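(* Let $\delta\in\mathbb Z/(p-1)\mathbb Z$ and let $F(T)\in\mathbb F_q(T)\cap\mathbb F_q[[T]]$. Then $\overline{\Gamma_\delta}(F(T))$ is a pseudo-rational function if and only if there exists an integer $n\ge0$ such that $$(1+T)^n\Big(\overline{U}(F(T))+(-1)^{\delta}\,\overline{U}\big(F((1+T)^{-1}-1)\big)\Big)\in\mathbb F_q[T].$$
   Context: Setting: $p$ is an odd prime, $K$ a finite extension of $\mathbb Q_p$, $O_K$ its valuation ring, $\pi$ a uniformizer, $\mathbb F_q=O_K/\pi O_K$, and $\Lambda=O_K[[T]]$. For $a\in\mathbb Z_p$, $(1+T)^a=\sum_k\binom ak T^k$. Put $\omega_n(T)=(1+T)^{p^n}-1$. $D(G)=(1+T)\frac{dG}{dT}$. $U(G)=G(T)-\frac1p\sum_{\zeta\in\mu_p}G(\zeta(1+T)-1)$ for $G\in\Lambda$; this lies in $\Lambda$. Fix a topological generator $\kappa$ of $1+p\mathbb Z_p$. For $s\in\mathbb Z_p$ and $n\ge0$, let $[s]_{n+1}\in\{0,\dots,p^{n+1}-1\}$ satisfy $[s]_{n+1}\equiv s\pmod{p^{n+1}}$. Put $k_n(s,\delta)=[s]_{n+1}+\delta_np^{n+1}$, where $\delta_n\in\{1,\dots,p-1\}$ and $[s]_{n+1}+\delta_n\equiv\delta\pmod{p-1}$. For $G\in\Lambda$, the $p$-adic Leopoldt transform $\Gamma_\delta(G)$ is the unique element of $\Lambda$ with $\Gamma_\delta(G)(\kappa^s-1)\equiv D^{k_n(s,\delta)}(G)(0)\pmod{p^{n+1}}$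 for all $s\in\mathbb Z_p$ and $n\ge0$; it is $O_K$-linear. For an $O_K$-linear map $g:\Lambda\to\Lambda$, $\overline g:\mathbb F_q[[T]]\to\mathbb F_q[[T]]$ is its reduction modulo $\pi$: apply $g$ to any lift and reduce. A pseudo-polynomial in $\mathbb F_q[[T]]$ is a finite sum $\sum c_i(1+T)^{a_i}$ with $c_i\in\mathbb F_q$, $a_i\in\mathbb Z_p$. A pseudo-rational function is a quotient $P/Q$ of pseudo-polynomials with $Q\ne0$. The sign $(-1)^\delta$ is well defined because $p-1$ is even. *)

(* Defs.v *)
From HB Require Import structures.
From mathcomp Require Import all_boot all_order all_algebra all_field.
From mathcomp Require Import boolp classical_sets.

Set Implicit Arguments.
Unset Strict Implicit.
Unset Printing Implicit Defensive.

Import Order.TTheory GRing.Theory Num.Theory.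
Local Open Scope ring_scope.

(* [zres a n] is the representative of [a] mod [p^n] in [0, p^n - 1], that is
   the number written [a]_n in the literature on the Leopoldt transform. *)
Record padic_int (p : nat) (p_pr : prime p) := PadicInt {
  zres :> nat -> nat;
  zres_mod : forall n, zres n = (zres n.+1 %% p ^ n)%N }.

Section PadicIntRing.
Variables (p : nat) (p_pr : prime p).
Local Notation Zp := (padic_int p_pr).
Implicit Types a b c : Zp.

HB.instance Definition _ := gen_eqMixin Zp.
HB.instance Definition _ := gen_choiceMixin Zp.

Lemma padic_intP a b : (forall n, a n = b n) -> a = b.
Proof.
case: a b => [f fP] [g gP] /= /funext fg; case: _ / fg gP => gP.
by congr PadicInt; exact: Prop_irrelevance.
Qed.

Lemma zres_le a k n : (k <= n)%N -> a k = (a n %% p ^ k)%N.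
Proof.
elim: n => [|n IHn].
  by rewrite leqn0 => /eqP->; rewrite zres_mod expn0 !modn1.
rewrite leq_eqVlt => /predU1P[->|/[!ltnS] kn].
  by rewrite zres_mod modn_mod.
by rewrite IHn// [a n]zres_mod modn_dvdm// dvdn_exp2l.
Qed.

Lemma zres_small a n : (a n %% p ^ n)%N = a n.
Proof. by rewrite -zres_le. Qed.

Lemma pexp_gt0 n : (0 < p ^ n)%N.
Proof. by rewrite expn_gt0 prime_gt0. Qed.

Let modpS m n : (m %% p ^ n.+1 %% p ^ n = m %% p ^ n)%N.
Proof. by rewrite modn_dvdm// dvdn_exp2l. Qed.

Definition zofnat (m : nat) : Zp.
Proof. by exists (fun n => m %% p ^ n)%N => n; rewrite modpS. Defined.

Definition zadd a b : Zp.
Proof.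
exists (fun n => (a n + b n) %% p ^ n)%N => n.
by rewrite modpS (zres_mod a) (zres_mod b) modnDm.
Defined.

Definition zmul a b : Zp.
Proof.
exists (fun n => (a n * b n) %% p ^ n)%N => n.
by rewrite modpS (zres_mod a) (zres_mod b) modnMm.
Defined.

Definition zopp a : Zp.
Proof.
exists (fun n => (p ^ n - a n) %% p ^ n)%N => n.
have le m : (a m <= p ^ m)%N by rewrite -zres_small ltnW// ltn_pmod// pexp_gt0.
apply/eqP; rewrite modpS -(eqn_modDr (a n)) subnK// modnn [a n]zres_mod.
by rewrite modnDmr subnK// expnS modnMl.
Defined.

Fact zaddA : associative zadd.
Proof. by move=> a b c; apply/padic_intP=> n /=; rewrite modnDml modnDmr addnA. Qed.
Fact zaddC : commutative zadd.
Proof. by move=> a b; apply/padic_intP=> n /=; rewrite addnC. Qed.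
Fact zadd0 : left_id (zofnat 0) zadd.
Proof. by move=> a; apply/padic_intP=> n /=; rewrite mod0n zres_small. Qed.
Fact zaddN : left_inverse (zofnat 0) zopp zadd.
Proof.
move=> a; apply/padic_intP=> n /=; rewrite modnDml subnK ?modnn ?mod0n//.
by rewrite -zres_small ltnW// ltn_pmod// pexp_gt0.
Qed.
Fact zmulA : associative zmul.
Proof. by move=> a b c; apply/padic_intP=> n /=; rewrite modnMml modnMmr mulnA. Qed.
Fact zmulC : commutative zmul.
Proof. by move=> a b; apply/padic_intP=> n /=; rewrite mulnC. Qed.
Fact zmul1 : left_id (zofnat 1) zmul.
Proof. by move=> a; apply/padic_intP=> n /=; rewrite modnMml mul1n zres_small. Qed.
Fact zmulD : left_distributive zmul zadd.
Proof.
move=> a b c; apply/padic_intP=> n /=.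
by rewrite modnMml modnDm mulnDl.
Qed.
Fact zone_neq0 : zofnat 1 != zofnat 0.
Proof.
apply/eqP => /(congr1 (fun a : Zp => a 1%N)) /=.
by rewrite expn1 mod0n modn_small// prime_gt1.
Qed.

HB.instance Definition _ := GRing.isZmodule.Build Zp zaddA zaddC zadd0 zaddN.
HB.instance Definition _ :=
  GRing.Zmodule_isComNzRing.Build Zp zmulA zmulC zmul1 zmulD zone_neq0.

Lemma zres0 n : (0 : Zp) n = 0%N.
Proof. exact: mod0n. Qed.

Lemma zresD a b n : (a + b) n = ((a n + b n) %% p ^ n)%N.
Proof. by []. Qed.

Lemma zresM a b n : (a * b) n = ((a n * b n) %% p ^ n)%N.
Proof. by []. Qed.

Lemma zres_neq0 a : a != 0 -> exists n, a n.+1 != 0%N.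
Proof.
move=> /eqP a0; apply: contrapT => h; apply: a0; apply/padic_intP => n.
rewrite zres0 zres_mod; suff -> : a n.+1 = 0%N by rewrite mod0n.
by apply/eqP/negPn/negP => an; apply: h; exists n.
Qed.

(* The [p]-adic valuation on [Z_p \ {0}]; junk value 0 at 0. *)
Definition zval a : nat :=
  if pselect (exists n, a n.+1 != 0%N) is left h then ex_minn h else 0%N.

Lemma zvalP a k : a != 0 -> (a k == 0%N) = (k <= zval a)%N.
Proof.
rewrite /zval => /zres_neq0; case: pselect => // h _.
case: ex_minnP => m am0 min_m; apply/idP/idP => [ak|km].
  rewrite leqNgt; apply: contra am0 => mk.
  by rewrite (zres_le _ mk) (eqP ak) mod0n.
case: k km => [|k km]; first by rewrite -zres_small expn0 modn1.
by apply/negPn; apply: contraL km => /min_m; rewrite -ltnS -leqNgt.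
Qed.

Let logn_zres a n : a != 0 -> (zval a < n)%N ->
  (0 < a n)%N /\ logn p (a n) = zval a.
Proof.
move=> a0 an; have an0 : (0 < a n)%N by rewrite lt0n zvalP// -ltnNge.
split => //; apply/eqP; rewrite eqn_leq; apply/andP; split.
  set l := logn p (a n); have [ln|nl] := leqP l n.
    by rewrite -zvalP// (zres_le _ ln) -[_ == _]/(_ %| _)%N pfactor_dvdn.
  have := ltn_pmod (a n) (pexp_gt0 n); rewrite zres_small ltnNge.
  by rewrite (dvdn_leq an0)// pfactor_dvdn// ltnW.
by rewrite -pfactor_dvdn// /dvdn -zres_le ?zvalP// ltnW.
Qed.

Fact zmul_eq0 a b : a * b = 0 -> (a == 0) || (b == 0).
Proof.
move=> ab0; apply/norP => -[a0 b0].
set n := (zval a + zval b).+1.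
have [a_gt0 la] := @logn_zres a n a0 (leq_addr _ _).
have [b_gt0 lb] := @logn_zres b n b0 (leq_addl _ _).
have := congr1 (fun c : Zp => c n) ab0; rewrite zresM zres0 => /eqP.
rewrite -[_ == _]/(_ %| _)%N pfactor_dvdn ?muln_gt0 ?a_gt0// lognM//.
by rewrite la lb ltnn.
Qed.

Lemma zvalM a b : a != 0 -> b != 0 -> zval (a * b) = (zval a + zval b)%N.
Proof.
move=> a0 b0.
have ab0 : a * b != 0.
  by apply/eqP => /zmul_eq0; rewrite (negPf a0) (negPf b0).
suff h k : (k <= zval (a * b)%R)%N = (k <= zval a + zval b)%N.
  by apply/eqP; rewrite eqn_leq -h leqnn h leqnn.
set n := (zval a + zval b + k).+1.
have [a_gt0 la] := @logn_zres a n a0 ltac:(by rewrite ltnS -addnA leq_addr).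
have [b_gt0 lb] :=
  @logn_zres b n b0 ltac:(by rewrite ltnS addnAC leq_addl).
rewrite -zvalP// (@zres_le _ k n) ?leqW ?leq_addl// zresM.
rewrite modn_dvdm; last by rewrite dvdn_exp2l// leqW ?leq_addl.
by rewrite -[_ == _]/(_ %| _)%N pfactor_dvdn ?muln_gt0 ?a_gt0// lognM// la lb.
Qed.

Lemma zvalD a b : a != 0 -> b != 0 -> a + b != 0 ->
  (minn (zval a) (zval b) <= zval (a + b)%R)%N.
Proof.
move=> a0 b0 ab0; rewrite -zvalP// zresD.
have /eqP-> : a (minn (zval a) (zval b)) == 0%N by rewrite zvalP// geq_minl.
have /eqP-> : b (minn (zval a) (zval b)) == 0%N by rewrite zvalP// geq_minr.
by rewrite mod0n.
Qed.

Definition zunit : {pred Zp} := fun a => `[< exists b, b * a = 1 >].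
Definition zinv a : Zp :=
  if pselect (exists b, b * a = 1) is left h then projT1 (cid h) else a.

Fact zmulVr : {in zunit, left_inverse 1 zinv *%R}.
Proof.
move=> a /asboolP ua; rewrite /zinv; case: pselect => // h.
by case: (cid h).
Qed.
Fact zunitP a b : b * a = 1 -> a \in zunit.
Proof. by move=> ba; apply/asboolP; exists b. Qed.
Fact zinv_out : {in [predC zunit], zinv =1 id}.
Proof. by move=> a /asboolP na; rewrite /zinv; case: pselect. Qed.

HB.instance Definition _ :=
  GRing.ComNzRing_hasMulInverse.Build Zp zmulVr zunitP zinv_out.
HB.instance Definition _ :=
  GRing.ComUnitRing_isIntegral.Build Zp zmul_eq0.

Definition zcvg (u : nat -> Zp) (l : Zp) : Prop :=
  forall m, exists N, forall n, (N <= n)%N -> u n m = l m.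

Definition zlim (u : nat -> Zp) : Zp := xget 0 [set l | zcvg u l]%classic.

(* [a ^ s] for [s] in [Z_p]; the limit exists when [a = 1 mod p]. *)
Definition zpow a (s : Zp) : Zp := zlim (fun n => a ^+ s n).

Definition zbin a (k : nat) : Zp :=
  xget 0 [set b | k`!%:R * b = \prod_(i < k) (a - i%:R)]%classic.

Definition topological_generator_1pZp (kappa : Zp) : Prop :=
  kappa 1%N = 1%N /\
  forall a, a 1%N = 1%N -> forall n, exists m : int, (kappa ^ m) n = a n.

End PadicIntRing.

(* The value at 0 is unconstrained: it stands for infinity, see [vge]. *)
Record valuation (E : fieldType) := Valuation {
  val_fun :> E -> int;
  valuationM : forall x y, x != 0 -> y != 0 ->
    val_fun (x * y) = val_fun x + val_fun y;
  valuationD : forall x y, x != 0 -> y != 0 -> x + y != 0 ->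
    Num.min (val_fun x) (val_fun y) <= val_fun (x + y);
  valuation_surj : exists2 x, x != 0 & val_fun x = 1 }.

Definition vge (E : fieldType) (v : valuation E) (m : int) (x : E) : bool :=
  (x == 0) || (m <= v x).

(* [w] restricts to [v] along [f], up to the ramification index [e]. *)
Definition extends (E E' : fieldType) (f : E -> E') (v : valuation E)
    (w : valuation E') : Prop :=
  exists2 e : nat, (0 < e)%N & forall x, x != 0 -> w (f x) = e%:Z * v x.

Definition vcvg (E : fieldType) (v : valuation E) (u : nat -> E) (l : E) :
    Prop :=
  forall m : int, exists N, forall n, (N <= n)%N -> vge v m (u n - l).

Section ValuationRing.
Variables (E : fieldType) (v : valuation E).

Definition valring_pred : {pred E} := vge v 0.

Fact valring_subring : subring_closed valring_pred.
Proof.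
have v1 : v 1 = 0.
  have := valuationM v (oner_neq0 E) (oner_neq0 E).
  by rewrite mulr1 => /eqP; rewrite -subr_eq subrr => /eqP.
have N10 : -1 != 0 :> E by rewrite oppr_eq0 oner_eq0.
have vN1 : v (-1) = 0.
  have := valuationM v N10 N10; rewrite mulrNN mulr1 v1 => /esym/eqP.
  by rewrite -mulr2n mulrn_eq0 => /eqP.
have mulP x y : x \in valring_pred -> y \in valring_pred ->
    x * y \in valring_pred.
  rewrite !unfold_in mulf_eq0.
  have [->|x0] := eqVneq x 0 => //=; have [->|y0] := eqVneq y 0 => //=.
  by move=> vx vy; rewrite valuationM// addr_ge0.
split=> // [|x y xO yO]; first by rewrite unfold_in /vge v1 lexx orbT.
have : -1 * y \in valring_pred.
  by apply: mulP => //; rewrite unfold_in /vge vN1 lexx orbT.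
rewrite mulN1r; move: (- y) xO => z; rewrite !unfold_in /vge.
have [->|x0] := eqVneq x 0; first by rewrite add0r.
have [->|z0] := eqVneq z 0; first by rewrite addr0 (negPf x0).
have [//|xz0 /= vx vz] := eqVneq (x + z) 0.
by apply: le_trans (valuationD v x0 z0 xz0); rewrite le_min vx.
Qed.

HB.instance Definition _ :=
  GRing.isSubringClosed.Build E valring_pred valring_subring.

Record valring := ValRing { valring_val : E; _ : valring_val \in valring_pred }.

HB.instance Definition _ := [isSub for valring_val].
HB.instance Definition _ := [Choice of valring by <:].
HB.instance Definition _ := [SubChoice_isSubComNzRing of valring by <:].

End ValuationRing.

Notation padic p_pr := {fraction (padic_int p_pr)}.

Section PadicValuation.
Variables (p : nat) (p_pr : prime p).
Local Notation Zp := (padic_int p_pr).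
Local Notation "x %:F" := (FracField.tofrac x).

Definition padic_val_fun (x : padic p_pr) : int :=
  (zval \n_(generic_quotient.repr x))%:Z - (zval \d_(generic_quotient.repr x))%:Z.

Lemma ratio_tofrac (r : {ratio Zp}) :
  (\pi r)%qT = (\n_r)%:F / (\d_r)%:F :> padic p_pr.
Proof.
have d0 := denom_ratioP r.
have dF0 : (\d_r)%:F != 0 by rewrite tofrac_eq0.
apply: (mulIf dF0); rewrite divfK//; unlock FracField.tofrac.
apply/etrans; first exact/esym/FracField.pi_mul.
apply/eqmodP; rewrite /= FracField.equivfE /FracField.mulf.
by rewrite !numden_Ratio ?mulf_neq0 ?oner_neq0// !mulr1 mulrC.
Qed.

Lemma padic_valE (a b : Zp) : a != 0 -> b != 0 ->
  padic_val_fun (a%:F / b%:F) = (zval a)%:Z - (zval b)%:Z.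
Proof.
move=> a0 b0; rewrite /padic_val_fun; set r := generic_quotient.repr _.
have d0 := denom_ratioP r.
have /eqP : (\n_r)%:F / (\d_r)%:F = a%:F / b%:F :> padic p_pr.
  by rewrite -ratio_tofrac /r generic_quotient.reprK.
rewrite eqr_div ?tofrac_eq0// -!tofracM tofrac_eq => /eqP e.
have n0 : \n_r != 0.
  apply/eqP => n0; move: e; rewrite n0 mul0r => /esym/eqP.
  by rewrite mulf_eq0 (negPf a0) (negPf d0).
move/(congr1 (fun c => (zval c)%:Z)): e.
rewrite !zvalM// !PoszD => e; apply/eqP.
by rewrite subr_eq addrAC eq_sym subr_eq e.
Qed.

Lemma fracP (x : padic p_pr) : x != 0 ->
  exists a b : Zp, [/\ a != 0, b != 0 & x = a%:F / b%:F].
Proof.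
elim/generic_quotient.quotW: x => r; rewrite ratio_tofrac => x0.
exists \n_r, \d_r; split => //; last exact: denom_ratioP.
by apply: contraNneq x0 => ->; rewrite tofrac0 mul0r.
Qed.

Fact padic_valM x y : x != 0 -> y != 0 ->
  padic_val_fun (x * y) = padic_val_fun x + padic_val_fun y.
Proof.
move=> /fracP[a [b [a0 b0 ->]]] /fracP[c [d [c0 d0 ->]]].
rewrite mulf_div -!tofracM !padic_valE ?mulf_neq0// !zvalM// !PoszD.
by rewrite opprD addrACA.
Qed.

Fact padic_valD x y : x != 0 -> y != 0 -> x + y != 0 ->
  Num.min (padic_val_fun x) (padic_val_fun y) <= padic_val_fun (x + y).
Proof.
move=> /fracP[a [b [a0 b0 ->]]] /fracP[c [d [c0 d0 ->]]].
rewrite addf_div ?tofrac_eq0// -!tofracM -tofracD => xy0.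
have s0 : a * d + c * b != 0.
  by apply: contraNneq xy0 => ->; rewrite tofrac0 mul0r.
rewrite !padic_valE ?mulf_neq0//.
have := zvalD (mulf_neq0 a0 d0) (mulf_neq0 c0 b0) s0.
rewrite !zvalM// => h; rewrite ge_min; apply/orP.
move: h; rewrite geq_min => /orP[h|h]; [left|right].
  by rewrite lerBrDr PoszD addrA subrK -PoszD lez_nat.
by rewrite lerBrDr PoszD [(zval b)%:Z + _]addrC addrA subrK -PoszD lez_nat.
Qed.

Fact padic_val_surj : exists2 x, x != 0 & padic_val_fun x = 1.
Proof.
have natE m n : (m%:R : Zp) n = (m %% p ^ n)%N.
  elim: m => [|m IHm]; first by rewrite zres0 mod0n.
  by rewrite -addn1 natrD zresD IHm /= modnDm.
have pE := natE p.
have p0 : p%:R != 0 :> Zp.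
  apply/eqP => /(congr1 (fun c : Zp => c 2)); rewrite pE zres0 => /eqP.
  rewrite modn_small ?eqn0Ngt ?prime_gt0//.
  by rewrite -{1}(expn1 p) ltn_exp2l// prime_gt1.
have one0 : 1 != 0 :> Zp := oner_neq0 _.
have v1 : zval (1 : Zp) = 0%N.
  by apply/eqP; rewrite -leqn0 leqNgt -zvalP//= expn1 modn_small// prime_gt1.
exists (p%:R%:F / 1%:F); first by rewrite tofrac1 divr1 tofrac_eq0.
rewrite padic_valE// v1 subr0; congr Posz; apply/eqP.
rewrite eqn_leq -zvalP// pE expn1 modnn andbT leqNgt -zvalP// pE.
rewrite modn_small ?eqn0Ngt ?prime_gt0//.
by rewrite -{1}(expn1 p) ltn_exp2l// prime_gt1.
Qed.

Definition padic_val : valuation (padic p_pr) :=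
  Valuation padic_valM padic_valD padic_val_surj.

End PadicValuation.

Record fps (R : Type) := FPS { coefs :> nat -> R }.

Lemma fpsP (R : Type) (f g : fps R) : (forall n, f n = g n) -> f = g.
Proof. by case: f g => [f] [g] /funext /= ->. Qed.

HB.instance Definition _ (R : Type) := gen_eqMixin (fps R).
HB.instance Definition _ (R : Type) := gen_choiceMixin (fps R).

Section FpsRing.
Variable R : comNzRingType.
Implicit Types f g h : fps R.

Definition fps_const (c : R) : fps R := FPS (fun n => if n == 0%N then c else 0).
Definition fps_X : fps R := FPS (fun n => (n == 1%N)%:R).
Definition fps_add f g : fps R := FPS (fun n => f n + g n).
Definition fps_opp f : fps R := FPS (fun n => - f n).
Definition fps_mul f g : fps R :=
  FPS (fun n => \sum_(i < n.+1) f i * g (n - i)%N).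

Fact fps_addA : associative fps_add.
Proof. by move=> f g h; apply/fpsP=> n; exact: addrA. Qed.
Fact fps_addC : commutative fps_add.
Proof. by move=> f g; apply/fpsP=> n; exact: addrC. Qed.
Fact fps_add0 : left_id (fps_const 0) fps_add.
Proof. by move=> f; apply/fpsP=> n /=; rewrite if_same add0r. Qed.
Fact fps_addN : left_inverse (fps_const 0) fps_opp fps_add.
Proof. by move=> f; apply/fpsP=> n /=; rewrite if_same addNr. Qed.

HB.instance Definition _ :=
  GRing.isZmodule.Build (fps R) fps_addA fps_addC fps_add0 fps_addN.

Let tr n f : {poly R} := \poly_(i < n) f i.

Let mulE n k f g : (k < n)%N -> fps_mul f g k = (tr n f * tr n g)`_k.
Proof.
move=> kn; rewrite coefM /=; apply: eq_bigr => i _; rewrite !coef_poly.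
by rewrite (leq_ltn_trans _ kn) ?leq_ord// (leq_ltn_trans _ kn)// leq_subr.
Qed.

Let coef_mul_eq (p q r : {poly R}) n :
  (forall i, (i <= n)%N -> p`_i = q`_i) -> (p * r)`_n = (q * r)`_n.
Proof.
by move=> pq; rewrite !coefM; apply: eq_bigr => i _; rewrite pq// leq_ord.
Qed.

Let tr_mul n f g i : (i < n)%N -> (tr n (fps_mul f g))`_i = (tr n f * tr n g)`_i.
Proof. by move=> ilt; rewrite coef_poly ilt (mulE _ _ ilt). Qed.

Fact fps_mulC : commutative fps_mul.
Proof. by move=> f g; apply/fpsP=> n; rewrite !(mulE _ _ (ltnSn n)) mulrC. Qed.
Fact fps_mulA : associative fps_mul.
Proof.
move=> f g h; apply/fpsP=> n; rewrite !(mulE _ _ (ltnSn n)) mulrC.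
have trE u w i : (i <= n)%N ->
  (tr n.+1 (fps_mul u w))`_i = (tr n.+1 u * tr n.+1 w)`_i.
  by move=> le_in; apply: tr_mul; rewrite ltnS.
by rewrite (coef_mul_eq _ (trE g h)) (coef_mul_eq _ (trE f g)) mulrC mulrA.
Qed.
Fact fps_mul1 : left_id (fps_const 1) fps_mul.
Proof.
move=> f; apply/fpsP=> n /=; rewrite big_ord_recl/= mul1r subn0 big1 ?addr0//.
by move=> i _; rewrite mul0r.
Qed.
Fact fps_mulD : left_distributive fps_mul fps_add.
Proof.
move=> f g h; apply/fpsP=> n /=; rewrite -big_split /=.
by apply: eq_bigr => i _; rewrite mulrDl.
Qed.
Fact fps_1neq0 : fps_const 1 != 0.
Proof.
by apply/eqP => /(congr1 (fun f : fps R => f 0%N)) /eqP; rewrite oner_eq0.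
Qed.

HB.instance Definition _ :=
  GRing.Zmodule_isComNzRing.Build (fps R)
    fps_mulA fps_mulC fps_mul1 fps_mulD fps_1neq0.

Definition fps_of_poly (P : {poly R}) : fps R := FPS (fun n => P`_n).

Definition fps_deriv f : fps R := FPS (fun n => f n.+1 *+ n.+1).

Definition fps_D f : fps R := (1 + fps_X) * fps_deriv f.

(* [f(g(T))] for [g] without constant term, so that only the powers [g ^+ i]
   with [i <= n] contribute to the coefficient of [T ^ n]. *)
Definition fps_comp f g : fps R :=
  FPS (fun n => \sum_(i < n.+1) f i * (g ^+ i) n).

Definition fps_inv1X : fps R := FPS (fun n => (-1) ^+ n).

Lemma fps_inv1XE : (1 + fps_X) * fps_inv1X = 1.
Proof.
apply/fpsP => -[|n] /=.
  by rewrite big_ord1/= addr0 mul1r expr0.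
rewrite !big_ord_recl big1 => [|i _] /=; last first.
  by rewrite /bump /= add0r mul0r.
rewrite /bump /= !addn0 !add0r ?addr0 !mul1r subn0 subSS subn0 exprS mulN1r.
by rewrite addNr.
Qed.

Definition is_poly f : Prop := exists P : {poly R}, f = fps_of_poly P.

Definition is_rational f : Prop :=
  exists P Q : {poly R}, Q != 0 /\ fps_of_poly Q * f = fps_of_poly P.

End FpsRing.

Arguments fps_X {R}.
Arguments fps_inv1X {R}.

Definition fps_map (R S : Type) (h : R -> S) (f : fps R) : fps S :=
  FPS (fun n => h (f n)).

Section Pseudo.
Variables (p : nat) (p_pr : prime p) (F : finFieldType).
Local Notation Zp := (padic_int p_pr).

(* [(1 + T) ^ a] for [F] of characteristic [p]: a p-adic integer acts on [F]
   through [Z_p -> Z/p -> F]. *)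
Definition fps_1Xpow (a : Zp) : fps F := FPS (fun k => (zbin a k 1%N)%:R).

Definition pseudo_polynomial (f : fps F) : Prop :=
  exists s : seq (F * Zp), f = \sum_(ca <- s) fps_const ca.1 * fps_1Xpow ca.2.

Definition pseudo_rational (f : fps F) : Prop :=
  exists P Q, [/\ pseudo_polynomial P, pseudo_polynomial Q, Q != 0 & Q * f = P].

End Pseudo.

Section Reduction.
Variables (O F : comNzRingType) (red : O -> F).

Definition red_lift (c : F) : O := xget 0 [set x | red x = c]%classic.

(* [overline g]: apply [g] to a coefficientwise lift and reduce. *)
Definition fps_overline (g : fps O -> fps O) (f : fps F) : fps F :=
  fps_map red (g (fps_map red_lift f)).

End Reduction.

Section Operators.
Variables (p : nat) (p_pr : prime p).
Variables (K : fieldExtType (padic p_pr)) (v : valuation K).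
Local Notation Zp := (padic_int p_pr).
Local Notation Lambda := (fps (valring v)).

(* [B = G(A)], each coefficient being a convergent series; the constant term of
   [A] need not vanish. *)
Definition fps_subst (E : fieldType) (w : valuation E) (G A B : fps E) : Prop :=
  forall k, vcvg w (fun N => \sum_(i < N) G i * (A ^+ i) k) (B k).

Definition fps_value (E : fieldType) (w : valuation E) (G : fps E) (x y : E) :
    Prop :=
  vcvg w (fun N => \sum_(i < N) G i * x ^+ i) y.

(* [H = U(G)], computed in an extension [L] of [K] in which [z] is a primitive
   [p]-th root of unity, so that [mu_p] consists of the [z ^+ j], [j < p]. *)
Definition is_U (L : fieldExtType K) (w : valuation L) (z : L) (G H : Lambda) :
    Prop :=
  let toL (f : Lambda) := fps_map (fun c : valring v => (\val c)%:A : L) f in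
  exists B : 'I_p -> fps L,
    (forall j : 'I_p,
      fps_subst w (toL G) (fps_const (z ^+ j) * (1 + fps_X) - 1) (B j)) /\
    toL H = toL G - fps_const (p%:R^-1) * \sum_j B j.

(* [k = k_n(s, delta)] *)
Definition leopoldt_exponent (delta : 'Z_p.-1) (s : Zp) (n k : nat) : Prop :=
  exists d : nat,
    [/\ (0 < d < p)%N, s n.+1 + d = delta %[mod p.-1]
      & k = s n.+1 + d * p ^ n.+1]%N.

(* [H] is the [p]-adic Leopoldt transform of [G]: the value [y] of [H] at
   [kappa ^ s - 1] is congruent to [D ^ k (G) (0)] modulo [p ^ n.+1] in [O_K],
   for [k = k_n(s, delta)]. *)
Definition is_leopoldt (kappa : Zp) (delta : 'Z_p.-1) (G H : Lambda) : Prop :=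
  forall (s : Zp) (n k : nat), leopoldt_exponent delta s n k ->
    exists2 y : valring v,
      fps_value v (fps_map \val H)
        ((FracField.tofrac (zpow kappa s - 1))%:A) (\val y)
      & exists r, y - iter k (@fps_D _) G 0%N = p%:R ^+ n.+1 * r.

End Operators.

(* Main.v *)
Require Import Defs.
From HB Require Import structures.
From mathcomp Require Import all_boot all_order all_algebra all_field.
From mathcomp Require Import cyclic.
From mathcomp Require Import boolp classical_sets.
From mathcomp Require Import zify ring.

Set Implicit Arguments.
Unset Strict Implicit.
Unset Printing Implicit Defensive.

Import Order.TTheory GRing.Theory Num.Theory.
Local Open Scope ring_scope.

(** Put [x = 1 + T] and read a power series over [F_q] as a measure on [Z_p], the series
    [x^a] being the Dirac mass at [a]; a continuous linear operator is determined by its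
    values on the [x^a]. Modulo [pi], the operator [U] is the restriction to [Z_p^*], and
    [Gamma_delta] kills [x^a] for [p | a] and maps [x^(w * kappa^l)] to [w^delta x^l] for
    [w^(p-1) = 1]. To see this without any completeness argument, note that a series over
    [O_K] is determined modulo [(pi, T^R)] by its values at [R] points to a finite precision.

    Let [H] be the series [U(F) + (-1)^delta U(F(x^-1 - 1))]. Since [Gamma_delta(H)] is
    [2 Gamma_delta(F)], the latter is a pseudo-polynomial as soon as [H] is a Laurent
    polynomial in [x]. Conversely, let [Q Gamma_delta(F) = P], and let [Psi] map [x^l] to the
    sum of the [w^(-delta) x^(w * kappa^l)]. Applying [Psi] gives a relation
    [\sum_j c_j H(x^alpha_j) = P'] with [P'] a pseudo-polynomial, [c_j <> 0] and the [alpha_j]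
    distinct up to sign. By Dirichlet's approximation theorem some unit multiple of the
    [alpha_j] and of the exponents of [P'] is congruent modulo [p^M] to integers [n_j] that
    are small with respect to [p^M], so that the relation modulo [T^(p^M)] becomes an
    identity between rational functions of [x]. Modulo Laurent polynomials [H] is
    [a(x) / (1 - x^d)], and the expansion of [\sum_j c_j H(x^n_j)] is a Dirichlet
    convolution, which cannot vanish unless [a = 0]. *)

(** * Formal power series and substitution *)

(** The exponents [alpha_j] being p-adic, the relation given by [Psi] lives in power series around
    [x = 1]. Once the exponents are integers [n_j] and denominators are cleared, degrees are of the
    order of [d * #|J| * max |n_j|]; the approximation has to keep this below [p^M], which fixes its
    quality. The resulting identity of fractions can then be expanded at [X = 0], where the
    substitution of [X^m] for [X] merely dilates the indices and where a fraction with denominator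
    [1 - X^d] has periodic coefficients. That denominator is general enough because [F_q] is finite.

    The integers [n_j] may be negative, so the fraction is carried together with its image under
    [x -> x^-1], the two being indexed by a boolean. The multiplier of the exponents has to be a
    unit, so that it preserves the valuations of the [alpha_j - alpha_j'] and [alpha_j + alpha_j'];
    with [M] larger than these, the [|n_j|] stay distinct. Grouping [w] with [-w] in the image of
    [Psi] removes opposite exponents, and makes the combination of [U(F)] and its reflection
    appear. *)

Lemma poly_shiftK (R : comNzRingType) (P : {poly R}) :
  (P \Po ('X + 1)) \Po ('X - 1) = P.
Proof. by rewrite -comp_polyA rmorphD rmorph1 /= comp_polyX subrK comp_polyXr. Qed.

Lemma poly_unshiftK (R : comNzRingType) (P : {poly R}) :
  (P \Po ('X - 1)) \Po ('X + 1) = P.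
Proof. by rewrite -comp_polyA rmorphB rmorph1 /= comp_polyX addrK comp_polyXr. Qed.

Section FpsCoef.
Variable R : comNzRingType.
Implicit Types (f g : fps R) (c : R).

Lemma fps_coefD f g n : (f + g) n = f n + g n. Proof. by []. Qed.
Lemma fps_coefN f n : (- f) n = - f n. Proof. by []. Qed.
Lemma fps_coefM f g n : (f * g) n = \sum_(i < n.+1) f i * g (n - i)%N.
Proof. by []. Qed.
Lemma fps_coef0 n : (0 : fps R) n = 0. Proof. exact: if_same. Qed.
Lemma fps_coef1 n : (1 : fps R) n = (n == 0)%:R.
Proof. by rewrite /=; case: eqP. Qed.

Lemma fps_coef_sum (I : Type) (r : seq I) (P : pred I) (h : I -> fps R) n :
  (\sum_(i <- r | P i) h i) n = \sum_(i <- r | P i) h i n.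
Proof. by elim/big_rec2: _ => [|i x y _ <-]; rewrite ?fps_coef0. Qed.

Lemma fps_coefC c f n : (fps_const c * f) n = c * f n.
Proof.
rewrite fps_coefM big_ord_recl subn0 big1 ?addr0// => i _.
by rewrite /= mul0r.
Qed.

Lemma fps_coefXM f n : (fps_X * f) n = if n is m.+1 then f m else 0.
Proof.
rewrite fps_coefM; case: n => [|n]; first by rewrite big_ord1 mul0r.
rewrite !big_ord_recl big1 ?addr0 => [|i _]; last by rewrite mul0r.
by rewrite mul0r add0r mul1r subSS subn0.
Qed.

Lemma fps_coefXnM f k n :
  (fps_X ^+ k * f) n = if (k <= n)%N then f (n - k)%N else 0.
Proof.
elim: k n => [|k IHk] n; first by rewrite mul1r subn0.
by rewrite exprS -mulrA fps_coefXM; case: n => // n; rewrite IHk.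
Qed.

Fact fps_const_additive : zmod_morphism (@fps_const R).
Proof. by move=> c d; apply/fpsP=> -[|n] //=; rewrite subr0. Qed.
Fact fps_const_multiplicative : monoid_morphism (@fps_const R).
Proof.
split=> // c d; apply/fpsP=> n; rewrite fps_coefC /=.
by case: eqP => // _; rewrite mulr0.
Qed.
HB.instance Definition _ :=
  GRing.isZmodMorphism.Build R (fps R) (@fps_const R) fps_const_additive.
HB.instance Definition _ :=
  GRing.isMonoidMorphism.Build R (fps R) (@fps_const R) fps_const_multiplicative.

Fact fps_of_poly_additive : zmod_morphism (@fps_of_poly R).
Proof. by move=> P Q; apply/fpsP=> n /=; rewrite coefB. Qed.
Fact fps_of_poly_multiplicative : monoid_morphism (@fps_of_poly R).
Proof.
split=> [|P Q]; apply/fpsP=> n; first by rewrite fps_coef1 /= coef1.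
by rewrite fps_coefM /= coefM.
Qed.
HB.instance Definition _ :=
  GRing.isZmodMorphism.Build {poly R} (fps R) (@fps_of_poly R)
    fps_of_poly_additive.
HB.instance Definition _ :=
  GRing.isMonoidMorphism.Build {poly R} (fps R) (@fps_of_poly R)
    fps_of_poly_multiplicative.

Lemma fps_of_polyC c : fps_of_poly c%:P = fps_const c.
Proof. by apply/fpsP=> n /=; rewrite coefC. Qed.
Lemma fps_of_polyX : fps_of_poly 'X = fps_X :> fps R.
Proof. by apply/fpsP=> n /=; rewrite coefX. Qed.

Lemma fps_natE n : n%:R = fps_const n%:R :> fps R.
Proof. by rewrite rmorph_nat. Qed.

(** The argument [y] may have a constant term, since only polynomials are evaluated; the case of
    interest is [y = 1 + fps_X], that is, polynomials in [x]. *)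
Definition fps_eval (y : fps R) (P : {poly R}) : fps R :=
  (map_poly (@fps_const R) P).[y].

Fact fps_eval_additive y : zmod_morphism (fps_eval y).
Proof. by move=> P Q; rewrite /fps_eval rmorphB hornerD hornerN. Qed.
Fact fps_eval_multiplicative y : monoid_morphism (fps_eval y).
Proof.
by split=> [|P Q]; rewrite /fps_eval ?rmorph1 ?hornerC// rmorphM hornerM.
Qed.
HB.instance Definition _ y :=
  GRing.isZmodMorphism.Build {poly R} (fps R) (fps_eval y)
    (fps_eval_additive y).
HB.instance Definition _ y :=
  GRing.isMonoidMorphism.Build {poly R} (fps R) (fps_eval y)
    (fps_eval_multiplicative y).

Lemma fps_evalC y c : fps_eval y c%:P = fps_const c.
Proof. by rewrite /fps_eval map_polyC hornerC. Qed.
Lemma fps_evalX y : fps_eval y 'X = y.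
Proof. by rewrite /fps_eval map_polyX hornerX. Qed.
Lemma fps_evalXn y n : fps_eval y 'X^n = y ^+ n.
Proof. by rewrite rmorphXn /= fps_evalX. Qed.
Lemma fps_evalE y P : fps_eval y P = \sum_(i < size P) fps_const P`_i * y ^+ i.
Proof.
rewrite -{1}[P]coefK poly_def rmorph_sum; apply: eq_bigr => i _.
by rewrite -mul_polyC rmorphM /= fps_evalC fps_evalXn.
Qed.

Lemma fps_eval_comp y P Q : fps_eval y (P \Po Q) = fps_eval (fps_eval y Q) P.
Proof. by rewrite /fps_eval map_comp_poly horner_comp. Qed.

Lemma fps_of_polyE P : fps_of_poly P = fps_eval fps_X P.
Proof.
rewrite fps_evalE -{1}[P]coefK poly_def rmorph_sum; apply: eq_bigr => i _.
by rewrite -mul_polyC rmorphM /= fps_of_polyC rmorphXn /= fps_of_polyX.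
Qed.

Lemma fps_of_polyE1X P :
  fps_of_poly P = fps_eval (1 + fps_X) (P \Po ('X - 1)).
Proof.
by rewrite fps_of_polyE fps_eval_comp rmorphB rmorph1 /= fps_evalX addrC addKr.
Qed.

Lemma fps_eval1XE P : fps_eval (1 + fps_X) P = fps_of_poly (P \Po ('X + 1)).
Proof.
by rewrite fps_of_polyE fps_eval_comp rmorphD rmorph1 /= fps_evalX addrC.
Qed.

End FpsCoef.

Section FpsMap.
Variables (R S : comNzRingType) (h : {rmorphism R -> S}).

Fact fps_map_additive : zmod_morphism (fps_map h).
Proof. by move=> f g; apply/fpsP=> n /=; rewrite rmorphB. Qed.
Fact fps_map_multiplicative : monoid_morphism (fps_map h).
Proof.
split=> [|f g]; apply/fpsP=> n; first by rewrite /=; case: eqP; rewrite ?rmorph1 ?rmorph0.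
by rewrite [LHS]rmorph_sum fps_coefM; apply: eq_bigr => i _; rewrite rmorphM.
Qed.
HB.instance Definition _ :=
  GRing.isZmodMorphism.Build (fps R) (fps S) (fps_map h) fps_map_additive.
HB.instance Definition _ :=
  GRing.isMonoidMorphism.Build (fps R) (fps S) (fps_map h) fps_map_multiplicative.

Lemma fps_map_const c : fps_map h (fps_const c) = fps_const (h c).
Proof. by apply/fpsP=> -[|n] //=; rewrite rmorph0. Qed.
Lemma fps_map_X : fps_map h fps_X = fps_X.
Proof. by apply/fpsP=> n /=; rewrite rmorph_nat. Qed.
End FpsMap.

(** * Congruences modulo T^N and continuous linear operators *)

Section Truncation.
Variable R : comNzRingType.
Implicit Types (f g : fps R) (A B : fps R -> fps R).

Definition eqT N f g := forall i, (i < N)%N -> f i = g i.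

Lemma eqT_refl N f : eqT N f f. Proof. by []. Qed.
Lemma eqT_sym N f g : eqT N f g -> eqT N g f.
Proof. by move=> fg i /fg. Qed.
Lemma eqT_trans N f g h : eqT N f g -> eqT N g h -> eqT N f h.
Proof. by move=> fg gh i iN; rewrite fg// gh. Qed.
Lemma eqTW M N f g : (M <= N)%N -> eqT N f g -> eqT M f g.
Proof. by move=> MN fg i iM; apply: fg; apply: leq_trans MN. Qed.
Lemma eqT_eq f g : (forall N, eqT N f g) -> f = g.
Proof. by move=> fg; apply/fpsP=> n; apply: (fg n.+1). Qed.
Lemma eqTD N f g f' g' : eqT N f g -> eqT N f' g' -> eqT N (f + f') (g + g').
Proof. by move=> fg fg' i iN; rewrite !fps_coefD fg// fg'. Qed.
Lemma eqTN N f g : eqT N f g -> eqT N (- f) (- g).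
Proof. by move=> fg i iN; rewrite !fps_coefN fg. Qed.
Lemma eqTM N f g f' g' : eqT N f g -> eqT N f' g' -> eqT N (f * f') (g * g').
Proof.
move=> fg fg' i iN; rewrite !fps_coefM; apply: eq_bigr => j _.
have ji := ltn_ord j; rewrite fg ?fg'//.
  by rewrite (leq_ltn_trans _ iN) ?leq_subr.
by rewrite (leq_ltn_trans _ iN).
Qed.
Lemma eqTX N f g k : eqT N f g -> eqT N (f ^+ k) (g ^+ k).
Proof. by move=> fg; elim: k => // k IHk; rewrite !exprS; apply: eqTM. Qed.
Lemma eqT_sum N (I : Type) (r : seq I) (P : pred I) (h h' : I -> fps R) :
  (forall i, P i -> eqT N (h i) (h' i)) ->
  eqT N (\sum_(i <- r | P i) h i) (\sum_(i <- r | P i) h' i).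
Proof. by move=> hh'; elim/big_rec2: _ => // i x y /hh'; apply: eqTD. Qed.
Lemma eqT_prod N (I : Type) (r : seq I) (P : pred I) (h h' : I -> fps R) :
  (forall i, P i -> eqT N (h i) (h' i)) ->
  eqT N (\prod_(i <- r | P i) h i) (\prod_(i <- r | P i) h' i).
Proof. by move=> hh'; elim/big_rec2: _ => // i x y /hh'; apply: eqTM. Qed.
Lemma eqT_eval N f g (P : {poly R}) :
  eqT N f g -> eqT N (fps_eval f P) (fps_eval g P).
Proof.
move=> fg; rewrite !fps_evalE; apply: eqT_sum => i _.
by apply: eqTM => //; apply: eqTX.
Qed.

Lemma eqT_trunc N f : eqT N f (fps_of_poly (\poly_(i < N) f i)).
Proof. by move=> i iN; rewrite /= coef_poly iN. Qed.

Lemma eqT_XnM N f : eqT N (fps_X ^+ N * f) 0.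
Proof. by move=> i iN; rewrite fps_coefXnM leqNgt iN fps_coef0. Qed.

Lemma eqT_dvdXn N f : eqT N f 0 -> exists g, f = fps_X ^+ N * g.
Proof.
move=> f0; exists (FPS (fun n => f (n + N)%N)); apply/fpsP=> n.
by rewrite fps_coefXnM /=; case: leqP => [/subnK-> //|/f0->]; rewrite fps_coef0.
Qed.

Definition fps_linear A :=
  forall c f g, A (fps_const c * f + g) = fps_const c * A f + A g.

(** Uniform continuity for the [T]-adic topology; a linear operator has it as soon as it is
    continuous at 0. *)
Definition fps_continuous A :=
  forall M, exists N, forall f g, eqT N f g -> eqT M (A f) (A g).

Section Linear.
Variables (A : fps R -> fps R) (linA : fps_linear A).
Lemma fps_linear0 : A 0 = 0.
Proof.
have := linA 1 0 0; rewrite rmorph1 !mul1r addr0 => /eqP.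
by rewrite -subr_eq subrr eq_sym => /eqP.
Qed.
Lemma fps_linearD f g : A (f + g) = A f + A g.
Proof. by have := linA 1 f g; rewrite rmorph1 !mul1r. Qed.
Lemma fps_linearZ c f : A (fps_const c * f) = fps_const c * A f.
Proof. by have := linA c f 0; rewrite fps_linear0 !addr0. Qed.
Lemma fps_linear_sum (I : Type) (r : seq I) (P : pred I) (h : I -> fps R) :
  A (\sum_(i <- r | P i) h i) = \sum_(i <- r | P i) A (h i).
Proof.
elim/big_rec2: _ => [|i x y _ <-]; first exact: fps_linear0.
exact: fps_linearD.
Qed.
Lemma fps_linear_continuous :
  (forall M, exists N, forall f, eqT N f 0 -> eqT M (A f) 0) ->
  fps_continuous A.
Proof.
move=> h M; have [N hN] := h M; exists N => f g fg.
have : eqT N (f - g) 0 by move=> i iN; rewrite fps_coefD fps_coefN fg// subrr fps_coef0.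
move/hN => h0; rewrite -(subrK g f) fps_linearD.
by move=> i iM; rewrite fps_coefD h0// fps_coef0 add0r.
Qed.
Lemma fps_linear_eval y P : A (fps_eval y P) =
  \sum_(i < size P) fps_const P`_i * A (y ^+ i).
Proof.
by rewrite fps_evalE fps_linear_sum; apply: eq_bigr => i _; rewrite fps_linearZ.
Qed.
End Linear.

(* The powers of [1 + T] span a dense subspace. *)
Lemma fps_linear_ext A B :
  fps_linear A -> fps_continuous A -> fps_linear B -> fps_continuous B ->
  (forall a : nat, A ((1 + fps_X) ^+ a) = B ((1 + fps_X) ^+ a)) -> A =1 B.
Proof.
move=> linA ctsA linB ctsB AB f; apply: eqT_eq => M.
have [N hN] := ctsA M; have [N' hN'] := ctsB M.
have t := @eqT_trunc (maxn N N') f.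
apply: eqT_trans (hN _ _ (eqTW (leq_maxl N N') t)) _.
apply/eqT_sym/eqT_trans/eqT_sym; first exact: hN' _ _ (eqTW (leq_maxr N N') t).
rewrite fps_of_polyE1X !fps_linear_eval//.
by apply: eqT_sum => i _; rewrite AB.
Qed.

Lemma fps_linear_comp A B :
  fps_linear A -> fps_linear B -> fps_linear (fun f => A (B f)).
Proof. by move=> linA linB c f g; rewrite linB linA. Qed.
Lemma fps_continuous_comp A B :
  fps_continuous A -> fps_continuous B -> fps_continuous (fun f => A (B f)).
Proof.
move=> cA cB M; have [N hN] := cA M; have [N' hN'] := cB N.
by exists N' => f g /hN'/hN.
Qed.
Lemma fps_linear_mul h : fps_linear (fun f => h * f).
Proof. by move=> c f g; rewrite mulrDr mulrCA. Qed.
Lemma fps_continuous_mul h : fps_continuous (fun f => h * f).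
Proof. by move=> M; exists M => f g fg; apply: eqTM. Qed.
Lemma fps_linear_bigsum (I : Type) (r : seq I) (A : I -> fps R -> fps R) :
  (forall i, fps_linear (A i)) -> fps_linear (fun f => \sum_(i <- r) A i f).
Proof.
move=> linA c f g; rewrite mulr_sumr -big_split /=.
by apply: eq_bigr => i _; rewrite linA.
Qed.
Lemma fps_continuous_bigsum (I : eqType) (r : seq I) (A : I -> fps R -> fps R) :
  (forall i, fps_continuous (A i)) ->
  fps_continuous (fun f => \sum_(i <- r) A i f).
Proof.
move=> cA M; elim: r => [|i r [N IHr]].
  by exists 0%N => f g _; rewrite !big_nil.
have [N' hN'] := cA i M; exists (maxn N N') => f g fg; rewrite !big_cons.
apply: eqTD; first by apply: hN'; apply: eqTW fg; apply: leq_maxr.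
by apply: IHr; apply: eqTW fg; apply: leq_maxl.
Qed.

End Truncation.

Section Substitution.
Variable R : comNzRingType.
Implicit Types (f g : fps R).

Lemma fps_pow_low g k n : g 0%N = 0 -> (n < k)%N -> (g ^+ k) n = 0.
Proof.
move=> g0; have : eqT 1 g 0 by case=> // _; rewrite g0 fps_coef0.
case/eqT_dvdXn => h -> nk; rewrite expr1 exprMn fps_coefXnM leqNgt nk//.
Qed.

Lemma fps_compE f g n : fps_comp f g n = \sum_(i < n.+1) f i * (g ^+ i) n.
Proof. by []. Qed.

Lemma fps_comp_coef N f g n : g 0%N = 0 -> (n < N)%N ->
  fps_comp f g n = \sum_(i < N) f i * (g ^+ i) n.
Proof.
move=> g0 nN; rewrite /=.
rewrite (big_ord_widen N (fun i => f i * (g ^+ i) n)) // big_mkcond.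
by apply: eq_bigr => i _; case: ltnP => // ni; rewrite fps_pow_low// mulr0.
Qed.

Lemma fps_comp_linear g : fps_linear (fun f : fps R => fps_comp f g).
Proof.
move=> c f f'; apply/fpsP=> n; rewrite fps_coefD fps_coefC !fps_compE mulr_sumr.
rewrite -big_split; apply: eq_bigr => i _.
by rewrite fps_coefD fps_coefC mulrDl mulrA.
Qed.

Lemma fps_comp_eqT g N f f' :
  eqT N f f' -> eqT N (fps_comp f g) (fps_comp f' g).
Proof.
move=> ff' n nN /=; apply: eq_bigr => i _; rewrite ff'//.
by rewrite (leq_trans _ nN) // ltnS -ltnS.
Qed.

Lemma fps_comp_continuous g : fps_continuous (fun f : fps R => fps_comp f g).
Proof. by move=> M; exists M => f f'; apply: fps_comp_eqT. Qed.

Lemma fps_comp_XM g f : g 0%N = 0 -> fps_comp (fps_X * f) g = g * fps_comp f g.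
Proof.
move=> g0; apply/fpsP=> n.
(* [n.+2] terms are taken, since the term of index 0 vanishes and the others shift down by one. *)
rewrite (@fps_comp_coef n.+2)// big_ord_recl fps_coefXM mul0r add0r.
transitivity (\sum_(i < n.+1) f i * (g * g ^+ i) n).
  by apply: eq_bigr => i _; rewrite lift0 fps_coefXM exprS.
rewrite fps_coefM.
under [RHS]eq_bigr => j _.
  rewrite (@fps_comp_coef n.+1)//; last by rewrite ltnS leq_subr.
  rewrite mulr_sumr; over.
rewrite exchange_big; apply: eq_bigr => i _; rewrite fps_coefM mulr_sumr.
by apply: eq_bigr => j _; rewrite mulrCA.
Qed.

Lemma fps_comp_1XM g f : g 0%N = 0 ->
  fps_comp ((1 + fps_X) * f) g = (1 + g) * fps_comp f g.
Proof.
move=> g0; rewrite mulrDl mul1r (fps_linearD (@fps_comp_linear g)).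
by rewrite fps_comp_XM// mulrDl mul1r.
Qed.

Lemma fps_comp1 g : fps_comp 1 g = 1.
Proof.
apply/fpsP=> n /=; rewrite big_ord_recl big1 ?addr0 ?mul1r//= => i _.
by rewrite mul0r.
Qed.

Lemma fps_comp_1XnM g f a : g 0%N = 0 ->
  fps_comp ((1 + fps_X) ^+ a * f) g = (1 + g) ^+ a * fps_comp f g.
Proof.
move=> g0; elim: a => [|a IHa]; first by rewrite !mul1r.
by rewrite !exprS -!mulrA fps_comp_1XM// IHa.
Qed.

Lemma fps_comp_1Xn g a : g 0%N = 0 ->
  fps_comp ((1 + fps_X) ^+ a) g = (1 + g) ^+ a.
Proof. by move=> g0; rewrite -[X in fps_comp X]mulr1 fps_comp_1XnM// fps_comp1 mulr1. Qed.

Lemma fps_comp_evalM g f P : g 0%N = 0 ->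
  fps_comp (fps_eval (1 + fps_X) P * f) g = fps_eval (1 + g) P * fps_comp f g.
Proof.
move=> g0; rewrite !fps_evalE !mulr_suml (fps_linear_sum (@fps_comp_linear g)).
apply: eq_bigr => i _.
by rewrite -!mulrA (fps_linearZ (@fps_comp_linear g)) fps_comp_1XnM.
Qed.

End Substitution.

Section FpsDomain.
Variable F : idomainType.

(** With [k] the order of [f], the coefficient of index [k + n] of the product is [f k * g n] once
    the lower coefficients of [g] are known to vanish. *)
Lemma fps_mul_eq0 (f g : fps F) : f * g = 0 -> f = 0 \/ g = 0.
Proof.
move=> fg0; have [->|/eqP f0] := eqVneq f 0; [by left|right].
have [|k fk min_k] := @ex_minnP (fun k => f k != 0).
  apply: contrapT => h; apply: f0; apply/fpsP=> n; rewrite fps_coef0.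
  by apply/eqP/negPn/negP => fn; apply: h; exists n.
apply/fpsP=> n; rewrite fps_coef0; elim/ltn_ind: n => n IHn.
have := congr1 (fun h : fps F => h (k + n)%N) fg0.
have ok : (k < (k + n).+1)%N by rewrite ltnS leq_addr.
rewrite fps_coefM fps_coef0 (bigD1 (Ordinal ok))//= addKn big1 ?addr0.
  by move/eqP; rewrite mulf_eq0 (negPf fk) => /eqP.
move=> i ik; have {ik} ik : (i != k :> nat) by [].
have [ki|ki] := ltnP k i; first by rewrite IHn ?mulr0//; have := ltn_ord i; lia.
have : (i < k)%N by rewrite ltn_neqAle ik.
have [->|/min_k] := eqVneq (f i) 0; first by rewrite mul0r.
by move=> h1 h2; have := leq_ltn_trans h1 h2; rewrite ltnn.
Qed.

End FpsDomain.

(** * p-adic integers and the series (1 + T)^a *)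

Section PadicIntegers.
Variables (p : nat) (p_pr : prime p).
Local Notation Zp := (padic_int p_pr).
Implicit Types (a b c s t : Zp).

Lemma zres_nat m n : (m%:R : Zp) n = (m %% p ^ n)%N.
Proof.
elim: m => [|m IHm]; first by rewrite zres0 mod0n.
by rewrite -addn1 natrD zresD IHm /= modnDm.
Qed.

Lemma zres_at0 a : a 0%N = 0%N.
Proof. by rewrite -zres_small expn0 modn1. Qed.

Lemma zres_lt a n : (a n < p ^ n)%N.
Proof. by rewrite -zres_small ltn_pmod// pexp_gt0. Qed.

Lemma zres_lift a n : ((a n)%:R : Zp) n = a n.
Proof. by rewrite zres_nat zres_small. Qed.

Lemma zres_eqW m n a b : (m <= n)%N -> a n = b n -> a m = b m.
Proof. by move=> mn ab; rewrite (zres_le a mn) (zres_le b mn) ab. Qed.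

Lemma zres_eqD n a b a' b' :
  a n = b n -> a' n = b' n -> (a + a') n = (b + b') n.
Proof. by rewrite !zresD => -> ->. Qed.
Lemma zres_eqM n a b a' b' :
  a n = b n -> a' n = b' n -> (a * a') n = (b * b') n.
Proof. by rewrite !zresM => -> ->. Qed.
Lemma zres_eqN n a b : a n = b n -> (- a) n = (- b) n.
Proof. by move=> ab; rewrite /= ab. Qed.
Lemma zres_eqX n a b k : a n = b n -> (a ^+ k) n = (b ^+ k) n.
Proof. by move=> ab; elim: k => // k IHk; rewrite !exprS; apply: zres_eqM. Qed.
Lemma zres_eq_sum n (I : Type) (r : seq I) (h h' : I -> Zp) :
  (forall i, h i n = h' i n) ->
  (\sum_(i <- r) h i) n = (\sum_(i <- r) h' i) n.
Proof. by move=> hh'; elim/big_rec2: _ => // i x y _; apply: zres_eqD. Qed.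
Lemma zres_eq_prod n (I : Type) (r : seq I) (h h' : I -> Zp) :
  (forall i, h i n = h' i n) ->
  (\prod_(i <- r) h i) n = (\prod_(i <- r) h' i) n.
Proof. by move=> hh'; elim/big_rec2: _ => // i x y _; apply: zres_eqM. Qed.

(** The residue of the quotient modulo [p ^ m] is [a (m + n) %/ p ^ n]: [n] more digits of [a] are
    read, and the lowest [n], which are 0, are dropped. *)
Lemma zres_eq0_dvd a n : a n = 0%N -> exists b, a = p%:R ^+ n * b.
Proof.
move=> an; have dvd m : (p ^ n %| a (m + n))%N.
  by rewrite /dvdn -(zres_le a (leq_addl m n)) an.
have ok m : (a (m + n) %/ p ^ n = (a (m.+1 + n) %/ p ^ n) %% p ^ m)%N.
  apply/eqP; rewrite -(eqn_pmul2r (pexp_gt0 p_pr n)) divnK// muln_modl.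
    by rewrite divnK// -expnD -zres_le// leqnSn.
by exists (PadicInt p_pr ok); apply/padic_intP=> m;
  rewrite -natrX zresM zres_nat /= modnMml mulnC divnK// -zres_le// leq_addr.
Qed.

Lemma zres_eqP n a b : a n = b n <-> exists c, a = b + p%:R ^+ n * c.
Proof.
split=> [ab|[c ->]]; last first.
  rewrite zresD -natrX zresM zres_nat modnn mul0n mod0n addn0.
  exact: zres_small.
have [|c abc] := @zres_eq0_dvd (a - b) n; last by exists c; rewrite -abc addrC subrK.
by rewrite (zres_eqD ab (erefl ((- b) n))) subrr zres0.
Qed.

(** In [a^p - b^p = (a - b) * \sum_i a^(p-1-i) b^i] the sum is congruent to [p * b^(p-1)], hence to
    0, modulo [p]; this gains one digit. *)
Lemma zres_eqXp k a b : a k.+1 = b k.+1 -> (a ^+ p) k.+2 = (b ^+ p) k.+2.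
Proof.
move=> ab; have [c abc] := (zres_eqP _ _ _).1 ab.
have := zres_eqW (ltn0Sn k) ab => ab1.
have s1 : (\sum_(i < p) a ^+ (p.-1 - i) * b ^+ i) 1%N = 0%N.
  transitivity ((\sum_(i < p) b ^+ p.-1) 1%N).
    apply: zres_eq_sum => i; rewrite (zres_eqM (zres_eqX _ ab1) (erefl _)) -exprD subnK//.
    by have := ltn_ord i; lia.
  rewrite sumr_const card_ord -mulr_natl zresM zres_nat expn1 modnn mul0n.
  exact: mod0n.
have [e se] := zres_eq0_dvd s1.
apply/zres_eqP; exists (c * e); rewrite -[LHS](subrK (b ^+ p)) addrC.
congr (_ + _); rewrite subrXX se {1}abc addrC addKr expr1 !exprS; ring.
Qed.

Lemma zres_eqXpn n a b : a 1%N = b 1%N -> (a ^+ (p ^ n)) n.+1 = (b ^+ (p ^ n)) n.+1.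
Proof.
move=> ab; elim: n => [|n IHn]; first by rewrite !expr1.
by rewrite expnSr !exprM; apply: zres_eqXp.
Qed.

(** By Fermat [i ^ p] and [i] agree modulo [p], and raising both to the power [p ^ n] turns this
    into a congruence modulo [p ^ n.+1]. *)
Fact zteich_mod i n :
  (((i%:R : Zp) ^+ (p ^ n)) n = ((i%:R : Zp) ^+ (p ^ n.+1)) n.+1 %% p ^ n)%N.
Proof.
rewrite -zres_mod expnS exprM; case: n => [|n]; first by rewrite !zres_at0.
apply: zres_eqW (leqnSn _) _; apply/esym/zres_eqXpn.
rewrite -natrX !zres_nat expn1; exact: fermat_little.
Qed.

(* The Teichmueller representative of [i] mod [p], as the limit of the
   [i ^ (p ^ n)]. *)
Definition zteich (i : nat) : Zp := PadicInt p_pr (zteich_mod i).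

Lemma zteichE i n : zteich i n = ((i%:R : Zp) ^+ (p ^ n)) n. Proof. by []. Qed.

Lemma zteich_res1 i : zteich i 1%N = (i %% p)%N.
Proof.
by rewrite zteichE -natrX zres_nat !expn1; apply: fermat_little.
Qed.

Lemma zteichM i j : zteich (i * j) = zteich i * zteich j.
Proof.
apply/padic_intP=> n; rewrite zteichE natrM exprMn; exact: zres_eqM.
Qed.

Lemma zteich_eqmod i j : i = j %[mod p] -> zteich i = zteich j.
Proof.
move=> ij; apply/padic_intP=> n; apply: zres_eqW (leqnSn _) _.
by rewrite !zteichE; apply: zres_eqW (leqnSn _) _; apply: zres_eqXpn; rewrite !zres_nat expn1.
Qed.

Lemma zteich1 : zteich 1 = 1.
Proof. by apply/padic_intP=> n; rewrite zteichE expr1n. Qed.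

Lemma zteich_order i : ~~ (p %| i)%N -> zteich i ^+ p.-1 = 1.
Proof.
move=> pi; rewrite -zteich1.
have -> : zteich i ^+ p.-1 = zteich (i ^ p.-1).
  elim: p.-1 => [|k IHk]; first by rewrite zteich1.
  by rewrite exprS expnS zteichM IHk.
apply: zteich_eqmod; rewrite -(totient_prime p_pr); apply: Euler_exp_totient.
by rewrite coprime_sym prime_coprime.
Qed.

Lemma zteichN i : odd p -> (i <= p)%N -> zteich (p - i) = - zteich i.
Proof.
move=> p_odd ip; apply/padic_intP=> n; case: n => [|n]; first by rewrite !zres_at0.
transitivity (((- i%:R) ^+ (p ^ n.+1) : Zp) n.+1).
  rewrite zteichE; apply: zres_eqW (leqnSn _) _; apply: zres_eqXpn.
  rewrite natrB// zresD zres_nat expn1 modnn add0n; exact: zres_small.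
rewrite exprNn -signr_odd oddX p_odd orbT mulN1r; exact: zres_eqN.
Qed.

End PadicIntegers.

(** * The group 1 + p Z_p and its logarithm *)

Section Kappa.
Variables (p : nat) (p_pr : prime p) (kappa : padic_int p_pr).
Hypothesis kappa_gen : topological_generator_1pZp kappa.
Local Notation Zp := (padic_int p_pr).
Implicit Types (a b c s t : Zp).

Let kappa1 : kappa 1%N = (1 : Zp) 1%N.
Proof. by rewrite kappa_gen.1 (zres_nat p_pr 1) expn1 modn_small ?prime_gt1. Qed.

Let kappaX1 n k : (kappa ^+ (k * p ^ n)) n.+1 = (1 : Zp) n.+1.
Proof.
by rewrite mulnC exprM -(expr1n Zp k); apply: zres_eqX; rewrite (zres_eqXpn _ kappa1) expr1n.
Qed.

Let kappaXV n k : ((kappa ^+ (k * (p ^ n).-1)) * kappa ^+ k) n.+1 = (1 : Zp) n.+1.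
Proof. by rewrite -exprD addnC -mulnS prednK ?pexp_gt0//. Qed.

(** [kappa ^+ (k * (p ^ n).-1)] is an inverse of [kappa ^+ k] modulo [p ^ n.+1], because
    [kappa ^+ (p ^ n)] is 1 there. *)
Lemma kappa_cancel n k a b :
  (kappa ^+ k * a) n.+1 = (kappa ^+ k * b) n.+1 -> a n.+1 = b n.+1.
Proof.
move=> /(zres_eqM (erefl ((kappa ^+ (k * (p ^ n).-1)) n.+1))); rewrite !mulrA.
rewrite (zres_eqM (kappaXV n k) (erefl (a n.+1))).
by rewrite (zres_eqM (kappaXV n k) (erefl (b n.+1))) !mul1r.
Qed.

Lemma kappaX_eqmod n j k : j = k %[mod p ^ n] ->
  (kappa ^+ j) n.+1 = (kappa ^+ k) n.+1.
Proof.
move=> jk; rewrite (divn_eq j (p ^ n)) (divn_eq k (p ^ n)) jk !exprD.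
by apply: zres_eqM => //; rewrite !kappaX1.
Qed.

Lemma kappaX_surj a n : a 1%N = 1%N -> exists k : nat, (kappa ^+ k) n = a n.
Proof.
move=> a1; case: n => [|n]; first by exists 0%N; rewrite !zres_at0.
have [[k|k] <-] := kappa_gen.2 a a1 n.+1; first by exists k.
have -> : kappa ^ (Negz k) = (kappa ^+ k.+1)^-1 by [].
(* A non-unit would be its own inverse by convention, and the exponent [k.+1] would serve. *)
have [uk|nuk] := boolP (kappa ^+ k.+1 \is a GRing.unit); last first.
  by exists k.+1; rewrite invr_out.
exists (k.+1 * (p ^ n).-1)%N; apply: (@kappa_cancel n k.+1).
by rewrite divrr// mulrC kappaXV.
Qed.

(** By counting: if [kappa] had order [p ^ j] modulo [p ^ n.+1] with [j < n], its powers would take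
    at most [p ^ j] values, too few to reach the [p ^ n] residues [1 + p * t]. *)
Lemma kappaX_eq1 n k : (kappa ^+ k) n.+1 = (1 : Zp) n.+1 -> (p ^ n %| k)%N.
Proof.
move=> kk; apply: contrapT => /negP ndvd.
have n0 : (0 < n)%N by case: n ndvd {kk} => //; rewrite dvd1n.
have k0 : (0 < k)%N by rewrite lt0n; apply: contraNneq ndvd => ->; apply: dvdn0.
have kpow j : (kappa ^+ (j * k)) n.+1 = (1 : Zp) n.+1.
  by rewrite mulnC exprM (zres_eqX _ kk) expr1n.
have [j jn gE] : exists2 j, (j <= n)%N & gcdn k (p ^ n) = (p ^ j)%N.
  by apply/dvdn_pfactor/dvdn_gcdr.
have kj : (kappa ^+ (p ^ j)) n.+1 = (1 : Zp) n.+1.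
  have [u v uv _] := @egcdnP k (p ^ n) k0.
  apply: (@kappa_cancel n (v * p ^ n)); rewrite -exprD mulr1.
  by rewrite -gE -uv kpow kappaX1.
have jltn : (j < n)%N.
  rewrite ltn_neqAle jn andbT; apply: contraNneq ndvd => <-.
  by rewrite -gE dvdn_gcdl.
have per i : (kappa ^+ i) n.+1 = (kappa ^+ (i %% p ^ j)) n.+1.
  rewrite {1}(divn_eq i (p ^ j)) exprD -[RHS]/((_ : Zp) n.+1) -[in RHS](mul1r (kappa ^+ _)).
  by apply: zres_eqM => //; rewrite mulnC exprM (zres_eqX _ kj) expr1n.
have ex (t : 'I_(p ^ n)) : exists i : 'I_(p ^ j), (kappa ^+ i) n.+1 = (1 + p%:R * t%:R : Zp) n.+1.
  have [|i iE] := @kappaX_surj (1 + p%:R * t%:R) n.+1.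
    rewrite -natrM -(natrD _ 1) zres_nat expn1 -modnDmr mulnC modnMl addn0.
    by rewrite modn_small ?prime_gt1.
  have lt : (i %% p ^ j < p ^ j)%N by rewrite ltn_pmod ?pexp_gt0.
  by exists (Ordinal lt); rewrite -iE [RHS]per.
pose f x := projT1 (cid (ex x)).
have f_inj : injective f.
  move=> x x' fx; have := projT2 (cid (ex x)); have := projT2 (cid (ex x')).
  rewrite -/(f x) -/(f x') fx => -> /eqP.
  rewrite -!natrM -!(natrD _ 1) !zres_nat eqn_modDl expnS -!muln_modr.
  rewrite eqn_pmul2l ?prime_gt0// !modn_small// => /eqP/esym xx'.
  exact: val_inj.
have := leq_card _ f_inj; rewrite !card_ord leqNgt ltn_exp2l ?prime_gt1//.
by rewrite jltn.
Qed.

Lemma kappaX_inj n j k :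
  (kappa ^+ j) n.+1 = (kappa ^+ k) n.+1 -> j = k %[mod p ^ n].
Proof.
wlog jk : j k / (j <= k)%N => [hw|] e.
  by have [/hw|/ltnW/hw] := leqP j k; [apply|move=> h; apply/esym/h].
apply/esym/eqP; rewrite eqn_mod_dvd//; apply: kappaX_eq1.
by apply: (@kappa_cancel n j); rewrite -exprD subnKC// mulr1.
Qed.

(** [kappa ^+ j] modulo [p ^ n.+1] depends only on [j] modulo [p ^ n], so the powers in the
    definition of [zpow] stabilize and the limit exists. *)
Lemma zpowE s n : zpow kappa s n = (kappa ^+ (s n)) n.
Proof.
have ok m : ((kappa ^+ s m) m = (kappa ^+ s m.+1) m.+1 %% p ^ m)%N.
  rewrite -zres_mod; apply: zres_eqW (leqnSn _) _; apply: kappaX_eqmod.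
  by rewrite [in LHS]zres_mod modn_mod.
have cv : zcvg (fun n => kappa ^+ s n) (PadicInt p_pr ok).
  move=> m; exists m => k mk /=; apply: zres_eqW (leqnSn _) _.
  by apply: kappaX_eqmod; rewrite [in RHS](zres_le _ mk) modn_mod.
have : zcvg (fun n => kappa ^+ s n) (zpow kappa s).
  by rewrite /zpow /zlim; apply: (xgetPex _ (ex_intro _ _ cv)).
move=> /(_ n)[N hN]; have [N' hN'] := cv n.
by rewrite -(hN _ (leq_maxl N N')) hN' ?leq_maxr.
Qed.

Lemma zpow_eq s t n : s n = t n -> zpow kappa s n.+1 = zpow kappa t n.+1.
Proof.
move=> st; rewrite !zpowE; apply: kappaX_eqmod.
by rewrite -!zres_mod st.
Qed.

Lemma zpow_inj s t n : zpow kappa s n.+1 = zpow kappa t n.+1 -> s n = t n.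
Proof. by rewrite !zpowE => /kappaX_inj; rewrite -!zres_mod. Qed.

Lemma zpowD s t : zpow kappa (s + t) = zpow kappa s * zpow kappa t.
Proof.
apply/padic_intP=> n; rewrite zpowE (zres_eqM (zpowE s n) (zpowE t n)) -exprD.
by apply: zres_eqW (leqnSn _) _; apply: kappaX_eqmod; rewrite zresD modn_mod.
Qed.

Lemma zpow_nat k : zpow kappa k%:R = kappa ^+ k.
Proof.
apply/padic_intP=> n; rewrite zpowE; apply: zres_eqW (leqnSn _) _.
by apply: kappaX_eqmod; rewrite zres_nat modn_mod.
Qed.

Lemma zpow_res1 s : zpow kappa s 1%N = 1%N.
Proof.
by rewrite zpowE (zres_eqX _ kappa1) expr1n (zres_nat p_pr 1) expn1 modn_small ?prime_gt1.
Qed.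

(** The exponents that give [a] modulo [p ^ n.+1] are unique modulo [p ^ n], hence form a p-adic
    integer. *)
Lemma zlog_ex a : a 1%N = 1%N -> exists s, zpow kappa s = a.
Proof.
move=> a1; pose k n := projT1 (cid (kappaX_surj n.+1 a1)).
have kP n : (kappa ^+ k n) n.+1 = a n.+1 by rewrite /k; case: cid.
have ok n : (k n %% p ^ n = (k n.+1 %% p ^ n.+1) %% p ^ n)%N.
  rewrite modn_dvdm; last by rewrite dvdn_exp2l.
  by apply: kappaX_inj; rewrite kP; apply/esym/(zres_eqW (leqnSn _)); rewrite kP.
exists (PadicInt p_pr ok); apply/padic_intP=> n; rewrite zpowE /=.
apply: zres_eqW (leqnSn _) _; rewrite -kP.
by apply: kappaX_eqmod; rewrite modn_mod.
Qed.

Lemma zunit_decomp a : a 1%N != 0%N ->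
  exists s, a = zteich p_pr (a 1%N) * zpow kappa s.
Proof.
move=> a1; have a1p : (a 1%N < p)%N by have := zres_lt a 1; rewrite expn1.
have na1 : ~~ (p %| a 1%N)%N by rewrite gtnNdvd// lt0n.
(* An inverse of [a] modulo [p], by Fermat. *)
pose j := (a 1%N ^ p.-2)%N.
have jE : zteich p_pr (a 1%N) * zteich p_pr j = 1.
  rewrite -zteichM -expnS -[(p.-2).+1]/(p.-1.-1.+1) prednK; last first.
    by rewrite -subn1 subn_gt0 prime_gt1.
  rewrite -(zteich1 p_pr); apply: zteich_eqmod.
  rewrite -(totient_prime p_pr); apply: Euler_exp_totient.
  by rewrite coprime_sym prime_coprime.
have [|s sE] := @zlog_ex (zteich p_pr j * a).
  transitivity ((zteich p_pr j * zteich p_pr (a 1%N)) 1%N).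
    by apply: zres_eqM => //; rewrite zteich_res1 modn_small.
  by rewrite mulrC jE (zres_nat p_pr 1) expn1 modn_small ?prime_gt1.
by exists s; rewrite sE mulrA jE mul1r.
Qed.

End Kappa.

(** * Binomial coefficients of p-adic integers *)

Section Binomials.
Variables (p : nat) (p_pr : prime p).
Local Notation Zp := (padic_int p_pr).
Implicit Types (a b c s t : Zp).

Let prod_zres a k n :
  (\prod_(i < k) (a - i%:R)) n = (k`! * 'C(a n, k) %% p ^ n)%N.
Proof.
transitivity ((\prod_(i < k) ((a n)%:R - i%:R : Zp)) n).
  apply: zres_eq_prod => i; apply: zres_eqD => //; exact/esym/zres_lift.
have -> : \prod_(i < k) ((a n)%:R - i%:R : Zp) = ((a n) ^_ k)%:R.
  elim: k => [|k IHk]; first by rewrite big_ord0.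
  rewrite big_ord_recr /= IHk ffactnSr natrM; have [ka|ak] := leqP k (a n).
    by rewrite natrB.
  by rewrite ffact_small// !mul0r.
by rewrite zres_nat mulnC bin_ffact.
Qed.

(** Cancelling [k!] costs the [logn p k!] digits of its [p]-part; the cofactor is prime to [p]. *)
Let cancel_fact k n x y :
  (k`! * x = k`! * y %[mod p ^ (n + logn p k`!)])%N -> (x = y %[mod p ^ n])%N.
Proof.
wlog yx : x y / (y <= x)%N => [hw|] e.
  by have [/hw|/ltnW/hw] := leqP y x; [apply|move=> h; apply/esym/h].
apply/eqP; rewrite eqn_mod_dvd//; move/eqP: e.
rewrite eqn_mod_dvd ?leq_mul2l ?yx ?orbT// -mulnBr.
have [w pw kE] := pfactor_coprime p_pr (fact_gt0 k).
set v := logn p _ in kE *; rewrite kE expnD -mulnA [(p ^ v * _)%N]mulnC mulnA.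
by rewrite dvdn_pmul2r ?pexp_gt0// Gauss_dvdr// coprimeXl.
Qed.

Lemma zbinE a k : k`!%:R * zbin a k = \prod_(i < k) (a - i%:R).
Proof.
pose v := logn p k`!.
(* The residue of the binomial modulo [p ^ n] is that of ['C(a (n + v), k)]: the [v] extra digits
   make up for the division by [k!]. *)
have ok n : ('C(a (n + v), k) %% p ^ n = ('C(a (n.+1 + v), k) %% p ^ n.+1) %% p ^ n)%N.
  rewrite modn_dvdm ?dvdn_exp2l//; apply: (@cancel_fact k); rewrite -!prod_zres.
  by rewrite (zres_le _ (leqnSn _)) prod_zres modn_dvdm// dvdn_exp2l// addSn.
rewrite /zbin; apply: (@xgetPex _ 0 [set b | k`!%:R * b = \prod_(i < k) (a - i%:R)]%classic).
exists (PadicInt p_pr ok) => /=; apply/padic_intP=> n; rewrite zresM zres_nat /=.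
rewrite modnMm (zres_le _ (leq_addr v n)) prod_zres modn_dvdm//.
by rewrite dvdn_exp2l// leq_addr.
Qed.

Lemma zbin_res1 a k n : (1 + logn p k`! <= n)%N ->
  zbin a k 1%N = ('C(a n, k) %% p)%N.
Proof.
move=> kn; have n0 : (0 < n)%N by apply: leq_trans kn.
rewrite (zres_le _ n0) -[RHS]/('C(a n, k) %% p ^ 1)%N; apply: (@cancel_fact k).
have := congr1 (fun c : Zp => c n) (zbinE a k).
rewrite zresM zres_nat prod_zres modnMml => e.
by rewrite -(modn_dvdm _ (dvdn_exp2l p kn)) e modn_dvdm// dvdn_exp2l.
Qed.

End Binomials.

(** * The series x^a and the substitution x -> x^a in characteristic p *)

Section PseudoMonomials.
Variables (p : nat) (p_pr : prime p) (F : finFieldType).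
Hypothesis pcharF : p \in [pchar F].
Local Notation Zp := (padic_int p_pr).
Local Notation E := (fps_1Xpow F (p_pr := p_pr)).
Local Notation x := (1 + fps_X : fps F).
Implicit Types (a b c s t : Zp).

Lemma natr_modp n : (n %% p)%:R = n%:R :> F.
Proof. by rewrite {2}(divn_eq n p) natrD natrM (pcharf0 pcharF) mulr0 add0r. Qed.

Lemma fps_pchar : p \in [pchar (fps F)].
Proof.
by rewrite inE p_pr /= fps_natE (pcharf0 pcharF) rmorph0 eqxx.
Qed.

Lemma x_pexp N : x ^+ (p ^ N) = 1 + fps_X ^+ (p ^ N).
Proof.
rewrite exprDn_pchar ?expr1n//; apply/pnatP => [|q q_pr].
  by rewrite expn_gt0 prime_gt0.
rewrite Euclid_dvdX// => /andP[+ _]; rewrite dvdn_prime2// => /eqP->.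
exact: fps_pchar.
Qed.

Lemma x_eqmod N m n : m = n %[mod p ^ N] -> eqT (p ^ N) (x ^+ m) (x ^+ n).
Proof.
move=> mn; have red k : eqT (p ^ N) (x ^+ k) (x ^+ (k %% p ^ N)).
  rewrite {1}(divn_eq k (p ^ N)) exprD mulnC exprM -[X in eqT _ _ X]mul1r.
  apply: eqTM => //; rewrite -[X in eqT _ _ X](expr1n _ (k %/ p ^ N)).
  apply: eqTX; rewrite x_pexp -[X in eqT _ _ X]addr0; apply: eqTD => //.
  by rewrite -[X in eqT _ X]mulr1; apply: eqT_XnM.
by apply: eqT_trans (red m) _; rewrite mn; apply: eqT_sym.
Qed.

Lemma coef_xn n k : (x ^+ n) k = ('C(n, k))%:R.
Proof.
elim: n k => [|n IHn] k; first by rewrite fps_coef1 bin0n.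
rewrite exprS mulrDl mul1r fps_coefD fps_coefXM IHn.
by case: k => [|k]; rewrite ?bin0 ?addr0// IHn binS natrD.
Qed.

(** This congruence, which rests on [x^(p ^ N) = 1 + T^(p ^ N)], reduces the arithmetic of p-adic
    exponents to that of natural ones. *)
Lemma pmono_eqT a N : eqT (p ^ N) (E a) (x ^+ (a N)).
Proof.
(* At precision [M] the coefficient of index [k] is an ordinary binomial coefficient modulo [p]; as
   [N <= M], the exponent [a M] may then be reduced modulo [p ^ N]. *)
move=> k kN; pose M := (1 + logn p k`! + N)%N.
have NM : (N <= M)%N by apply: leq_addl.
rewrite /= (@zbin_res1 _ _ _ _ M) ?leq_addr// natr_modp -coef_xn.
by apply: (x_eqmod (N := N)) => //; rewrite -(zres_le a NM) zres_small.
Qed.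

Lemma pmono_eq a b N : a N = b N -> eqT (p ^ N) (E a) (E b).
Proof.
move=> ab; apply: eqT_trans (@pmono_eqT a N) _; rewrite ab.
exact/eqT_sym/pmono_eqT.
Qed.

Lemma leq_pexp N : (N <= p ^ N)%N.
Proof. by rewrite ltnW// ltn_expl// prime_gt1. Qed.

Lemma eqT_pexp (f g : fps F) : (forall N, eqT (p ^ N) f g) -> f = g.
Proof. by move=> fg; apply: eqT_eq => N; apply: eqTW (leq_pexp N) (fg N). Qed.

Lemma pmonoD a b : E (a + b) = E a * E b.
Proof.
apply: eqT_pexp => N; apply: eqT_trans (@pmono_eqT _ N) _.
apply/eqT_sym/(eqT_trans (eqTM (@pmono_eqT a N) (@pmono_eqT b N))).
by rewrite -exprD; apply: x_eqmod; rewrite zresD modn_mod.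
Qed.

Lemma pmono_nat m : E m%:R = x ^+ m.
Proof.
apply: eqT_pexp => N; apply: eqT_trans (@pmono_eqT _ N) _.
by apply: x_eqmod; rewrite zres_nat modn_mod.
Qed.

Lemma pmono0 : E 0 = 1. Proof. exact: (pmono_nat 0). Qed.

Lemma pmonoX a m : E a ^+ m = E (a * m%:R).
Proof.
elim: m => [|m IHm]; first by rewrite mulr0 pmono0.
by rewrite exprS IHm -pmonoD mulr_natr -mulrS mulr_natr.
Qed.

Lemma pmonoN1 : E (-1) = fps_inv1X.
Proof.
rewrite -[E (-1)]mulr1 -(fps_inv1XE F) mulrA -[x]expr1 -(pmono_nat 1) -pmonoD.
by rewrite addNr pmono0 mul1r.
Qed.

Lemma pmono_coef0 a : E a 0%N = 1.
Proof. by rewrite (pmono_eqT a (N := 0)) ?expn0// coef_xn bin0. Qed.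

(** The substitution [x -> x^a], that is, the push-forward of a measure under multiplication by [a].
    For [a = -1] it is the reflection in the statement of the theorem. *)
Definition fps_scale a (f : fps F) := fps_comp f (E a - 1).

Lemma pmonoB1_coef0 a : (E a - 1) 0%N = 0.
Proof. by rewrite fps_coefD fps_coefN pmono_coef0 fps_coef1 subrr. Qed.

Lemma fps_scale_linear a : fps_linear (fps_scale a).
Proof. exact: fps_comp_linear. Qed.
Lemma fps_scale_continuous a : fps_continuous (fps_scale a).
Proof. exact: fps_comp_continuous. Qed.

Lemma fps_scale_xn a n : fps_scale a (x ^+ n) = E (a * n%:R).
Proof. by rewrite /fps_scale fps_comp_1Xn ?pmonoB1_coef0// addrC subrK pmonoX. Qed.

Lemma fps_scale_pmono a b : fps_scale a (E b) = E (a * b).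
Proof.
apply: eqT_pexp => N.
apply: eqT_trans (fps_comp_eqT _ (@pmono_eqT b N)) _.
rewrite [fps_comp _ _]fps_scale_xn; apply: pmono_eq.
by apply: zres_eqM => //; apply: zres_lift.
Qed.

Lemma fps_scaleA a b f : fps_scale a (fps_scale b f) = fps_scale (a * b) f.
Proof.
move: f; apply: fps_linear_ext.
- exact: fps_linear_comp (fps_scale_linear a) (fps_scale_linear b).
- exact: fps_continuous_comp (fps_scale_continuous a) (fps_scale_continuous b).
- exact: fps_scale_linear.
- exact: fps_scale_continuous.
by move=> n; rewrite !fps_scale_xn fps_scale_pmono mulrA.
Qed.

Lemma fps_scale1 f : fps_scale 1 f = f.
Proof.
move: f; apply: fps_linear_ext.
- exact: fps_scale_linear.
- exact: fps_scale_continuous.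
- by [].
- by move=> M; exists M.
by move=> n; rewrite fps_scale_xn mul1r pmono_nat.
Qed.

Lemma fps_scale_evalM a P f :
  fps_scale a (fps_eval x P * f) = fps_eval (E a) P * fps_scale a f.
Proof. by rewrite /fps_scale fps_comp_evalM ?pmonoB1_coef0// addrC subrK. Qed.

Lemma fps_scale_eval a P : fps_scale a (fps_eval x P) = fps_eval (E a) P.
Proof. by rewrite -[fps_eval x P]mulr1 fps_scale_evalM /fps_scale fps_comp1 mulr1. Qed.

(** Modulo [T^N] the first factor is a polynomial in [x], for which the rule is
    [fps_scale_evalM]. *)
Lemma fps_scale_mul a f g : fps_scale a (f * g) = fps_scale a f * fps_scale a g.
Proof.
apply: eqT_eq => N.
have t := eqT_trunc f (N := N); rewrite fps_of_polyE1X in t.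
apply: eqT_trans (fps_comp_eqT _ (eqTM t (@eqT_refl _ N g))) _.
rewrite [fps_comp _ _]fps_scale_evalM -fps_scale_eval.
by apply: eqTM => //; apply: fps_comp_eqT; apply: eqT_sym.
Qed.

End PseudoMonomials.

(** * Valuations and interpolation *)

Section PadicVal.
Variables (p : nat) (p_pr : prime p).
Local Notation Zp := (padic_int p_pr).

Lemma zval1 : zval (1 : Zp) = 0%N.
Proof.
apply/eqP; rewrite -leqn0 leqNgt -zvalP ?oner_neq0//.
by rewrite (zres_nat p_pr 1) expn1 modn_small ?prime_gt1.
Qed.

Lemma padic_p_neq0 : p%:R != 0 :> Zp.
Proof.
apply/eqP => /(congr1 (fun c : Zp => c 2)); rewrite zres_nat zres0 => /eqP.
rewrite modn_small ?eqn0Ngt ?prime_gt0//.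
by rewrite -{1}(expn1 p) ltn_exp2l// prime_gt1.
Qed.

Lemma zval_p : zval (p%:R : Zp) = 1%N.
Proof.
apply/eqP; rewrite eqn_leq -zvalP ?padic_p_neq0// zres_nat expn1 modnn andbT.
rewrite leqNgt -zvalP ?padic_p_neq0// zres_nat.
rewrite modn_small ?eqn0Ngt ?prime_gt0//.
by rewrite -{1}(expn1 p) ltn_exp2l// prime_gt1.
Qed.

Lemma padic_val_tofrac (a : Zp) : a != 0 ->
  padic_val p_pr (FracField.tofrac a) = (zval a)%:Z.
Proof.
move=> a0; have -> : FracField.tofrac a = FracField.tofrac a / FracField.tofrac 1.
  by rewrite tofrac1 divr1.
by rewrite /= padic_valE ?oner_neq0// zval1 subr0.
Qed.

End PadicVal.

Section Vge.
Variables (E : fieldType) (v : valuation E).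
Implicit Types (x y : E) (m : int).

Lemma vge0 m : vge v m 0. Proof. by rewrite /vge eqxx. Qed.

Lemma vgeD m x y : vge v m x -> vge v m y -> vge v m (x + y).
Proof.
rewrite /vge; have [->|x0] := eqVneq x 0; first by rewrite add0r.
have [->|y0] := eqVneq y 0; first by rewrite addr0 (negPf x0).
have [//|xy0 /= vx vy] := eqVneq (x + y) 0.
by apply: le_trans (valuationD v x0 y0 xy0); rewrite le_min vx.
Qed.

Lemma vgeM m n x y : vge v m x -> vge v n y -> vge v (m + n) (x * y).
Proof.
rewrite /vge mulf_eq0; have [//|x0] := eqVneq x 0.
by have [//|y0 /= vx vy] := eqVneq y 0; rewrite valuationM// lerD.
Qed.

Lemma vge_valring (x : valring v) : vge v 0 (\val x).
Proof. exact: (valP x). Qed.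

Lemma vgeMl m (x : valring v) y : vge v m y -> vge v m (\val x * y).
Proof. by move=> /(vgeM (vge_valring x)); rewrite add0r. Qed.

Lemma vgeB m x y : vge v m x -> vge v m y -> vge v m (x - y).
Proof.
move=> vx vy; apply: vgeD => //.
by rewrite -mulN1r; apply: (vgeMl (-1)).
Qed.

Lemma vcvg_eventually (u : nat -> E) l N :
  (forall n, (N <= n)%N -> u n = l) -> vcvg v u l.
Proof. by move=> ul m; exists N => n /ul->; rewrite subrr vge0. Qed.

Lemma vcvgD (u u' : nat -> E) l l' :
  vcvg v u l -> vcvg v u' l' -> vcvg v (fun n => u n + u' n) (l + l').
Proof.
move=> ul ul' m; have [N hN] := ul m; have [N' hN'] := ul' m.
exists (maxn N N') => n; rewrite geq_max => /andP[/hN h /hN' h'].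
by rewrite opprD addrACA; apply: vgeD.
Qed.

Lemma vcvgZ (c : E) (u : nat -> E) l :
  vcvg v u l -> vcvg v (fun n => c * u n) (c * l).
Proof.
have [-> _ m|c0 ul m] := eqVneq c 0.
  by exists 0%N => n _; rewrite !mul0r subr0 vge0.
have [N hN] := ul (m - v c); exists N => n /hN h.
rewrite -mulrBr; have -> : m = v c + (m - v c) by rewrite addrC subrK.
by apply: vgeM => //; rewrite /vge lexx orbT.
Qed.

Lemma vcvg_sum (I : Type) (r : seq I) (u : I -> nat -> E) (l : I -> E) :
  (forall i, vcvg v (u i) (l i)) ->
  vcvg v (fun n => \sum_(i <- r) u i n) (\sum_(i <- r) l i).
Proof.
move=> ul; elim: r => [|i r IHr].
  by rewrite big_nil; apply: (@vcvg_eventually _ _ 0) => n _; rewrite big_nil.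
move=> m; have [N hN] := vcvgD (ul i) IHr m; exists N => n /hN.
by rewrite !big_cons.
Qed.

Lemma vcvg_shift (u u' : nat -> E) l :
  (forall n, u' n.+1 = u n) -> vcvg v u l -> vcvg v u' l.
Proof.
move=> uu' ul m; have [N hN] := ul m; exists N.+1 => -[//|n] Nn.
by rewrite uu'; apply: hN.
Qed.

Lemma vcvg_uniq (u : nat -> E) l l' : vcvg v u l -> vcvg v u l' -> l = l'.
Proof.
move=> ul ul'; apply/eqP; rewrite -subr_eq0; apply/negPn/negP => ll'.
have [N hN] := ul (v (l - l') + 1); have [N' hN'] := ul' (v (l - l') + 1).
have := vgeB (hN' _ (leq_maxr N N')) (hN _ (leq_maxl N N')).
set N0 := maxn N N'; have -> : u N0 - l' - (u N0 - l) = l - l' by ring.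
by rewrite /vge (negPf ll') /= gerDl.
Qed.

Lemma fps_value_linear (c : valring v) (H H' : fps (valring v)) x y y' :
  fps_value v (fps_map \val H) x y -> fps_value v (fps_map \val H') x y' ->
  fps_value v (fps_map \val (fps_const c * H + H')) x (\val c * y + y').
Proof.
move=> hy hy' m; have [N hN] := vcvgD (vcvgZ (\val c) hy) hy' m.
exists N => n /hN; congr (vge _ _ (_ - _)); rewrite mulr_sumr -big_split.
apply: eq_bigr => i _.
rewrite -[fps_map _ (_ + _) i]/(\val ((fps_const c * H + H') i)).
by rewrite fps_coefD fps_coefC rmorphD rmorphM mulrDl mulrA.
Qed.

Lemma fps_value_poly (P : {poly valring v}) (t : valring v) :
  fps_value v (fps_map \val (fps_of_poly P)) (\val t) (\val P.[t]).
Proof.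
apply: (@vcvg_eventually _ _ (size P)) => n Pn.
rewrite (horner_coef_wide _ Pn) rmorph_sum; apply: eq_bigr => i _.
by rewrite rmorphM rmorphXn.
Qed.

End Vge.

Section Interpolation.
Import Pdiv.Ring Pdiv.RingMonic Pdiv.CommonRing.

(* Write [P = B * \prod_i ('X - t_i) + A] with [size A <= R]: the product reduces
   to ['X^R], and the coefficients of [A] are recovered from its values through
   the adjugate of the Vandermonde matrix. *)
Lemma poly_values_red0 (O F : comNzRingType) (red : {rmorphism O -> F})
    (R : nat) (t : 'I_R -> O) (q : O) (P : {poly O}) :
  (forall i, red (t i) = 0) ->
  (forall a s, \det (Vandermonde R (\row_i t i)) * a = q * s -> red a = 0) ->
  (forall i, exists r, P.[t i] = q * r) ->
  forall k, (k < R)%N -> red P`_k = 0.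
Proof.
move=> redt qP valP k kR.
pose W := \prod_(i < R) ('X - (t i)%:P).
have Wm : W \is monic by apply: monic_prod_XsubC.
have sW : size W = R.+1 by rewrite size_prod_XsubC /index_enum -enumT size_enum_ord.
have PE := rdivp_eq Wm P; set A := rmodp P W in PE; set B := rdivp P W in PE.
have sA : (size A <= R)%N by rewrite -ltnS -sW ltn_rmodp monic_neq0.
have Wt i : W.[t i] = 0.
  by rewrite horner_prod (bigD1 i)//= hornerXsubC subrr mul0r.
have At i : A.[t i] = P.[t i] by rewrite [in RHS]PE hornerD hornerM Wt mulr0 add0r.
have redA j : red A`_j = 0.
  have [jR|Rj] := ltnP j R; last by rewrite nth_default ?rmorph0// (leq_trans sA).
  pose V := Vandermonde R (\row_i t i).
  pose a := \row_(j < R) A`_j.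
  have aV : a *m V = \row_i A.[t i].
    apply/rowP => i; rewrite !mxE (horner_coef_wide _ sA).
    by apply: eq_bigr => l _; rewrite !mxE.
  pose r i := projT1 (cid (valP i)).
  have rE i : P.[t i] = q * r i by rewrite /r; case: cid.
  apply: (qP _ (\sum_i r i * (\adj V) i (Ordinal jR))).
  have := congr1 (fun M : 'rV_R => M 0 (Ordinal jR)) (congr1 (mulmx^~ (\adj V)) aV).
  rewrite /= -mulmxA mul_mx_adj mul_mx_scalar mxE mxE => ->.
  rewrite mxE mulr_sumr; apply: eq_bigr => i _.
  by rewrite mxE At rE mulrA.
have redW : map_poly red W = 'X^R.
  rewrite rmorph_prod -[R in 'X^R]card_ord -prodr_const; apply: eq_bigr => i _.
  by rewrite rmorphB /= map_polyX map_polyC /= redt subr0.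
rewrite -coef_map PE rmorphD rmorphM /= redW coefD coefMXn kR add0r coef_map.
exact: redA.
Qed.

End Interpolation.

(** * The derivation D on the powers of x *)

Section Derivation.
Variable R : comNzRingType.
Implicit Types (f g : fps R) (c : R).
Local Notation x := (1 + fps_X : fps R).
Local Notation D := (@fps_D R).

Lemma fps_derivD f g : fps_deriv (f + g) = fps_deriv f + fps_deriv g.
Proof. by apply/fpsP=> n; rewrite fps_coefD -mulrnDl. Qed.
Lemma fps_derivC c f : fps_deriv (fps_const c * f) = fps_const c * fps_deriv f.
Proof.
apply/fpsP=> n; rewrite fps_coefC -[LHS]/((fps_const c * f) n.+1 *+ n.+1).
by rewrite fps_coefC mulrnAr.
Qed.
Lemma fps_derivXM f : fps_deriv (fps_X * f) = f + fps_X * fps_deriv f.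
Proof.
apply/fpsP=> n; rewrite fps_coefD fps_coefXM.
rewrite -[LHS]/((fps_X * f) n.+1 *+ n.+1) fps_coefXM.
by case: n => [|n]; rewrite ?addr0// mulrS.
Qed.

Lemma fps_D_linear : fps_linear D.
Proof. by move=> c f g; rewrite /fps_D fps_derivD fps_derivC mulrDr mulrCA. Qed.

Lemma fps_DxM f : D (x * f) = x * f + x * D f.
Proof.
rewrite /fps_D {1}(mulrDl 1 fps_X f) mul1r fps_derivD fps_derivXM.
by rewrite addrCA [fps_deriv f + _]addrC; ring.
Qed.

Lemma fps_DxnM n f : D (x ^+ n * f) = n%:R * (x ^+ n * f) + x ^+ n * D f.
Proof.
elim: n => [|n IHn]; first by rewrite !mul1r mul0r add0r.
rewrite exprS -mulrA fps_DxM IHn -natr1; ring.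
Qed.

Lemma iter_fps_D_linear k : fps_linear (iter k D).
Proof.
elim: k => [//|k IHk] c f g.
by rewrite !iterS IHk fps_D_linear.
Qed.

Lemma iter_fps_Dxn k n : iter k D (x ^+ n) = fps_const (n%:R ^+ k) * x ^+ n.
Proof.
elim: k => [|k IHk]; first by rewrite rmorph1 mul1r.
rewrite iterS IHk (fps_linearZ fps_D_linear) -[X in D X]mulr1 fps_DxnM.
have -> : D 1 = 0.
  by apply/fpsP=> i; rewrite /fps_D (_ : fps_deriv 1 = 0) ?mulr0//;
     apply/fpsP=> j; rewrite fps_coef0 /= mul0rn.
by rewrite mulr0 addr0 mulr1 exprSr rmorphM /= fps_natE mulrA.
Qed.

Lemma xn_coef0 n : (x ^+ n) 0%N = 1.
Proof.
elim: n => [|n IHn]; first by rewrite fps_coef1.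
by rewrite exprS mulrDl mul1r fps_coefD IHn fps_coefXM addr0.
Qed.

(* The ideal generated by [q] and [x ^ q - 1] is stable under [D]. *)
Lemma iter_fps_D_ideal q k A B : exists r,
  iter k D (fps_const q%:R * A + (x ^+ q - 1) * B) 0%N = q%:R * r.
Proof.
suff [A' [B' ->]] : exists A' B',
    iter k D (fps_const q%:R * A + (x ^+ q - 1) * B) =
    fps_const q%:R * A' + (x ^+ q - 1) * B'.
  exists (A' 0%N); rewrite fps_coefD fps_coefC [X in _ + X]fps_coefM big_ord1.
  by rewrite fps_coefD fps_coefN fps_coef1 xn_coef0 subrr mul0r addr0.
elim: k => [|k [A' [B' IHk]]]; first by exists A, B.
exists (D A' + x ^+ q * B'), (D B').
rewrite iterS IHk (fps_linearD fps_D_linear) (fps_linearZ fps_D_linear).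
rewrite mulrBl mul1r (fps_linearD fps_D_linear) fps_DxnM.
have -> : D (- B') = - D B'.
  by rewrite -mulN1r -(rmorphN1 (@fps_const R)) (fps_linearZ fps_D_linear)
    rmorphN1 mulN1r.
rewrite fps_natE; ring.
Qed.

End Derivation.

(** * Z_p inside O_K, and the reduction modulo pi *)

Section Embedding.
Variables (p : nat) (p_pr : prime p).
Variables (K : fieldExtType (padic p_pr)) (v : valuation K).
Hypothesis v_ext : extends (fun x => x%:A) (padic_val p_pr) v.
Local Notation Zp := (padic_int p_pr).
Local Notation O := (valring v).

Fact ziota_subproof (c : Zp) : (FracField.tofrac c)%:A \in valring_pred v.
Proof.
have [e e0 eP] := v_ext; rewrite unfold_in /vge.
have [->|c0] := eqVneq c 0; first by rewrite tofrac0 scale0r eqxx.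
by rewrite eP ?tofrac_eq0// padic_val_tofrac// mulr_ge0 ?orbT.
Qed.

Definition ziota (c : Zp) : O := ValRing (ziota_subproof c).

Fact ziota_additive : zmod_morphism ziota.
Proof. by move=> a b; apply: val_inj; rewrite /= tofracB scalerBl. Qed.
Fact ziota_multiplicative : monoid_morphism ziota.
Proof.
split=> [|a b]; apply: val_inj; first by rewrite /= tofrac1 scale1r.
by rewrite /= tofracM; apply: (rmorphM (in_alg K)).
Qed.
HB.instance Definition _ := GRing.isZmodMorphism.Build Zp O ziota ziota_additive.
HB.instance Definition _ :=
  GRing.isMonoidMorphism.Build Zp O ziota ziota_multiplicative.

Lemma val_ziota c : \val (ziota c) = (FracField.tofrac c)%:A. Proof. by []. Qed.

Lemma ziota_val_neq0 c : c != 0 -> \val (ziota c) != 0.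
Proof. by move=> c0; rewrite val_ziota scaler_eq0 oner_eq0 orbF tofrac_eq0. Qed.

Lemma pexp_neq0 n : p%:R ^+ n != 0 :> Zp.
Proof.
elim: n => [|n IHn]; first exact: oner_neq0.
by rewrite exprS mulf_neq0// padic_p_neq0.
Qed.

Lemma zval_pexp n : zval (p%:R ^+ n : Zp) = n.
Proof.
elim: n => [|n IHn]; first exact: zval1.
by rewrite exprS zvalM ?pexp_neq0 ?padic_p_neq0// zval_p IHn.
Qed.

Lemma ziota_dvd (a b : Zp) n : a n = b n ->
  exists r, ziota a - ziota b = p%:R ^+ n * r.
Proof.
move=> /zres_eqP[c ->]; exists (ziota c).
by rewrite -rmorphB /= addrC addKr rmorphM rmorphXn rmorph_nat.
Qed.

Section Residue.
Variables (pi : valring v) (pi_unif : v (\val pi) = 1).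
Variables (F : finFieldType) (red : {rmorphism valring v -> F}).
Hypothesis red_ker : forall x, red x = 0 <-> exists y, x = pi * y.

(** [v 0] is unconstrained, so [v (\val pi) = 1] does not exclude [pi = 0] by itself. In that case
    [red] would be injective, and an element [x] of valuation 1 would satisfy [x^q = x] with
    [q = #|F|], hence [q - 1 = v (x^(q-1)) = v 1 = 0]. *)
Let pi_neq0 : \val pi != 0.
Proof.
apply/eqP => pi0.
have red1 : red 1 = 0 -> False by rewrite rmorph1 => /eqP; rewrite oner_eq0.
have all0 (y : O) : red y = 0 -> y = 0.
  move=> /red_ker[z ->]; apply: val_inj; rewrite rmorphM /= pi0 mul0r//.
have [x x0 vx] := valuation_surj v.
have xO : x \in valring_pred v by rewrite unfold_in /vge vx orbT.
have : red (ValRing xO) != 0.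
  by apply/eqP => /all0/(congr1 val) /= x00; rewrite x00 eqxx in x0.
move=> rx; have cF : #|F| != 0%N by apply/eqP => /card0_eq/(_ 0); rewrite inE.
pose N := #|F|.
have : red ((ValRing xO) ^+ N - ValRing xO) = 0.
  by rewrite rmorphB rmorphXn /= expf_card subrr.
move=> /all0/(congr1 val); rewrite rmorphB rmorphXn /= => /eqP.
have N1 : (1 < N)%N by apply: finNzRing_gt1.
rewrite -(prednK (ltnW N1)) exprS -[X in _ - X]mulr1 -mulrBr mulf_eq0 (negPf x0) /=.
rewrite subr_eq0 => /eqP xN1.
have vX k : v (x ^+ k) = k%:Z.
  elim: k => [|k IHk].
    have := valuationM v (oner_neq0 K) (oner_neq0 K).
    by rewrite mulr1 => /eqP; rewrite -subr_eq subrr => /eqP.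
  by rewrite exprS valuationM ?expf_neq0// vx IHk -add1n PoszD.
have := vX N.-1; rewrite xN1 -(expr0 x) vX => /eqP; rewrite eqz_nat => /eqP N0.
by have := N1; rewrite -(prednK (ltnW N1)) -N0.
Qed.

Lemma red_vge1 (y : O) : vge v 1 (\val y) -> red y = 0.
Proof.
move=> vy; apply/red_ker.
have [y0|y0] := eqVneq (\val y) 0.
  by exists 0; apply: val_inj; rewrite y0 mulr0.
have zO : \val y / \val pi \in valring_pred v.
  move: vy; rewrite unfold_in /vge (negPf y0) /= => vy.
  have z0 : \val y / \val pi != 0 by rewrite mulf_neq0 ?invr_eq0.
  rewrite (negPf z0) /=; have := valuationM v z0 pi_neq0.
  by rewrite divfK// pi_unif => vyE; rewrite vyE in vy; rewrite -(lerD2r 1) add0r.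
by exists (ValRing zO); apply: val_inj; rewrite rmorphM /= mulrC divfK.
Qed.

Lemma red_p : red p%:R = 0.
Proof.
apply: red_vge1; have [e e0 eP] := v_ext.
rewrite -(rmorph_nat ziota) val_ziota /vge eP ?tofrac_eq0 ?padic_p_neq0//.
by rewrite padic_val_tofrac ?padic_p_neq0// zval_p mulr1 lez_nat e0 orbT.
Qed.

Lemma residue_pchar : p \in [pchar F].
Proof. by rewrite inE p_pr /= -(rmorph_nat red) red_p. Qed.

Lemma red_ziota c : red (ziota c) = (c 1%N)%:R.
Proof.
have cE : c 1%N = ((c 1%N)%:R : Zp) 1%N by rewrite zres_lift.
have [r /(congr1 red)] := ziota_dvd cE.
rewrite expr1 rmorphB rmorphM red_p mul0r => /eqP; rewrite subr_eq0 => /eqP->.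
by rewrite !rmorph_nat.
Qed.

(** With [e] the ramification index, this translates divisibility by [p ^ n] in [O_K] into a bound
    on [v]. *)
Lemma vge_pexpP (y : O) (e : nat) n :
  (forall x, x != 0 -> v x%:A = e%:Z * padic_val p_pr x) ->
  vge v (e * n)%N%:Z (\val y) <-> exists r, y = p%:R ^+ n * r.
Proof.
move=> eP; have pE : p%:R ^+ n = ziota (p%:R ^+ n) by rewrite rmorphXn rmorph_nat.
have p0 := ziota_val_neq0 (pexp_neq0 n).
have vp : v (\val (ziota (p%:R ^+ n))) = (e * n)%N%:Z.
  by rewrite val_ziota eP ?tofrac_eq0 ?pexp_neq0// padic_val_tofrac ?pexp_neq0// zval_pexp.
split=> [vy|[r ->]]; last first.
  have vpp : vge v (e * n)%N (\val (ziota (p%:R ^+ n))) by rewrite /vge vp lexx orbT.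
  by have := vgeM vpp (vge_valring r); rewrite addr0 pE rmorphM.
have rO : \val y / \val (ziota (p%:R ^+ n)) \in valring_pred v.
  move: vy; rewrite unfold_in /vge; have [->|y0 /= vy] := eqVneq (\val y) 0.
    by rewrite mul0r eqxx.
  have z0 : \val y / \val (ziota (p%:R ^+ n)) != 0 by rewrite mulf_neq0 ?invr_eq0.
  rewrite (negPf z0) /=; have := valuationM v z0 p0.
  by rewrite divfK// vp => vyE; rewrite vyE in vy; rewrite -(lerD2r (e * n)%N%:Z) add0r.
by exists (ValRing rO); apply: val_inj; rewrite pE rmorphM /= mulrC divfK.
Qed.

(** The precision [c] is one more than the valuation of the Vandermonde determinant of the first [R]
    points, so that dividing by this determinant still leaves a positive valuation. *)
Lemma fps_values_red0 (R : nat) (t : nat -> Zp) :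
  (forall i, t i 1%N = 0%N) -> injective t ->
  exists c : nat, forall H : fps O,
    (forall i, exists2 y : O,
      fps_value v (fps_map \val H) (\val (ziota (t i))) (\val y) &
      exists r, y = p%:R ^+ c * r) ->
    forall k, (k < R)%N -> red (H k) = 0.
Proof.
move=> t1 t_inj; have [e e0 eP] := v_ext.
pose d : Zp := \det (Vandermonde R (\row_(i < R) t i)).
have d0 : d != 0.
  rewrite /d det_Vandermonde; apply/prodf_neq0 => i _; apply/prodf_neq0 => j ij.
  rewrite !mxE subr_eq0; apply/eqP => /t_inj ji; by rewrite ji ltnn in ij.
exists (zval d).+1 => H valH k kR; set c := (zval d).+1 in valH *.
pose y i := projT1 (cid2 (valH i)).
have yP i : fps_value v (fps_map \val H) (\val (ziota (t i))) (\val (y i)).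
  by rewrite /y; case: cid2.
have yc i : exists r, y i = p%:R ^+ c * r by rewrite /y; case: cid2.
have [N hN] : exists N, forall i : 'I_R, forall n, (N <= n)%N ->
    vge v (e * c)%N%:Z (\sum_(j < n) fps_map \val H j * \val (ziota (t i)) ^+ j - \val (y i)).
  pose N i := projT1 (cid (yP i (e * c)%N%:Z)).
  exists (\max_(i < R) N i) => i n Nn; rewrite /N in Nn.
  apply: (projT2 (cid (yP i (e * c)%N%:Z))).
  by apply: leq_trans Nn; apply: (leq_bigmax i).
(* At order [M] the partial sums are within [p ^ c] of the values at all [R] points, so [H] may be
   replaced by a polynomial. *)
pose M := maxn N R; pose P := \poly_(j < M) H j.
have PH : P`_k = H k by rewrite coef_poly (leq_trans kR) ?leq_maxr.
rewrite -PH; apply: (@poly_values_red0 _ _ red R (fun i => ziota (t i)) (p%:R ^+ c) P) => //.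
- by move=> i; rewrite red_ziota t1.
- move=> a s; have -> : \det (Vandermonde R (\row_(i < R) ziota (t i))) = ziota d.
    rewrite /d -det_map_mx; congr (\det _); apply/matrixP => i j.
    by rewrite !mxE rmorphXn.
  move=> das; apply: red_vge1; have [a0|a0] := eqVneq (\val a) 0.
    by rewrite a0; apply: vge0.
  have : vge v (e * c)%N%:Z (\val (ziota d * a)).
    by apply/(vge_pexpP _ _ eP); exists s.
  have zd0 := ziota_val_neq0 d0.
  rewrite rmorphM /vge mulf_eq0 (negPf a0) (negPf zd0) /=.
  rewrite valuationM// eP ?tofrac_eq0// padic_val_tofrac//.
  rewrite /c -addn1 PoszD mulrDr mulr1 lerD2l => ea.
  by apply: le_trans ea; rewrite lez_nat.
move=> i; apply/(vge_pexpP _ _ eP).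
have := hN i M (leq_maxl _ _); have /(vge_pexpP _ _ eP) := yc i.
move=> h /vgeD/(_ h); rewrite subrK; congr (vge _ _ _).
rewrite (horner_coef_wide _ (size_poly _ _)) rmorph_sum; apply: eq_bigr => j _.
by rewrite rmorphM rmorphXn /= coef_poly ltn_ord.
Qed.

End Residue.
End Embedding.

(** * The Leopoldt transform modulo pi *)

Section Overline.
Variables (O F : comNzRingType) (red : {rmorphism O -> F}) (pi : O).
Hypothesis red_surj : forall c, exists x, red x = c.
Hypothesis red_ker : forall x, red x = 0 <-> exists y, x = pi * y.
Variable g : fps O -> fps O.
Hypothesis g_linear : forall c G G',
  fps_map red (g (fps_const c * G + G')) =
  fps_const (red c) * fps_map red (g G) + fps_map red (g G').

Lemma red_liftK c : red (red_lift red c) = c.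
Proof. exact: (@xgetPex _ 0 [set x | red x = c]%classic (red_surj c)). Qed.

Lemma fps_red_liftK f : fps_map red (fps_map (red_lift red) f) = f.
Proof. by apply/fpsP=> n /=; rewrite red_liftK. Qed.

Lemma fps_red_surj f : exists G, fps_map red G = f.
Proof. by exists (fps_map (red_lift red) f); apply: fps_red_liftK. Qed.

(** Two lifts of a series differ by [pi] times a series, which [g], being linear after reduction,
    sends to 0 modulo [pi]. *)
Lemma fps_overline_map G : fps_overline red g (fps_map red G) = fps_map red (g G).
Proof.
rewrite /fps_overline; set G' := fps_map _ (fps_map _ _).
have redG n : red (G' n - G n) = 0 by rewrite rmorphB /= red_liftK subrr.
pose Q : fps O := FPS (fun n => projT1 (cid ((red_ker _).1 (redG n)))).
have -> : G' = fps_const pi * Q + G.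
  apply/fpsP=> n; rewrite fps_coefD fps_coefC /=; case: cid => y /= <-.
  by rewrite subrK.
have red_pi : red pi = 0 by apply/red_ker; exists 1; rewrite mulr1.
by rewrite g_linear red_pi rmorph0 mul0r add0r.
Qed.

Lemma fps_overline_linear : fps_linear (fps_overline red g).
Proof.
move=> c f h; have [x <-] := red_surj c.
have [G <-] := fps_red_surj f; have [G' <-] := fps_red_surj h.
rewrite -fps_map_const -rmorphM -rmorphD !fps_overline_map g_linear.
by rewrite fps_map_const.
Qed.

End Overline.

Section Exponent.
Variables (p : nat) (p_pr : prime p) (p_odd : odd p) (delta : 'Z_p.-1).
Local Notation Zp := (padic_int p_pr).

Let p_gt2 : (2 < p)%N. Proof. exact: odd_prime_gt2. Qed.

Lemma leopoldt_exponent_ex (s : Zp) n : exists k, leopoldt_exponent delta s n k.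
Proof.
(* [p.-2] plays the role of -1 modulo [p.-1]. *)
pose d0 := ((delta + s n.+1 * p.-2) %% p.-1)%N.
have d0p : (d0 < p.-1)%N by rewrite ltn_mod; lia.
have sd : (s n.+1 + d0 = delta %[mod p.-1])%N.
  rewrite modnDmr addnCA -mulnS (_ : (p.-2).+1 = p.-1) ?modnDmr; last lia.
  by rewrite -modnDmr modnMl addn0.
(* The multiplier has to be positive: the residue 0 is replaced by [p.-1]. *)
have [d00|d00] := posnP d0; last first.
  by eexists; exists d0; split=> //; rewrite d00 /=; lia.
eexists; exists p.-1; split=> //; first by apply/andP; split; lia.
by rewrite modnDr; rewrite d00 addn0 in sd.
Qed.

(** The class modulo [p.-1] governs the Teichmueller part of [a ^ k], the class modulo [p ^ n.+1]
    its part in [1 + p Z_p], and [n < k] makes [a ^ k] small when [p] divides [a]. *)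
Lemma leopoldt_exponentP (s : Zp) n k : leopoldt_exponent delta s n k ->
  [/\ (k = delta %[mod p.-1])%N, (k = s n.+1 %[mod p ^ n.+1])%N & (n < k)%N].
Proof.
case=> d [/andP[d0 dp] sd ->]; split.
- have pX m : (p ^ m = 1 %[mod p.-1])%N.
    have p1 : (p = 1 %[mod p.-1])%N.
      have {1}-> : p = (p.-1 + 1)%N by lia.
      by rewrite modnDl.
    by rewrite -modnXm p1 modnXm exp1n.
  by rewrite -modnDmr -modnMmr pX modnMmr modnDmr muln1.
- by rewrite addnC modnMDl.
apply: (@leq_trans (d * p ^ n.+1)); last exact: leq_addl.
apply: (@leq_trans (p ^ n.+1)); first by rewrite ltnW// ltn_expl// prime_gt1.
by rewrite leq_pmull.
Qed.

End Exponent.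

Section Leopoldt.
Variables (p : nat) (p_pr : prime p) (p_odd : odd p).
Variables (K : fieldExtType (padic p_pr)) (v : valuation K).
Hypothesis v_ext : extends (fun x => x%:A) (padic_val p_pr) v.
Variables (pi : valring v) (pi_unif : v (\val pi) = 1).
Variables (F : finFieldType) (red : {rmorphism valring v -> F}).
Hypothesis red_surj : forall c, exists x, red x = c.
Hypothesis red_ker : forall x, red x = 0 <-> exists y, x = pi * y.
Variables (kappa : padic_int p_pr).
Hypothesis kappa_gen : topological_generator_1pZp kappa.
Variable (delta : 'Z_p.-1).
Local Notation Zp := (padic_int p_pr).
Local Notation O := (valring v).
Local Notation D := (@fps_D _).
Local Notation ziota := (ziota v_ext).
Local Notation E := (fps_1Xpow F (p_pr := p_pr)).
Local Notation x := (1 + fps_X).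

Let pcharF : p \in [pchar F] := residue_pchar v_ext pi_unif red_ker.

(* The defining congruences of [Gamma G = H] to the precision [p ^ m], at the
   points [kappa ^ s - 1] with [s] a natural number. *)
Definition leopoldt_mod (m : nat) (G H : fps O) : Prop :=
  forall s n k : nat, leopoldt_exponent delta (s%:R : Zp) n k -> (m <= n.+1)%N ->
    exists2 y : O,
      fps_value v (fps_map \val H) (\val (ziota (zpow kappa s%:R - 1))) (\val y) &
      exists r, y - iter k D G 0%N = p%:R ^+ m * r.

Lemma is_leopoldt_mod m G H : is_leopoldt kappa delta G H -> leopoldt_mod m G H.
Proof.
move=> GH s n k skn mn; have [y yH [r yr]] := GH _ _ _ skn.
exists y => //; exists (p%:R ^+ (n.+1 - m) * r).
by rewrite mulrA -exprD subnKC.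
Qed.

Lemma leopoldt_mod_linear m c G G' H H' :
  leopoldt_mod m G H -> leopoldt_mod m G' H' ->
  leopoldt_mod m (fps_const c * G + G') (fps_const c * H + H').
Proof.
move=> GH GH' s n k skn mn; have [y yH [r yr]] := GH _ _ _ skn mn.
have [y' yH' [r' yr']] := GH' _ _ _ skn mn.
exists (c * y + y').
  have -> : \val (c * y + y') = \val c * \val y + \val y' by rewrite rmorphD rmorphM.
  exact: fps_value_linear.
exists (c * r + r'); rewrite iter_fps_D_linear fps_coefD fps_coefC.
by rewrite mulrDr mulrCA -yr -yr'; ring.
Qed.

Lemma leopoldt_mod0 m G H : leopoldt_mod m G H ->
  (forall k, (m <= k)%N -> exists r, iter k D G 0%N = p%:R ^+ m * r) ->
  leopoldt_mod m 0 H.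
Proof.
move=> GH G0 s n k skn mn; have [y yH [r yr]] := GH _ _ _ skn mn.
have [_ _ nk] := leopoldt_exponentP p_odd skn.
exists y => //; have [r' r'E] := G0 k (leq_trans mn nk).
exists (r + r'); rewrite (fps_linear0 (iter_fps_D_linear k)) fps_coef0 subr0.
by rewrite mulrDr -yr r'E subrK.
Qed.

(** The points [kappa ^ s - 1] are distinct elements of [p Z_p], so values that vanish there to a
    fixed precision force the reduction to vanish modulo [T^R]. *)
Lemma leopoldt_mod0_red R : exists m, forall H,
  leopoldt_mod m 0 H -> eqT R (fps_map red H) 0.
Proof.
have t1 i : (zpow kappa i%:R - 1) 1%N = 0%N.
  have -> : (zpow kappa i%:R - 1) 1%N = (1 - 1 : Zp) 1%N.
    apply: zres_eqD => //; rewrite zpow_res1// (zres_nat p_pr 1) expn1.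
    by rewrite modn_small ?prime_gt1.
  by rewrite subrr zres0.
have t_inj : injective (fun i : nat => zpow kappa i%:R - 1 : Zp).
  move=> i j /addIr ij; pose n := maxn i j.
  have : (i%:R : Zp) n = (j%:R : Zp) n by apply: (zpow_inj kappa_gen); rewrite ij.
  have lt k : (k <= n)%N -> (k < p ^ n)%N.
    by move=> kn; apply: leq_ltn_trans kn (ltn_expl _ _); rewrite prime_gt1.
  by rewrite !zres_nat !modn_small ?lt ?leq_maxl ?leq_maxr.
have [m hm] := fps_values_red0 v_ext pi_unif red_ker R t1 t_inj.
exists m => H H0 k kR; rewrite fps_coef0 /=; apply: hm kR => s.
have [k' sk'] := leopoldt_exponent_ex p_odd delta (s%:R) m.
have [y yH [r yr]] := H0 _ _ _ sk' (leqnSn m).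
exists y => //; exists r; rewrite -yr.
by rewrite (fps_linear0 (iter_fps_D_linear k')) fps_coef0 subr0.
Qed.

Lemma leopoldt_red_unique G H H' :
  (forall m, leopoldt_mod m G H) -> (forall m, leopoldt_mod m G H') ->
  fps_map red H = fps_map red H'.
Proof.
move=> GH GH'; apply/eqP; rewrite -subr_eq0; apply/eqP; apply: eqT_eq => R.
have [m hm] := leopoldt_mod0_red R; rewrite -rmorphB; apply: hm.
have := leopoldt_mod_linear (-1) (GH' m) (GH m).
by rewrite rmorphN1 !mulN1r addNr addrC.
Qed.

Variable Gamma : fps O -> fps O.
Hypothesis Gamma_def : forall G, is_leopoldt kappa delta G (Gamma G).

Lemma Gamma_red_linear c G G' :
  fps_map red (Gamma (fps_const c * G + G')) =
  fps_const (red c) * fps_map red (Gamma G) + fps_map red (Gamma G').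
Proof.
rewrite -fps_map_const -rmorphM -rmorphD /=.
apply: (@leopoldt_red_unique (fps_const c * G + G')) => m.
  exact: is_leopoldt_mod.
by apply: leopoldt_mod_linear; apply: is_leopoldt_mod.
Qed.

Local Notation Gammabar := (fps_overline red Gamma).

Lemma Gammabar_linear : fps_linear Gammabar.
Proof. exact: (fps_overline_linear red_surj red_ker Gamma_red_linear). Qed.

Lemma Gammabar_map G : Gammabar (fps_map red G) = fps_map red (Gamma G).
Proof. exact: (fps_overline_map red_surj red_ker Gamma_red_linear). Qed.

(** [T^(p ^ m)] lifts to [x^(p ^ m) - 1], and the ideal generated by [p ^ m] and this element is
    stable under [D]; at [T = 0] its elements are divisible by [p ^ m]. *)
Lemma Gammabar_continuous : fps_continuous Gammabar.
Proof.
apply: (fps_linear_continuous Gammabar_linear) => R.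
have [m hm] := leopoldt_mod0_red R; exists (p ^ m)%N => f /eqT_dvdXn[f' ->].
have [G' <-] := fps_red_surj red_surj f'.
have -> : fps_X ^+ (p ^ m) * fps_map red G' =
    fps_map red ((x ^+ (p ^ m) - 1) * G').
  rewrite rmorphM rmorphB rmorphXn rmorphD !rmorph1 /= fps_map_X.
  by rewrite (x_pexp p_pr pcharF) addrC addKr.
rewrite Gammabar_map; apply: hm; apply: leopoldt_mod0 (is_leopoldt_mod (Gamma_def _)) _.
move=> k _; have [r] := iter_fps_D_ideal (p ^ m) k 0 G'.
by rewrite mulr0 add0r natrX; exists r.
Qed.

Lemma fps_red_xn n : fps_map red (x ^+ n) = x ^+ n.
Proof. by rewrite rmorphXn rmorphD rmorph1 /= fps_map_X. Qed.

Lemma fps_of_poly_xn n : fps_of_poly (('X + 1) ^+ n) = x ^+ n :> fps O.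
Proof. by rewrite rmorphXn rmorphD rmorph1 /= fps_of_polyX addrC. Qed.

(** [D^k] multiplies [x^a] by [a^k], which is divisible by [p ^ m] as soon as [k >= m]. *)
Lemma Gammabar_xn_p (a : nat) : (p %| a)%N -> Gammabar (x ^+ a) = 0.
Proof.
move=> /dvdnP[b ->].
rewrite -fps_red_xn Gammabar_map; apply: eqT_eq => R; have [m hm] := leopoldt_mod0_red R.
apply: hm; apply: leopoldt_mod0 (is_leopoldt_mod (Gamma_def _)) _ => k mk.
rewrite iter_fps_Dxn fps_coefC xn_coef0 mulr1 natrM exprMn mulrC.
by exists (p%:R ^+ (k - m) * b%:R ^+ k); rewrite mulrA -exprD subnKC.
Qed.

Lemma zpow_exp s k : zpow kappa s ^+ k = zpow kappa (s * k%:R).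
Proof.
elim: k => [|k IHk]; first by rewrite mulr0 (zpow_nat kappa_gen 0).
by rewrite exprSr IHk -natr1 mulrDr mulr1 zpowD.
Qed.

Lemma zteich_exp_eqmod i j k : ~~ (p %| i)%N -> (j = k %[mod p.-1])%N ->
  zteich p_pr i ^+ j = zteich p_pr i ^+ k.
Proof.
move=> pi_ jk; rewrite (divn_eq j p.-1) (divn_eq k p.-1) jk !exprD ![(_ * p.-1)%N]mulnC.
by rewrite !exprM zteich_order// !expr1n.
Qed.

(** With [omega] the Teichmueller representative of [j], the number [D^k (x^a) (0) = a^k] is close
    to [omega^delta * kappa^(l * s)], the value of [omega^delta * x^l] at [kappa^s - 1]. At
    precision [m] only the residue [l m] of [l] matters, which leaves a polynomial to evaluate. *)
Lemma Gammabar_xn_unit (a j : nat) l : ~~ (p %| j)%N ->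
  a%:R = zteich p_pr j * zpow kappa l ->
  Gammabar (x ^+ a) = fps_const (j%:R ^+ delta) * E l.
Proof.
move=> pj aE.
rewrite -fps_red_xn Gammabar_map; apply: eqT_eq => R; have [m0 hm0] := leopoldt_mod0_red R.
(* [m0] is the precision that determines the reduction modulo [T^R]; [R <= m] lets [x ^+ (l m)]
   stand for [E l] modulo [T^R]. *)
pose m := maxn R m0.
(* For the zero series the prescribed values do not depend on [k], so precision [m] implies
   precision [m0]. *)
have hm H : leopoldt_mod m 0 H -> eqT R (fps_map red H) 0.
  move=> H0; apply: hm0 => s n k skn m0n.
  have [k' sk'] := leopoldt_exponent_ex p_odd delta (s%:R) m.
  have [y yH [r yr]] := H0 _ _ _ sk' (leqnSn m).
  exists y => //; exists (p%:R ^+ (m - m0) * r).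
  rewrite mulrA -exprD subnKC ?leq_maxr// -yr.
  by rewrite !(fps_linear0 (iter_fps_D_linear _)).
pose w := zteich p_pr j ^+ delta.
pose H0 : fps O := fps_const (ziota w) * x ^+ (l m).
have redH0 : fps_map red H0 = fps_const (j%:R ^+ delta) * x ^+ (l m).
  rewrite rmorphM /= fps_map_const fps_red_xn /w.
  rewrite rmorphXn rmorphXn /= (red_ziota v_ext pi_unif red_ker) zteich_res1.
  by rewrite (natr_modp pcharF).
have H0P : leopoldt_mod m (x ^+ a) H0.
  move=> s n k skn mn; pose t := zpow kappa s%:R - 1 : Zp.
  exists (ziota (w * zpow kappa (s%:R * (l m)%:R))).
    have -> : H0 = fps_of_poly ((ziota w)%:P * ('X + 1) ^+ l m).
      by rewrite rmorphM /= fps_of_polyC fps_of_poly_xn.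
    have -> : ziota (w * zpow kappa (s%:R * (l m)%:R)) =
              ((ziota w)%:P * ('X + 1) ^+ l m).[ziota t].
      rewrite hornerM hornerC horner_exp hornerD hornerX hornerC.
      by rewrite -(rmorph1 ziota) -rmorphD /t subrK -rmorphXn /= zpow_exp [LHS]rmorphM.
    exact: fps_value_poly.
  rewrite iter_fps_Dxn fps_coefC xn_coef0 mulr1 -(rmorph_nat ziota a) -rmorphXn.
  apply: ziota_dvd; rewrite aE exprMn zpow_exp.
  have [kd ks _] := leopoldt_exponentP p_odd skn.
  rewrite (zteich_exp_eqmod pj kd); apply: zres_eqM => //.
  apply: zres_eqW (leqnSn _) _; apply: (zpow_eq kappa_gen); rewrite mulrC.
  apply: zres_eqM; first exact: zres_lift.
  by apply: zres_eqW mn _; rewrite [RHS]zres_nat ks zres_small.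
have := leopoldt_mod_linear (-1) H0P (is_leopoldt_mod (m := m) (Gamma_def (x ^+ a))).
rewrite rmorphN1 !mulN1r addNr => /hm; rewrite rmorphD rmorphN /= redH0 => h.
have {}h : eqT R (fps_map red (Gamma (x ^+ a))) (fps_const (j%:R ^+ delta) * x ^+ (l m)).
  move=> i iR; have := h i iR; rewrite fps_coefD fps_coefN fps_coef0 => /eqP.
  by rewrite addrC subr_eq0 => /eqP.
apply: eqT_trans h _; apply: eqTM => //.
apply: eqT_sym; apply: eqTW (pmono_eqT pcharF l (N := m)).
by apply: leq_trans (leq_maxl R m0) _; apply: leq_pexp.
Qed.

Lemma Gammabar_pmono_p (c : Zp) : c 1%N = 0%N -> Gammabar (E c) = 0.
Proof.
move=> c1; apply: eqT_eq => R; have [N hN] := Gammabar_continuous R.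
have := hN (E c) (x ^+ (c N.+1)).
rewrite Gammabar_xn_p; last by rewrite /dvdn -[(_ %% p)%N]/(_ %% p ^ 1)%N -zres_le// c1.
apply; apply: eqTW (pmono_eqT pcharF c (N := N.+1)).
by apply: leq_trans (leqnSn N) (leq_pexp _ _).
Qed.

(** By continuity the exponent [c] is replaced by the natural number [c N.+1]; its own logarithm
    [l'] agrees with [l] modulo [p ^ N], the passage to logarithms losing one digit. *)
Lemma Gammabar_pmono_unit j l : ~~ (p %| j)%N ->
  Gammabar (E (zteich p_pr j * zpow kappa l)) = fps_const (j%:R ^+ delta) * E l.
Proof.
move=> pj; apply: eqT_eq => R; have [N0 hN] := Gammabar_continuous R.
pose N := maxn N0 R; set c := zteich _ _ * _.
have c1 : c 1%N = (j %% p)%N.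
  rewrite -(zteich_res1 p_pr) -[in RHS](mulr1 (zteich p_pr j)).
  apply: zres_eqM => //.
  by rewrite zpow_res1// (zres_nat p_pr 1) expn1 modn_small ?prime_gt1.
have cN1 : ((c N.+1)%:R : Zp) 1%N = (j %% p)%N.
  by rewrite zres_nat -c1 -zres_le.
have [|l' l'E] := zunit_decomp kappa_gen (a := (c N.+1)%:R); first by rewrite cN1.
have h := hN (E c) (x ^+ (c N.+1)).
rewrite (@Gammabar_xn_unit _ (j %% p) l') in h; first last.
- by rewrite l'E cN1.
- by rewrite /dvdn modn_mod.
apply: eqT_trans (h _) _.
  apply: eqTW (pmono_eqT pcharF c (N := N.+1)).
  apply: leq_trans (leq_maxl N0 R) _.
  by apply: leq_trans (leqnSn N) (leq_pexp _ _).
rewrite (natr_modp pcharF); apply: eqTM => //.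
apply: (@eqTW _ _ (p ^ N)).
  by apply: leq_trans (leq_maxr N0 R) (leq_pexp _ _).
apply: (pmono_eq pcharF); apply: (zpow_inj kappa_gen).
have : (zteich p_pr j * zpow kappa l') N.+1 = (zteich p_pr j * zpow kappa l) N.+1.
  rewrite -(@zteich_eqmod _ p_pr (j %% p) j) ?modn_mod// -cN1 -l'E cN1.
  rewrite zres_lift /c; congr (zres (_ * _) _).
  by apply: zteich_eqmod; rewrite modn_mod.
(* The power [p.-2] of the Teichmueller factor is its inverse. *)
move=> /(zres_eqM (erefl ((zteich p_pr j ^+ p.-2) N.+1))).
rewrite !mulrA -exprSr (_ : (p.-2).+1 = p.-1) ?zteich_order ?mul1r//.
by have := prime_gt1 p_pr; lia.
Qed.

End Leopoldt.

(** * The operator U modulo pi *)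

Section SeriesSubstitution.
Variables (E : fieldType) (w : valuation E).
Implicit Types G A B : fps E.

Lemma fps_subst_uniq G A B B' :
  fps_subst w G A B -> fps_subst w G A B' -> B = B'.
Proof. by move=> GB GB'; apply/fpsP=> k; apply: vcvg_uniq (GB k) (GB' k). Qed.

Lemma fps_subst_linear c G G' A B B' :
  fps_subst w G A B -> fps_subst w G' A B' ->
  fps_subst w (fps_const c * G + G') A (fps_const c * B + B').
Proof.
move=> GB GB' k m; have [N hN] := vcvgD (vcvgZ c (GB k)) (GB' k) m.
exists N => n /hN; rewrite fps_coefD fps_coefC.
congr (vge _ _ (_ - _)); rewrite mulr_sumr -big_split; apply: eq_bigr => i _.
by rewrite fps_coefD fps_coefC mulrDl mulrA.
Qed.

Lemma fps_subst1 A : fps_subst w 1 A 1.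
Proof.
move=> k; apply: (@vcvg_eventually _ _ _ _ 1) => -[//|n] _.
rewrite big_ord_recl big1 ?addr0 => [|i _]; last by rewrite fps_coef1 mul0r.
by rewrite fps_coef1 mul1r.
Qed.

(** Each coefficient of [A * A ^+ i] is a finite combination of those of [A ^+ i], so the partial
    sums for [fps_X * G] are, up to a shift by one, finite combinations of those for [G] and
    converge with them. *)
Lemma fps_subst_XM G A B : fps_subst w G A B -> fps_subst w (fps_X * G) A (A * B).
Proof.
move=> GB k.
apply: (@vcvg_shift _ _ (fun n => \sum_(l < k.+1) A l * (\sum_(i < n) G i * (A ^+ i) (k - l)%N))).
  move=> n; rewrite big_ord_recl fps_coefXM mul0r add0r.
  under [RHS]eq_bigr do rewrite mulr_sumr.
  rewrite exchange_big; apply: eq_bigr => i _.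
  rewrite lift0 fps_coefXM exprS fps_coefM mulr_sumr.
  by apply: eq_bigr => l _; rewrite mulrCA.
by rewrite fps_coefM; apply: vcvg_sum => l; apply: vcvgZ.
Qed.

Lemma fps_subst_xnM G A B n :
  fps_subst w G A B -> fps_subst w ((1 + fps_X) ^+ n * G) A ((1 + A) ^+ n * B).
Proof.
move=> GB; elim: n => [|n IHn]; first by rewrite !mul1r.
rewrite !exprS -!mulrA !mulrDl !mul1r.
have := fps_subst_linear 1 IHn (fps_subst_XM IHn).
by rewrite rmorph1 !mul1r.
Qed.

End SeriesSubstitution.

Section UOperator.
Variables (p : nat) (p_pr : prime p).
Variables (K : fieldExtType (padic p_pr)) (v : valuation K).
Variables (L : fieldExtType K) (w : valuation L).
Variables (z : L) (z_prim : p.-primitive_root z).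
Local Notation O := (valring v).
Local Notation x := (1 + fps_X).

Definition valring_emb (c : O) : L := (\val c)%:A.
Fact valring_emb_additive : zmod_morphism valring_emb.
Proof. by move=> a b; rewrite /valring_emb rmorphB scalerBl. Qed.
Fact valring_emb_multiplicative : monoid_morphism valring_emb.
Proof.
split=> [|a b]; first by rewrite /valring_emb rmorph1 scale1r.
by rewrite /valring_emb rmorphM; apply: (rmorphM (in_alg L)).
Qed.
HB.instance Definition _ :=
  GRing.isZmodMorphism.Build O L valring_emb valring_emb_additive.
HB.instance Definition _ :=
  GRing.isMonoidMorphism.Build O L valring_emb valring_emb_multiplicative.

Implicit Types G H : fps O.

Local Notation toL := (fps_map valring_emb).
Local Notation A j := (fps_const (z ^+ j) * x - 1).

Let AE j : 1 + A j = fps_const (z ^+ j) * x.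
Proof. by rewrite addrC subrK. Qed.

Lemma toL_inj : injective toL.
Proof.
move=> G G' GG'; apply/fpsP=> n; apply: val_inj.
have /= := congr1 (fun f : fps L => f n) GG'.
exact: (fmorph_inj (in_alg L)).
Qed.

Lemma toL_xn n : toL (x ^+ n) = x ^+ n.
Proof. by rewrite rmorphXn rmorphD rmorph1 /= fps_map_X. Qed.

Lemma is_U_uniq G H H' : is_U w z G H -> is_U w z G H' -> H = H'.
Proof.
move=> [B [GB HE]] [B' [GB' HE']]; apply: toL_inj.
rewrite [LHS]HE [RHS]HE'; congr (_ - _ * _); apply: eq_bigr => j _.
exact: fps_subst_uniq (GB j) (GB' j).
Qed.

Lemma is_U_linear c G G' H H' : is_U w z G H -> is_U w z G' H' ->
  is_U w z (fps_const c * G + G') (fps_const c * H + H').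
Proof.
move=> [B [GB HE]] [B' [GB' HE']].
have {}HE : toL H = toL G - fps_const p%:R^-1 * \sum_j B j := HE.
have {}HE' : toL H' = toL G' - fps_const p%:R^-1 * \sum_j B' j := HE'.
pose cL := fps_const (valring_emb c).
exists (fun j => cL * B j + B' j); split=> [j|].
  rewrite -[fps_map _ _]/(toL (fps_const c * G + G')) rmorphD rmorphM /= fps_map_const.
  exact: fps_subst_linear.
rewrite -[LHS]/(toL (fps_const c * H + H')) -[fps_map _ (_ + G')]/(toL (fps_const c * G + G')).
rewrite !rmorphD !rmorphM /= !fps_map_const -/cL big_split /= -mulr_sumr.
by rewrite HE HE'; ring.
Qed.

(** Each substitution multiplies [x] by some [z ^+ j], hence fixes [x ^+ p]. *)
Lemma is_U_xpM G H : is_U w z G H -> is_U w z (x ^+ p * G) (x ^+ p * H).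
Proof.
move=> [B [GB HE]].
have {}HE : toL H = toL G - fps_const p%:R^-1 * \sum_j B j := HE.
exists (fun j => x ^+ p * B j); split=> [j|].
  rewrite -[fps_map _ _]/(toL (x ^+ p * G)) rmorphM /= toL_xn.
  have := fps_subst_xnM p (GB j).
  rewrite AE exprMn -rmorphXn /= exprAC (prim_expr_order z_prim).
  by rewrite expr1n rmorph1 mul1r.
rewrite -[LHS]/(toL (x ^+ p * H)) -[fps_map _ (_ * G)]/(toL (x ^+ p * G)).
by rewrite !rmorphM /= toL_xn HE -mulr_sumr; ring.
Qed.

Lemma sum_root_pow (a : nat) :
  \sum_(j < p) (z ^+ j) ^+ a = if (p %| a)%N then p%:R else 0.
Proof.
rewrite (eq_bigr (fun j : 'I_p => (z ^+ a) ^+ j)) => [|j _]; last by rewrite exprAC.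
case: ifPn => pa.
  rewrite (eq_bigr (fun=> 1)) ?sumr_const ?card_ord// => j _.
  have /eqP-> : z ^+ a == 1 by rewrite -(prim_order_dvd z_prim).
  by rewrite expr1n.
have za : z ^+ a - 1 != 0 by rewrite subr_eq0 -(prim_order_dvd z_prim).
apply: (mulfI za); rewrite -subrX1 exprAC (prim_expr_order z_prim) expr1n.
by rewrite subrr mulr0.
Qed.

Lemma is_U_xn (a : nat) :
  is_U w z (x ^+ a : fps O) (if (p %| a)%N then 0 else x ^+ a).
Proof.
exists (fun j => fps_const ((z ^+ j) ^+ a) * x ^+ a); split=> [j|].
  rewrite -[fps_map _ _]/(toL (x ^+ a)) toL_xn.
  have := fps_subst_xnM a (fps_subst1 w (A j)).
  by rewrite AE exprMn -rmorphXn !mulr1.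
rewrite -[fps_map _ (x ^+ a)]/(toL (x ^+ a)) toL_xn -mulr_suml -rmorph_sum /=.
rewrite sum_root_pow mulrA -rmorphM; case: ifP => _.
  rewrite mulVf ?(prim_root_natf_neq0 z_prim)// rmorph1 mul1r subrr.
  exact: (rmorph0 toL).
by rewrite mulr0 rmorph0 mul0r subr0; apply: toL_xn.
Qed.

Variables (F : finFieldType) (red : {rmorphism O -> F}) (pi : O).
Hypothesis red_surj : forall c, exists x, red x = c.
Hypothesis red_ker : forall x, red x = 0 <-> exists y, x = pi * y.
Hypothesis pcharF : p \in [pchar F].
Variable U : fps O -> fps O.
Hypothesis U_def : forall G, is_U w z G (U G).
Local Notation Ubar := (fps_overline red U).
Local Notation E := (fps_1Xpow F (p_pr := p_pr)).

Lemma U_red_linear c G G' :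
  fps_map red (U (fps_const c * G + G')) =
  fps_const (red c) * fps_map red (U G) + fps_map red (U G').
Proof.
rewrite (is_U_uniq (U_def _) (is_U_linear c (U_def G) (U_def G'))).
by rewrite rmorphD rmorphM /= fps_map_const.
Qed.

Lemma Ubar_linear : fps_linear Ubar.
Proof. exact: (fps_overline_linear red_surj red_ker U_red_linear). Qed.

Lemma Ubar_map G : Ubar (fps_map red G) = fps_map red (U G).
Proof. exact: (fps_overline_map red_surj red_ker U_red_linear). Qed.

Lemma Ubar_xpM f : Ubar (x ^+ p * f) = x ^+ p * Ubar f.
Proof.
have [G <-] := fps_red_surj red_surj f.
have xE : x ^+ p = fps_map red (x ^+ p).
  by rewrite rmorphXn rmorphD rmorph1 /= fps_map_X.
rewrite [in LHS]xE -rmorphM !Ubar_map.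
by rewrite (is_U_uniq (U_def _) (is_U_xpM (U_def G))) rmorphM /= -xE.
Qed.

Lemma Ubar_evalM P f :
  Ubar (fps_eval (x ^+ p) P * f) = fps_eval (x ^+ p) P * Ubar f.
Proof.
rewrite !fps_evalE !mulr_suml (fps_linear_sum Ubar_linear).
apply: eq_bigr => i _; rewrite -!mulrA (fps_linearZ Ubar_linear).
congr (_ * _); elim: (nat_of_ord i) => [|n IHn]; first by rewrite !mul1r.
by rewrite exprS -!mulrA Ubar_xpM IHn.
Qed.

(** In characteristic [p], [T^p = x^p - 1], and the operator commutes with multiplication by [x^p];
    so it preserves the multiples of [T^(p * M)]. *)
Lemma Ubar_continuous : fps_continuous Ubar.
Proof.
apply: (fps_linear_continuous Ubar_linear) => M; exists (p ^ 1 * M)%N => f.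
case/eqT_dvdXn => g ->; rewrite exprM.
have -> : fps_X ^+ (p ^ 1) = fps_eval (x ^+ p) ('X - 1) :> fps F.
  rewrite rmorphB rmorph1 /= fps_evalX -[x ^+ p]/(x ^+ (p ^ 1)) (x_pexp p_pr pcharF).
  by rewrite addrC addKr.
rewrite -rmorphXn Ubar_evalM rmorphXn /= rmorphB rmorph1 /= fps_evalX.
rewrite -[x ^+ p]/(x ^+ (p ^ 1)) (x_pexp p_pr pcharF) [1 + _]addrC addrK -exprM.
apply: (@eqTW _ _ (p ^ 1 * M)); last exact: eqT_XnM.
by rewrite leq_pmull// expn_gt0 prime_gt0.
Qed.

Lemma Ubar_xn (a : nat) : Ubar (x ^+ a) = if (p %| a)%N then 0 else x ^+ a.
Proof.
have xE n : fps_map red (x ^+ n) = x ^+ n.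
  by rewrite rmorphXn rmorphD rmorph1 /= fps_map_X.
rewrite -{1}xE Ubar_map (is_U_uniq (U_def _) (is_U_xn a)).
by case: ifP => _; rewrite ?xE ?rmorph0.
Qed.

Lemma Ubar_pmono (c : padic_int p_pr) :
  Ubar (E c) = if c 1%N == 0%N then 0 else E c.
Proof.
apply: eqT_eq => R; have [N0 hN] := Ubar_continuous R.
pose N := maxn N0 R.
have cN : eqT (p ^ N.+1) (E c) (x ^+ (c N.+1)) := pmono_eqT pcharF c (N := N.+1).
have N0N : (N0 <= p ^ N.+1)%N.
  by apply: leq_trans (leq_pexp p_pr _); rewrite leqW// leq_maxl.
apply: eqT_trans (hN _ _ (eqTW N0N cN)) _; rewrite Ubar_xn.
rewrite /dvdn -[(_ %% p)%N]/(_ %% p ^ 1)%N -zres_le//.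
case: ifP => // _; apply/eqT_sym; apply: eqTW cN.
by apply: leq_trans (leq_pexp p_pr _); rewrite leqW// leq_maxr.
Qed.

Lemma fps_eval_pexp y (P : {poly F}) :
  fps_eval y P ^+ p = fps_eval (y ^+ p) (map_poly (fun c => c ^+ p) P).
Proof.
have pF := fps_pchar p_pr pcharF.
rewrite fps_evalE -(pFrobenius_autE pF) rmorph_sum /=.
have sM : (size (map_poly (fun c => c ^+ p) P) <= size P)%N by apply: size_poly.
rewrite fps_evalE (big_ord_widen _ (fun i => fps_const (map_poly (fun c => c ^+ p) P)`_i * (y ^+ p) ^+ i) sM) [RHS]big_mkcond.
apply: eq_bigr => i _; rewrite pFrobenius_autE exprMn -rmorphXn exprAC coef_poly ltn_ord.
case: ltnP => // si; have : (map_poly (fun c => c ^+ p) P)`_i = 0 by rewrite nth_default.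
by rewrite coef_poly ltn_ord => ->; rewrite rmorph0 mul0r.
Qed.

(** After multiplication by [Q ^+ p.-1] the denominator is [Q ^+ p], a polynomial in [x ^+ p], with
    which the operator commutes; the new numerator is a polynomial, and so is its image. *)
Lemma is_rational_Ubar f : is_rational f -> is_rational (Ubar f).
Proof.
case=> P [Q [Q0 QfP]].
pose Q1 := Q \Po ('X - 1).
have QE : fps_of_poly Q = fps_eval x Q1 by rewrite fps_of_polyE1X.
have QpE : fps_of_poly (Q ^+ p) = fps_eval (x ^+ p) (map_poly (fun c => c ^+ p) Q1).
  by rewrite rmorphXn /= QE fps_eval_pexp.
have : fps_of_poly (Q ^+ p) * f = fps_of_poly (Q ^+ p.-1 * P).
  by rewrite -(prednK (prime_gt0 p_pr)) /= exprSr !rmorphM -mulrA QfP.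
move=> /(congr1 Ubar); rewrite {1}QpE Ubar_evalM -QpE => h.
have [R RE] : exists R, Ubar (fps_of_poly (Q ^+ p.-1 * P)) = fps_of_poly R.
  rewrite fps_of_polyE1X (fps_linear_eval Ubar_linear).
  set S := _ \Po _; exists (\sum_(i < size S | ~~ (p %| i)%N) (S`_i)%:P * ('X + 1) ^+ i).
  rewrite rmorph_sum [RHS]big_mkcond; apply: eq_bigr => i _.
  rewrite Ubar_xn; case: ifP => _ /=; first by rewrite mulr0.
  by rewrite rmorphM /= fps_of_polyC rmorphXn rmorphD rmorph1 /= fps_of_polyX addrC.
exists R, (Q ^+ p); split; first by rewrite expf_neq0.
by rewrite h RE.
Qed.

End UOperator.

(** * Rational series with p-adic exponents *)

Section Dilation.
Variable F : fieldType.
Implicit Types (f g : fps F) (d m : nat).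

(** The series [f(X^m)] for [m > 0], given by its coefficients so that the Dirichlet convolution can
    be read off. *)
Definition fps_dil m f : fps F :=
  FPS (fun k => if (m %| k)%N then f (k %/ m)%N else 0).

Lemma fps_dil_XnM m d f : (0 < m)%N ->
  fps_dil m (fps_X ^+ d * f) = fps_X ^+ (d * m) * fps_dil m f.
Proof.
move=> m0; apply/fpsP=> k; rewrite fps_coefXnM.
rewrite -[LHS]/(if (m %| k)%N then (fps_X ^+ d * f) (k %/ m)%N else 0) fps_coefXnM.
rewrite leq_divRL// /=; case: leqP => [dk|]; last by rewrite if_same.
have [r ->] : exists r, k = (r + d * m)%N by exists (k - d * m)%N; rewrite subnK.
by rewrite addnK dvdn_addl ?dvdn_mull// divnDr ?dvdn_mull// mulnK// addnK.
Qed.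

Lemma fps_dilD m f g : fps_dil m (f + g) = fps_dil m f + fps_dil m g.
Proof. by apply/fpsP=> k; rewrite fps_coefD /=; case: ifP => _; rewrite ?addr0. Qed.

Lemma fps_dilN m f : fps_dil m (- f) = - fps_dil m f.
Proof. by apply/fpsP=> k; rewrite fps_coefN /=; case: ifP => _; rewrite ?oppr0. Qed.

Lemma fps_dil_poly m (P : {poly F}) : (0 < m)%N ->
  fps_dil m (fps_of_poly P) = fps_of_poly (P \Po 'X^m).
Proof. by move=> m0; apply/fpsP=> k; rewrite /= coef_comp_poly_Xn. Qed.

Lemma fps_dil_geom m d f : (0 < m)%N ->
  (1 - fps_X ^+ (d * m)) * fps_dil m f = fps_dil m ((1 - fps_X ^+ d) * f).
Proof. by move=> m0; rewrite !mulrBl !mul1r fps_dilD fps_dilN fps_dil_XnM. Qed.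

Lemma fps_1subXn_neq0 d : (0 < d)%N -> 1 - fps_X ^+ d != 0 :> fps F.
Proof.
move=> d0; apply/eqP => /(congr1 (fun f : fps F => f 0%N)).
rewrite fps_coefD fps_coefN fps_coef1 fps_coef0 -[fps_X ^+ d]mulr1 fps_coefXnM.
by rewrite leqNgt d0 subr0 => /eqP; rewrite oner_eq0.
Qed.

Lemma fps_prod_neq0 (I : finType) (P : pred I) (f : I -> fps F) :
  (forall i, f i != 0) -> \prod_(i | P i) f i != 0.
Proof.
move=> f0; elim/big_ind: _ => [|g h g0 h0|i _]; [exact: oner_neq0| |exact: f0].
by apply/eqP => /fps_mul_eq0[/eqP|/eqP]; apply/negP.
Qed.

Lemma fps_geom_ex d f : (0 < d)%N -> exists g, (1 - fps_X ^+ d) * g = f.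
Proof.
move=> d0; pose h : fps F := FPS (fun=> 1).
have h1 : (1 - fps_X ^+ 1) * h = 1.
  apply/fpsP=> -[|n]; rewrite mulrBl mul1r fps_coefD fps_coefN fps_coefXM fps_coef1 /=.
    by rewrite subr0.
  by rewrite subrr.
exists (fps_dil d h * f).
rewrite mulrA -[X in fps_X ^+ X]mul1n fps_dil_geom// h1 -[RHS]mul1r; congr (_ * _).
by rewrite -(rmorph1 (@fps_of_poly F)) fps_dil_poly// comp_polyC.
Qed.

(** The degree of [b] may be [d] itself, which happens after the substitution [x -> x^-1]; hence
    periodicity starts at index 1 only. *)
Lemma fps_periodic d f (b : {poly F}) k : (size b <= d.+1)%N ->
  (1 - fps_X ^+ d) * f = fps_of_poly b -> (0 < k)%N -> f (k + d)%N = f k.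
Proof.
move=> sb fb k0; have := congr1 (fun g : fps F => g (k + d)%N) fb.
rewrite mulrBl mul1r fps_coefD fps_coefN fps_coefXnM leq_addl addnK /=.
rewrite nth_default; first by move/eqP; rewrite subr_eq0 => /eqP.
by apply: leq_trans sb _; rewrite -add1n leq_add2r.
Qed.

Lemma fps_periodicM d f (b : {poly F}) k t : (size b <= d.+1)%N ->
  (1 - fps_X ^+ d) * f = fps_of_poly b -> (0 < k)%N -> f (k + t * d)%N = f k.
Proof.
move=> sb fb k0; elim: t => [|t IHt]; first by rewrite addn0.
by rewrite mulSn addnCA addnC (fps_periodic sb fb) ?IHt// addn_gt0 k0.
Qed.

(** The assumed identity is [\sum_j c_j A_j(X^(m_j)) = P / X^S] with denominators cleared. So this
    sum is a polynomial, whereas its coefficients are periodic from index 1 on: those of positive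
    index are 0. *)
Lemma dilation_relation (J : finType) d (b : J -> {poly F}) (A : J -> fps F)
    (m : J -> nat) (c : J -> F) S (P : {poly F}) :
  (0 < d)%N -> (forall j, (size (b j) <= d.+1)%N) ->
  (forall j, (1 - fps_X ^+ d) * A j = fps_of_poly (b j)) ->
  (forall j, (0 < m j)%N) ->
  \sum_j (c j)%:P * (b j \Po 'X^(m j)) * \prod_(l | l != j) (1 - 'X^(d * m l)) * 'X^S =
    P * \prod_l (1 - 'X^(d * m l)) ->
  forall k, (0 < k)%N -> \sum_j c j * fps_dil (m j) (A j) k = 0.
Proof.
move=> d0 sb Ab m0 rel k k0.
pose D l : fps F := 1 - fps_X ^+ (d * m l).
have DE l : fps_of_poly (1 - 'X^(d * m l)) = D l.
  by rewrite rmorphB rmorph1 rmorphXn /= fps_of_polyX.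
have AE j : D j * fps_dil (m j) (A j) = fps_of_poly (b j \Po 'X^(m j)).
  by rewrite fps_dil_geom// Ab fps_dil_poly.
pose W := \sum_j fps_const (c j) * fps_dil (m j) (A j).
have WP : fps_X ^+ S * W = fps_of_poly P.
  apply/eqP; rewrite -subr_eq0; apply/eqP.
  have Dn0 : \prod_l D l != 0.
    by apply: fps_prod_neq0 => l; rewrite fps_1subXn_neq0// muln_gt0 d0 m0.
  suff /fps_mul_eq0[/eqP|//] : \prod_l D l * (fps_X ^+ S * W - fps_of_poly P) = 0.
    by rewrite (negPf Dn0).
  apply/eqP; rewrite mulrBr subr_eq0 [_ * fps_of_poly P]mulrC.
  have <- : \prod_l fps_of_poly (1 - 'X^(d * m l)) = \prod_l D l.
    by apply: eq_bigr => l _; rewrite DE.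
  rewrite -rmorph_prod -rmorphM -rel rmorph_sum mulrCA mulr_sumr mulr_sumr.
  apply/eqP/eq_bigr => j _; rewrite !rmorphM !rmorph_prod /= -AE fps_of_polyC.
  rewrite rmorphXn /= fps_of_polyX (bigD1 j)//= DE; ring.
pose M := \prod_l m l.
(* The shift is a multiple of the common period [d * M] that leads beyond the degree of [P]. *)
have big : W (k + (size P).+1 * (d * M))%N = 0.
  have := congr1 (fun f : fps F => f (S + (k + (size P).+1 * (d * M)))%N) WP.
  rewrite fps_coefXnM leq_addr addKn => -> /=; apply: nth_default.
  have dM0 : (0 < d * M)%N by rewrite muln_gt0 d0 prodn_gt0.
  apply: leq_trans (leqnSn _) _; apply: leq_trans (leq_pmulr _ dM0) _.
  by rewrite addnA leq_addl.
rewrite -[RHS]big /W fps_coef_sum; apply: eq_bigr => j _; rewrite fps_coefC; congr (_ * _).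
have [t ->] : exists t, ((size P).+1 * (d * M) = m j * (t * d))%N.
  exists ((size P).+1 * \prod_(l | l != j) m l)%N.
  rewrite /M (bigD1 j)//= mulnA mulnC !mulnA; ring.
rewrite /= dvdn_addl ?dvdn_mulr//; case: ifP => // mk.
rewrite divnDl// mulKn// (fps_periodicM _ (sb j) (Ab j))// divn_gt0//.
exact: dvdn_leq.
Qed.

End Dilation.

(* The coefficients of [\sum_j c_j f_j(X ^ m_j)] form a Dirichlet convolution: look at the
   index [m_j * k] with [m_j] and then [k] minimal. *)
Lemma dirichlet_vanish (F : fieldType) (J : finType) (j0 : J) (A : bool -> fps F)
    (m : J -> nat) (s : J -> bool) (c : J -> F) :
  injective m -> (forall j, (0 < m j)%N) -> (forall j, c j != 0) ->
  (forall e k, (0 < k)%N ->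
     \sum_j c j * fps_dil (m j) (A (e (+) s j)) k = 0) ->
  forall e k, (0 < k)%N -> A e k = 0.
Proof.
move=> m_inj m0 c0 rel e k k0; apply/eqP/negPn/negP => Aek.
have ex : exists k, (0 < k)%N && ((A true k != 0) || (A false k != 0)).
  by exists k; rewrite k0; case: e Aek => ->; rewrite ?orbT.
have {e k k0 Aek} [k /andP[k0 Ak] min_k] := ex_minnP ex.
have A0 e i : (0 < i < k)%N -> A e i = 0.
  move=> /andP[i0 ik]; apply/eqP/negPn/negP => Ai.
  have := min_k i; rewrite i0 leqNgt ik; case: e Ai => -> /=; rewrite ?orbT; last by move/(_ isT).
  by move/(_ isT).
case: (arg_minnP m (P := predT) (i0 := j0)) => // j _ min_j.
have Aj e : A (e (+) s j) k = 0.
  have mk0 : (0 < m j * k)%N by rewrite muln_gt0 m0.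
  have := rel e _ mk0; rewrite (bigD1 j)//= big1 ?addr0 => [|i ij].
    by rewrite dvdn_mulr// mulKn// => /eqP; rewrite mulf_eq0 (negPf (c0 j)) => /eqP.
  case: ifP => [/dvdnP[q qE]|_]; last by rewrite mulr0.
  have mji : (m j < m i)%N.
    by rewrite ltn_neqAle min_j// andbT; apply: contraNneq ij => /m_inj->.
  rewrite qE mulnK// A0 ?mulr0//; apply/andP; split.
    by move: mk0; rewrite qE muln_gt0 => /andP[].
  rewrite ltnNge; apply/negP => kq.
  have := leq_mul mji kq; rewrite -(ltn_pmul2r k0) in mji.
  by rewrite -mulnC in qE; lia.
have := Aj (~~ s j); have := Aj (s j); rewrite addbb addNb addbb => f0 t0.
by move: Ak; rewrite f0 t0 eqxx.
Qed.

Lemma eq_divn_subn d m n : (0 < d)%N -> (m %/ d = n %/ d)%N -> (m - n < d)%N.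
Proof.
move=> d0 mn; apply: leq_ltn_trans (ltn_pmod m d0).
by rewrite {1}(divn_eq m d) mn leq_subLR leq_add2r leq_divM.
Qed.

(** * Simultaneous approximation of p-adic integers by small integers *)

Section Approximation.
Variables (p : nat) (p_pr : prime p).
Local Notation Zp := (padic_int p_pr).

Lemma zres_int0 (n : int) k : (n%:~R : Zp) k = 0%N -> (p ^ k %| `|n|)%N.
Proof.
case: n => n nk.
  by move: nk; rewrite -[(Posz n)%:~R]/(n%:R) zres_nat => /eqP.
have := zres_eqN (etrans (nk : (- n.+1%:R : Zp) k = _) (esym (zres0 p_pr k))).
by rewrite opprK oppr0 zres_nat zres0 => /eqP.
Qed.

Lemma zres_unitM0 (u a : Zp) M : u 1%N != 0%N -> a != 0 -> (u * a) M = 0%N ->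
  (M <= zval a)%N.
Proof.
move=> u1 a0 uaM; have u0 : u != 0.
  by apply: contraNneq u1 => ->; rewrite zres0.
have zu : zval u = 0%N by move: u1; rewrite zvalP// -ltnNge ltnS leqn0 => /eqP.
by have := zvalM u0 a0; rewrite zu add0n => <-; rewrite -zvalP ?mulf_neq0// uaM.
Qed.

(* Dirichlet's simultaneous approximation: among the multiples [u * alpha_i] mod [p ^ N]
   two fall into the same box, and the power of [p] dividing the difference of the
   multipliers is divided out. *)
Lemma simultaneous_approx (I : finType) (alpha : I -> Zp) (B M0 : nat) :
  exists (u : Zp) (M : nat) (n : I -> int),
  [/\ (M0 <= M)%N, u 1%N != 0%N,
      forall i, (u * alpha i) M = ((n i)%:~R : Zp) M &
      forall i, (`|n i| * B < p ^ M)%N].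
Proof.
(* The additional coordinate 1 approximates the multiplier itself; it will force [M0 <= M]. *)
pose a (i : option I) := if i is Some j then alpha j else 1.
(* [B'] boxes per coordinate serve both the bound [B] and, through the additional coordinate,
   [p ^ M0]. The number of families of boxes is [N], less than the number [p ^ N] of multipliers. *)
pose B' := (maxn B (p ^ M0)).+1.
pose N := (B' ^ #|{: option I}|)%N.
pose r (t : nat) i : nat := (t%:R * a i) N.
have box (t : 'I_(p ^ N)) i : (r t i * B' %/ p ^ N < B')%N.
  by rewrite ltn_divLR ?pexp_gt0// mulnC ltn_pmul2l// zres_lt.
pose f t := [ffun i => Ordinal (box t i)].
have /injectivePn[t1 [t2 t12 ft]] : ~~ injectiveb f.
  apply/negP => /injectiveP/leq_card; rewrite card_ord card_ffun card_ord.
  by rewrite leqNgt ltn_expl// prime_gt1.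
wlog lt : t1 t2 t12 ft / (t2 < t1)%N => [hw|].
  have : (t1 != t2 :> nat) by [].
  by rewrite neq_ltn => /orP[|] lt; [apply: (hw t2 t1)|apply: (hw t1 t2)]; rewrite // eq_sym.
pose n0 i : int := (r t1 i)%:Z - (r t2 i)%:Z.
have n0B i : (`|n0 i| * B' < p ^ N)%N.
  have := congr1 (fun g : {ffun option I -> 'I_B'} => g i : nat) ft.
  rewrite !ffunE /= /n0 => e.
  have [xy|/ltnW xy] := leqP (r t1 i) (r t2 i).
    by rewrite distnC distnEl// mulnBl; apply: eq_divn_subn; rewrite ?pexp_gt0.
  by rewrite distnEl// mulnBl; apply: eq_divn_subn; rewrite ?pexp_gt0.
pose u0 := (t1 - t2)%N.
have u0_gt0 : (0 < u0)%N by rewrite subn_gt0.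
have u0N : (u0 < p ^ N)%N by apply: leq_ltn_trans (leq_subr _ _) (ltn_ord t1).
have [u' pu' u0E] := pfactor_coprime p_pr u0_gt0.
set k := logn p u0 in u0E.
have kN : (k < N)%N.
  rewrite -(ltn_exp2l _ _ (prime_gt1 p_pr)); apply: leq_ltn_trans u0N.
  by rewrite dvdn_leq// u0E dvdn_mull.
pose M := (N - k)%N.
have NE : N = (k + M)%N by rewrite /M subnKC// ltnW.
have n0P i : exists2 n' : int, (`|n'| * B' < p ^ M)%N &
    ((u'%:R : Zp) * a i) M = (n'%:~R : Zp) M.
  have : (u0%:R * a i) N = ((n0 i)%:~R : Zp) N.
    have -> : (n0 i)%:~R = (r t1 i)%:R - (r t2 i)%:R :> Zp by rewrite /n0 rmorphB.
    rewrite natrB ?(ltnW lt)// mulrBl.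
    by apply: zres_eqD; [|apply: zres_eqN]; rewrite [RHS]zres_lift.
  move=> /zres_eqP[c cE].
  have nE : (n0 i)%:~R = p%:R ^+ k * (u'%:R * a i - p%:R ^+ M * c) :> Zp.
    rewrite mulrBr !mulrA -exprD -NE -natrX -natrM [(p ^ k * u')%N]mulnC -u0E cE.
    by rewrite addrK.
  have /dvdnP[q qE] : (p ^ k %| `|n0 i|)%N.
    by apply: zres_int0; rewrite nE -natrX zresM zres_nat modnn mul0n mod0n.
  have [n' n'E] : exists n' : int, n0 i = (p ^ k)%:Z * n'.
    have : ((p ^ k)%:Z %| n0 i)%Z by rewrite dvdzE qE dvdn_mull.
    by move=> /dvdzP[n' ->]; exists n'; rewrite mulrC.
  exists n'.
    have := n0B i; rewrite n'E abszM NE expnD absz_nat -mulnA.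
    by rewrite ltn_pmul2l// pexp_gt0.
  apply/zres_eqP; exists c.
  move: nE; rewrite n'E rmorphM /= -[(Posz _)%:~R]/((p ^ k)%:R) natrX.
  by move=> /(mulfI (pexp_neq0 p_pr k)) ->; rewrite subrK.
have u'1 : (u'%:R : Zp) 1%N != 0%N.
  by rewrite zres_nat expn1 -/(dvdn _ _) -prime_coprime.
pose n i := projT1 (cid2 (n0P (Some i))).
exists u'%:R, M, n; split.
(* The multiplier is a unit, so its own approximation [n'] is not 0 and
   [p ^ M0 < B' <= |n'| * B' < p ^ M]. *)
- have [n' n'B n'E] := n0P None.
  have n'0 : (0 < `|n'|)%N.
    rewrite lt0n absz_eq0; apply: contraNneq u'1 => n'0.
    rewrite mulr1 n'0 zres0 in n'E.
    by rewrite (zres_le (u'%:R) (_ : 1 <= M)%N) ?n'E ?mod0n// subn_gt0.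
  rewrite ltnW// -(ltn_exp2l _ _ (prime_gt1 p_pr)); apply: leq_ltn_trans n'B.
  apply: leq_trans (leq_pmull _ n'0); apply: leqW; exact: leq_maxr.
- by [].
- by move=> i; rewrite /n; case: cid2.
move=> i; rewrite /n; case: cid2 => n' /= n'B _; apply: leq_ltn_trans n'B.
by rewrite leq_mul2l leqW ?orbT// leq_maxl.
Qed.

End Approximation.

Section PolyDegree.
Variable F : fieldType.

Lemma size_polyM_leqS a b (P Q : {poly F}) :
  (size P <= a.+1)%N -> (size Q <= b.+1)%N -> (size (P * Q)%R <= (a + b).+1)%N.
Proof.
move=> sP sQ; apply: leq_trans (size_polyMleq _ _) _.
by have := leq_add sP sQ; lia.
Qed.

Lemma size_poly_sum_leq (I : Type) (r : seq I) (P : pred I) (f : I -> {poly F}) n :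
  (forall i, P i -> (size (f i) <= n)%N) -> (size (\sum_(i <- r | P i) f i)%R <= n)%N.
Proof.
move=> fn; elim/big_ind: _ => [|g h gn hn|i]; last exact: fn.
  by rewrite size_poly0.
by apply: leq_trans (size_polyD _ _) _; rewrite geq_max gn.
Qed.

Lemma size_poly_prod_leq (I : Type) (r : seq I) (P : pred I) (f : I -> {poly F}) (a : I -> nat) :
  (forall i, P i -> (size (f i) <= (a i).+1)%N) ->
  (size (\prod_(i <- r | P i) f i)%R <= (\sum_(i <- r | P i) a i).+1)%N.
Proof.
move=> fa; elim/big_rec2: _ => [|i s g Pi gs]; first by rewrite size_poly1.
by apply: size_polyM_leqS => //; apply: fa.
Qed.

Lemma size_1subXn n : (size (1 - 'X^n : {poly F})%R <= n.+1)%N.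
Proof.
apply: leq_trans (size_polyD _ _) _; rewrite size_polyN size_polyXn size_poly1.
by rewrite geq_max leqnn.
Qed.

Lemma size_comp_Xn_leq n d (P : {poly F}) :
  (size P <= d.+1)%N -> (size (P \Po 'X^n) <= (d * n).+1)%N.
Proof.
move=> sP; apply: leq_trans (size_comp_poly_leq _ _) _.
by rewrite size_polyXn ltnS leq_mul2r; apply/orP; right; move: sP; case: (size P).
Qed.

(** A polynomial in [x] is a polynomial in [T] of the same degree, so [N] coefficients settle it. *)
Lemma fps_eval_small_eq0 (Z : {poly F}) N : (size Z <= N)%N ->
  eqT N (fps_eval (1 + fps_X) Z) 0 -> Z = 0.
Proof.
move=> ZN; rewrite fps_eval1XE => Z0.
have ZX : Z \Po ('X + 1) = 0.
  apply/polyP=> i; rewrite coef0; have [iN|Ni] := ltnP i N.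
    by have := Z0 i iN; rewrite fps_coef0.
  apply: nth_default; apply: leq_trans Ni; apply: leq_trans ZN.
  have -> : 'X + 1 = 'X + 1%:P :> {poly F} by [].
  by rewrite size_comp_poly2// size_XaddC.
by rewrite -[Z]poly_shiftK ZX comp_poly0.
Qed.

End PolyDegree.

(** * The periodic part of a rational series over a finite field *)

Section PeriodicPart.
Import Pdiv.Ring Pdiv.RingMonic Pdiv.CommonRing.
Variable F : finFieldType.
Local Notation x := (1 + fps_X : fps F).

(** [F] is finite, so the remainders of the powers of ['X] modulo [Q] repeat. *)
Lemma dvdp_Xn_sub1 (Q : {poly F}) : Q != 0 ->
  exists e d, [/\ (0 < d)%N & exists C, 'X^e * ('X^d - 1) = Q * C].
Proof.
move=> Q0; pose T := 'rV[F]_(size Q).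
pose f (n : 'I_(#|{: T}|.+1)) : T := \row_(i < size Q) ('X^n %% Q)%R`_i.
have /injectivePn[n1 [n2 n12 fn]] : ~~ injectiveb f.
  by apply/negP => /injectiveP/leq_card; rewrite card_ord ltnn.
wlog lt : n1 n2 n12 fn / (n2 < n1)%N => [hw|].
  have : (n1 != n2 :> nat) by [].
  by rewrite neq_ltn => /orP[|] lt; [apply: (hw n2 n1)|apply: (hw n1 n2)]; rewrite // eq_sym.
exists n2, (n1 - n2)%N; split; first by rewrite subn_gt0.
have : ('X^n1 %% Q)%R = ('X^n2 %% Q)%R.
  apply/polyP=> i; have [iQ|Qi] := ltnP i (size Q).
    by have := congr1 (fun M : T => M 0 (Ordinal iQ)) fn; rewrite !mxE.
  by rewrite !nth_default// (leq_trans _ Qi)// ltnW// ltn_modp.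
move=> e; exists ('X^n1 %/ Q - 'X^n2 %/ Q)%R.
rewrite mulrBr -exprD subnKC ?(ltnW lt)// mulr1.
rewrite {1}(divp_eq 'X^n1 Q) {1}(divp_eq 'X^n2 Q) e; ring.
Qed.

(* Modulo Laurent polynomials in [x], a rational series is [a(x) / (1 - x^d)]. *)
Lemma rational_periodic_part (H : fps F) : is_rational H ->
  exists (d e : nat) (a R : {poly F}) (H0 : fps F),
  [/\ (0 < d)%N, (size a <= d)%N, (1 - x ^+ d) * H0 = fps_eval x a &
      x ^+ e * H = x ^+ e * H0 + fps_eval x R].
Proof.
case=> P [Q [Q0 QH]].
pose P1 := P \Po ('X - 1); pose Q1 := Q \Po ('X - 1).
have Q1H : fps_eval x Q1 * H = fps_eval x P1 by rewrite -!fps_of_polyE1X.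
have Q10 : Q1 != 0.
  by apply: contra_neq Q0 => Q10; rewrite -[Q]poly_unshiftK -/Q1 Q10 comp_poly0.
have [i [d [d0 [C CE]]]] := dvdp_Xn_sub1 Q10.
(* The exponent [i] is raised to the multiple [d * i] of [d]: since ['X^(d * i)] is 1 modulo
   ['X^d - 1], the remainder [a] of [N] can be given the factor ['X^(d * i)] without changing its
   class. *)
have [j ij] : exists j, (i + j = d * i)%N by exists (d * i - i)%N; rewrite subnKC// leq_pmull.
pose N := - ('X^j * C * P1).
have HN : x ^+ (d * i) * (1 - x ^+ d) * H = fps_eval x N.
  have : fps_eval x ('X^i * ('X^d - 1)) * H = fps_eval x (C * P1).
    by rewrite CE [Q1 * C]mulrC rmorphM -mulrA Q1H -rmorphM.
  rewrite rmorphM rmorphB rmorph1 /= !(fps_evalXn x) => h.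
  have -> : N = - ('X^j * (C * P1)) by rewrite /N mulrA.
  rewrite rmorphN rmorphM /= (fps_evalXn x) -h -ij exprD; ring.
have dm : 'X^d - 1 \is @monic F by rewrite monicXnsubC.
pose a := rmodp N ('X^d - 1); pose B := rdivp N ('X^d - 1).
have NE : N = B * ('X^d - 1) + a := rdivp_eq dm N.
pose G : {poly F} := \sum_(k < i) ('X^d) ^+ k.
have GE : 'X^(d * i) - 1 = ('X^d - 1) * G by rewrite exprM subrX1.
pose R := G * a - B.
have NE' : N = 'X^(d * i) * a + (1 - 'X^d) * R.
  have -> : 'X^(d * i) = 1 + ('X^d - 1) * G by rewrite -GE addrC subrK.
  by rewrite NE /R; ring.
pose y : fps F := fps_inv1X ^+ (d * i).
have xy : x ^+ (d * i) * y = 1 by rewrite -exprMn fps_inv1XE expr1n.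
exists d, (d * i)%N, a, R, (H - y * fps_eval x R); split=> //.
- rewrite -ltnS; have <- : size ('X^d - 1 : {poly F}) = d.+1 by rewrite size_XnsubC.
  by rewrite ltn_rmodp monic_neq0.
- have h : x ^+ (d * i) * ((1 - x ^+ d) * (H - y * fps_eval x R)) =
           x ^+ (d * i) * fps_eval x a.
    transitivity (x ^+ (d * i) * (1 - x ^+ d) * H - (x ^+ (d * i) * y) * ((1 - x ^+ d) * fps_eval x R)).
      by ring.
    rewrite HN NE' xy rmorphD !rmorphM rmorphB rmorph1 /= !(fps_evalXn x); ring.
  by have := congr1 ( *%R y) h; rewrite /= !(mulrA y) [y * _]mulrC xy !mul1r.
by rewrite mulrBr mulrA xy mul1r subrK.
Qed.

Lemma x_subXn_neq0 d : (0 < d)%N -> 1 - x ^+ d != 0.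
Proof.
move=> d0; have -> : 1 - x ^+ d = fps_eval x (1 - 'X^d).
  by rewrite rmorphB rmorph1 /= (fps_evalXn x).
apply/eqP => h; have : 1 - 'X^d = 0 :> {poly F}.
  by apply: (fps_eval_small_eq0 (leqnn _)); rewrite h.
move=> /(congr1 (fun P : {poly F} => P`_0)).
by rewrite coefB coef1 coefXn coef0 (ltn_eqF d0) subr0 => /eqP; rewrite oner_eq0.
Qed.

End PeriodicPart.

(** * From p-adic exponents to rational functions *)

Section Core.
Variables (p : nat) (p_pr : prime p) (F : finFieldType).
Hypothesis pcharF : p \in [pchar F].
Local Notation Zp := (padic_int p_pr).
Local Notation E := (fps_1Xpow F (p_pr := p_pr)).
Local Notation x := (1 + fps_X : fps F).

Section Relation.
Variables (J I : finType) (alpha : J -> Zp) (c : J -> F) (beta : I -> Zp) (g : I -> F).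
Variables (d : nat) (b : bool -> {poly F}) (Hs : bool -> fps F).
Hypothesis d_gt0 : (0 < d)%N.
Hypothesis size_b : forall e, (size (b e) <= d.+1)%N.
Hypothesis Hs_eq : forall e, (1 - x ^+ d) * Hs e = fps_eval x (b e).

(* The relation between power series only involves the exponents modulo [p ^ M]; as they
   are small, it is an identity between polynomials. *)
Lemma truncated_relation (M : nat) (y : J -> Zp) (m : J -> nat) (s : J -> bool)
    (bt : I -> Zp) (k : I -> nat) (S : nat) :
  \sum_j fps_const (c j) * fps_scale (y j) (Hs (s j)) =
    \sum_i fps_const (g i) * E (bt i) ->
  (forall j, (y j) M = ((m j)%:R : Zp) M) ->
  (forall j, (m j <= S)%N) ->
  (forall i, (S%:R + bt i) M = ((k i)%:R : Zp) M) ->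
  (forall i, (k i <= S + S)%N) ->
  (S * (d * #|J| + 3) < p ^ M)%N ->
  \sum_j (c j)%:P * (b (s j) \Po 'X^(m j)) *
     \prod_(l | l != j) (1 - 'X^(d * m l)) * 'X^S =
  (\sum_i (g i)%:P * 'X^(k i)) * \prod_l (1 - 'X^(d * m l)).
Proof.
move=> rel ym mS btk kS SM; apply/eqP; rewrite -subr_eq0; apply/eqP.
(* All terms have degree at most [d * #|J| * S + 2 * S]: at most [d * S] for the numerator or
   denominator of each index, [S] for ['X^S] on the left, [2 * S] for ['X^(k i)] on the right. *)
have {}SM : (d * #|J| * S + 3 * S < p ^ M)%N by rewrite -mulnDl mulnC.
apply: (@fps_eval_small_eq0 _ _ (p ^ M)).
  have sumS (P : pred J) : (\sum_(l | P l) d * m l <= d * #|J| * S)%N.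
    apply: (@leq_trans (\sum_(l : J) d * S)%N).
      by rewrite big_mkcond; apply: leq_sum => l _; case: ifP => // _; rewrite leq_mul2l mS orbT.
    by rewrite sum_nat_const mulnCA mulnA.
  have prodS (P : pred J) :
      (size (\prod_(l | P l) (1 - 'X^(d * m l)) : {poly F})%R
        <= (\sum_(l | P l) d * m l).+1)%N.
    by apply: size_poly_prod_leq => l _; apply: size_1subXn.
  apply: leq_trans (size_polyD _ _) _; rewrite size_polyN geq_max; apply/andP; split.
    apply: size_poly_sum_leq => j _.
    have s1 : (size ((c j)%:P * (b (s j) \Po 'X^(m j)))%R <= (d * m j).+1)%N.
      by apply: (@size_polyM_leqS _ 0) => //; [exact: size_polyC_leq1|exact: size_comp_Xn_leq].
    have s2 := prodS (fun l => l != j).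
    have s3 : (size ('X^S : {poly F}) <= S.+1)%N by rewrite size_polyXn.
    apply: leq_trans (size_polyM_leqS (size_polyM_leqS s1 s2) s3) _.
    apply: leq_ltn_trans SM; apply: leq_add; last exact: leq_pmull.
    by have := sumS predT; rewrite (bigD1 j).
  have s1 : (size (\sum_i (g i)%:P * 'X^(k i))%R <= (S + S).+1)%N.
    apply: size_poly_sum_leq => i _.
    apply: leq_trans (size_polyM_leqS (a := 0) (b := k i) _ _) _.
    - exact: size_polyC_leq1.
    - by rewrite size_polyXn.
    by rewrite add0n ltnS kS.
  apply: leq_trans (size_polyM_leqS s1 (prodS predT)) _.
  apply: leq_ltn_trans SM; rewrite addnC; apply: leq_add; first exact: sumS.
  by rewrite mulSn leq_add2l leq_pmull.
have ym' j : eqT (p ^ M) (x ^+ (m j)) (E (y j)).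
  by rewrite -(pmono_nat p_pr pcharF); apply: (pmono_eq pcharF).
have Dm l : eqT (p ^ M) (fps_eval x (1 - 'X^(d * m l))) (1 - E (y l) ^+ d).
  rewrite rmorphB rmorph1 /= (fps_evalXn x) mulnC exprM.
  by apply: eqTD => //; apply: eqTN; apply: eqTX.
have GE j : (1 - E (y j) ^+ d) * fps_scale (y j) (Hs (s j)) = fps_eval (E (y j)) (b (s j)).
  rewrite -(fps_scale_eval pcharF) -Hs_eq (fps_scale_mul pcharF); congr (_ * _).
  have -> : 1 - x ^+ d = fps_eval x (1 - 'X^d) by rewrite rmorphB rmorph1 /= (fps_evalXn x).
  by rewrite (fps_scale_eval pcharF) rmorphB rmorph1 /= (fps_evalXn (E (y j))).
pose D := \prod_l (1 - E (y l) ^+ d).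
pose V := \sum_j fps_const (c j) * fps_scale (y j) (Hs (s j)).
(* Modulo [T^(p ^ M)] both sides are [D * x ^+ S * V]: the left one because [GE] clears the
   denominators, the right one because [rel] turns [V] into a pseudo-polynomial. *)
have -> : (0 : fps F) = D * x ^+ S * V - D * x ^+ S * V by rewrite subrr.
rewrite rmorphB; apply: eqTD; last apply: eqTN.
  rewrite rmorph_sum /V mulr_sumr; apply: eqT_sum => j _.
  rewrite !rmorphM rmorph_prod /= fps_evalC (fps_evalXn x) fps_eval_comp (fps_evalXn x).
  have -> : D * x ^+ S * (fps_const (c j) * fps_scale (y j) (Hs (s j))) =
      fps_const (c j) * fps_eval (E (y j)) (b (s j)) *
      \prod_(l | l != j) (1 - E (y l) ^+ d) * x ^+ S.
    by rewrite -GE /D (bigD1 j)//=; ring.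
  apply: eqTM => //; apply: eqTM.
    by apply: eqTM => //; apply: eqT_eval.
  by apply: eqT_prod => l _; apply: Dm.
have -> : D * x ^+ S * V = (\sum_i fps_const (g i) * (x ^+ S * E (bt i))) * D.
  rewrite -mulrA mulrC /V rel mulr_sumr; congr (_ * _).
  by apply: eq_bigr => i _; rewrite mulrCA.
rewrite rmorphM rmorph_sum rmorph_prod /=.
apply: eqTM; last by apply: eqT_prod => l _; apply: Dm.
apply: eqT_sum => i _; rewrite rmorphM /= fps_evalC (fps_evalXn x); apply: eqTM => //.
rewrite -!(pmono_nat p_pr pcharF) -(pmonoD pcharF); apply: (pmono_eq pcharF).
exact/esym/btk.
Qed.

Hypothesis scale_Hs : forall e, fps_scale (-1 : Zp) (Hs e) = Hs (~~ e).
Hypothesis c_neq0 : forall j, c j != 0.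
Hypothesis alphaD : forall j j', alpha j + alpha j' != 0.
Hypothesis alphaB : forall j j', j != j' -> alpha j - alpha j' != 0.
Hypothesis rel : \sum_j fps_const (c j) * fps_scale (alpha j) (Hs false) =
  \sum_i fps_const (g i) * E (beta i).

(** [A e] is the expansion at [X = 0] of the fraction whose expansion at [X = 1] is [Hs e]. The
    truncated relation is an identity of fractions, so it holds for the [A e] too, where the
    Dirichlet convolution applies. *)
Lemma relation_vanish (j0 : J) (A : bool -> fps F) :
  (forall e, (1 - fps_X ^+ d) * A e = fps_of_poly (b e)) ->
  forall e k, (0 < k)%N -> A e k = 0.
Proof.
move=> Ab.
(* Beyond [M0] digits no nonzero [alpha j - alpha j'] or [alpha j + alpha j'] vanishes, nor does a
   unit multiple of it; this makes the [m j] positive and distinct. The case [j = j'] of the sum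
   gives positivity. *)
pose M0 := (\max_j \max_j' maxn (zval (alpha j - alpha j')%R) (zval (alpha j + alpha j')%R)).+1.
have zM0 j j' : (zval (alpha j - alpha j')%R < M0)%N && (zval (alpha j + alpha j')%R < M0)%N.
  rewrite /M0 !ltnS -geq_max.
  apply: leq_trans (leq_bigmax j).
  exact: (leq_bigmax (F := fun j' => maxn (zval (alpha j - alpha j')%R) (zval (alpha j + alpha j')%R)) j').
pose ab (i : J + I) := match i with inl j => alpha j | inr i => beta i end.
have [u [M [n [M0M u1 nP nB]]]] := simultaneous_approx ab (d * #|J| + 3) M0.
have uM0 a : a != 0 -> (zval a < M0)%N -> (u * a) M = 0%N -> False.
  move=> a0 aM0 /(zres_unitM0 u1 a0) Ma.
  by have := leq_ltn_trans (leq_trans M0M Ma) aM0; rewrite ltnn.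
pose nj j := n (inl j); pose m j := `|nj j|%N; pose s j := nj j < 0.
have njP j : (u * alpha j) M = ((nj j)%:~R : Zp) M := nP (inl j).
have nD j j' : nj j + nj j' != 0.
  apply/eqP => njj; have /andP[_ h] := zM0 j j'; apply: (uM0 _ (alphaD j j') h).
  rewrite mulrDr (zres_eqD (njP j) (njP j')) -rmorphD njj rmorph0; exact: zres0.
have m0 j : (0 < m j)%N.
  by rewrite lt0n absz_eq0; apply: contra_neq (nD j j) => ->; rewrite addr0.
have m_inj : injective m.
  move=> j j' mjj; apply/eqP/negPn/negP => jj'.
  have [njj|njj] : nj j = nj j' \/ nj j = - nj j'.
    by move: mjj; rewrite /m; lia.
    have /andP[h _] := zM0 j j'; apply: (uM0 _ (alphaB jj') h).
    rewrite mulrBr (zres_eqD (njP j) (zres_eqN (njP j'))) -rmorphB njj subrr rmorph0.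
    exact: zres0.
  by have := nD j j'; rewrite njj addNr eqxx.
apply: (dirichlet_vanish (s := s) j0 m_inj m0 c_neq0) => e.
(* Both [u] and [-u] are used: the change of sign exchanges [Hs false] and [Hs true] in every term,
   which yields the relation for both values of [e]. *)
pose v := if e then - u else u : Zp.
pose y j := if s j then - (u * alpha j) else u * alpha j : Zp.
(* Multiplication by [x ^+ S] makes the exponents on the right natural numbers, at most [S + S]. *)
pose S := \max_i `|n i|%N.
have nS i : (`|n i| <= S)%N by apply: (leq_bigmax i).
pose k i := absz (S%:Z + (if e then - n (inr i) else n (inr i))).

have nkE i : S%:Z + (if e then - n (inr i) else n (inr i)) = (k i)%:Z.
  by rewrite /k; have := nS (inr i); case: (e); lia.
apply: (dilation_relation (d := d) (b := fun j => b (e (+) s j)) (S := S)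
  (P := \sum_i (g i)%:P * 'X^(k i))) => //.
apply: (truncated_relation (M := M) (y := y) (m := m) (s := fun j => e (+) s j)
  (bt := fun i => v * beta i) (k := k) (S := S)).
- have := congr1 (fps_scale v) rel.
  rewrite !(fps_linear_sum (fps_scale_linear v)) => relv.
  transitivity (\sum_j fps_scale v (fps_const (c j) * fps_scale (alpha j) (Hs false))).
    apply: eq_bigr => j _; rewrite (fps_linearZ (fps_scale_linear v)) (fps_scaleA pcharF).
    congr (_ * _); rewrite /y /v.
    have sN (a : Zp) h : fps_scale (- a) (Hs h) = fps_scale a (Hs (~~ h)).
      by rewrite -scale_Hs (fps_scaleA pcharF a (-1)) mulrN1.
    by move: (e) (s j) => [] []; rewrite /= ?mulNr ?sN ?opprK.
  rewrite relv; apply: eq_bigr => i _.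
  by rewrite (fps_linearZ (fps_scale_linear v)) (fps_scale_pmono pcharF).
- move=> j; rewrite /y /m /s; case: ltP => nj0.
    rewrite (zres_eqN (njP j)) -rmorphN.
    by rewrite -[in LHS](ltz0_abs nj0).
  by rewrite (njP j) -[in LHS](gez0_abs nj0).
- by move=> j; apply: nS.
- move=> i.
  have -> : (k i)%:R = S%:R + (if e then - n (inr i) else n (inr i))%:~R :> Zp.
    by rewrite -[LHS]/((k i)%:Z%:~R) -nkE rmorphD.
  apply: zres_eqD => //; rewrite /v; case: (e).
    by rewrite mulNr rmorphN; apply: zres_eqN; apply: (nP (inr i)).
  exact: (nP (inr i)).
- by move=> i; rewrite /k; have := nS (inr i); case: (e); lia.
(* There is at least one index, so [S] is one of the [|n i|] and the bound [nB] applies to it. *)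
have card0 : (0 < #|{: J + I}|)%N by apply/card_gt0P; exists (inl j0).
by have [i0 SE] := bigop.eq_bigmax (fun i => `|n i|%N) card0; rewrite /S SE.
Qed.

End Relation.

(** The coefficient of index [d] of [a] equals [A d - A 0] and is 0 because [size a] is at most [d];
    so [A 0] vanishes with the others. *)
Lemma periodic_poly_eq0 (d : nat) (a : {poly F}) (A : fps F) : (size a <= d)%N ->
  (0 < d)%N -> (1 - fps_X ^+ d) * A = fps_of_poly a ->
  (forall k, (0 < k)%N -> A k = 0) -> a = 0.
Proof.
move=> ad d0 Aa A0.
have coefA k : a`_k = A k - (if (d <= k)%N then A (k - d)%N else 0).
  have : ((1 - fps_X ^+ d) * A) k = a`_k by rewrite Aa.
  by rewrite mulrBl mul1r fps_coefD fps_coefN fps_coefXnM => <-.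
have Az : A 0%N = 0.
  have := coefA d; rewrite leqnn subnn A0// nth_default// sub0r => /eqP.
  by rewrite eq_sym oppr_eq0 => /eqP.
apply/polyP=> k; rewrite coef0 coefA.
have A0' i : A i = 0 by case: i => [|i]; [exact: Az|exact: A0].
by rewrite !A0' if_same subrr.
Qed.

Lemma pseudo_polynomial_fin (f : fps F) : pseudo_polynomial p_pr f ->
  exists (n : nat) (g : 'I_n -> F) (beta : 'I_n -> Zp),
    f = \sum_i fps_const (g i) * E (beta i).
Proof.
case=> s ->; exists (size s), (fun i => (tnth (in_tuple s) i).1), (fun i => (tnth (in_tuple s) i).2).
by rewrite big_tnth.
Qed.

Lemma pseudo_polynomialD (f g : fps F) : pseudo_polynomial p_pr f ->
  pseudo_polynomial p_pr g -> pseudo_polynomial p_pr (f + g).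
Proof. by move=> [s ->] [t ->]; exists (s ++ t); rewrite big_cat. Qed.

Lemma pseudo_polynomialZM (c : F) (a : Zp) (f : fps F) : pseudo_polynomial p_pr f ->
  pseudo_polynomial p_pr (fps_const c * E a * f).
Proof.
move=> [s ->]; exists [seq (c * ca.1, a + ca.2) | ca <- s].
rewrite big_map mulr_sumr; apply: eq_bigr => ca _.
by rewrite rmorphM /= (pmonoD pcharF); ring.
Qed.

Lemma pseudo_polynomial1 : pseudo_polynomial p_pr (1 : fps F).
Proof.
by exists [:: (1, 0)]; rewrite big_seq1 (pmono0 p_pr pcharF) rmorph1 mulr1.
Qed.

Lemma pseudo_polynomial_mono (c : F) (a : Zp) : pseudo_polynomial p_pr (fps_const c * E a).
Proof. by exists [:: (c, a)]; rewrite big_seq1. Qed.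

Lemma pseudo_polynomial_sum (I : Type) (r : seq I) (h : I -> fps F) :
  (forall i, pseudo_polynomial p_pr (h i)) -> pseudo_polynomial p_pr (\sum_(i <- r) h i).
Proof.
move=> hP; elim: r => [|i r IHr]; first by exists [::]; rewrite !big_nil.
by rewrite big_cons; apply: pseudo_polynomialD.
Qed.

Lemma pseudo_polynomial_eval (a : Zp) (P : {poly F}) :
  pseudo_polynomial p_pr (fps_eval (E a) P).
Proof.
rewrite fps_evalE; apply: pseudo_polynomial_sum => i.
by rewrite (pmonoX pcharF); apply: pseudo_polynomial_mono.
Qed.

Lemma pseudo_polynomial_scale_laurent (a : Zp) (e : nat) (R : {poly F}) f :
  x ^+ e * f = fps_eval x R -> pseudo_polynomial p_pr (fps_scale a f).
Proof.
move=> fR; have -> : fps_scale a f = fps_const 1 * E (- (a * e%:R)) * fps_eval (E a) R.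
  have := congr1 (fps_scale a) fR; rewrite (fps_scale_mul pcharF) (fps_scale_xn pcharF).
  rewrite (fps_scale_eval pcharF) => <-.
  by rewrite rmorph1 mul1r mulrA -(pmonoD pcharF) addNr (pmono0 p_pr pcharF) mul1r.
exact/pseudo_polynomialZM/pseudo_polynomial_eval.
Qed.

(** The Laurent polynomial [H - H0] contributes a pseudo-polynomial to the combination, so the
    relation passes to the periodic part [H0], which then has to be 0. *)
Theorem scale_combination_laurent (J : finType) (j0 : J) (alpha : J -> Zp) (c : J -> F)
    (H : fps F) :
  is_rational H -> (forall j, c j != 0) ->
  (forall j j', alpha j + alpha j' != 0) ->
  (forall j j', j != j' -> alpha j - alpha j' != 0) ->
  pseudo_polynomial p_pr (\sum_j fps_const (c j) * fps_scale (alpha j) H) ->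
  exists e R, x ^+ e * H = fps_eval x R.
Proof.
move=> Hrat c0 aD aB Hpp.
have [d [e [a [R [H0 [d0 ad H0a HR]]]]]] := rational_periodic_part Hrat.
have H0pp : pseudo_polynomial p_pr (\sum_j fps_const (c j) * fps_scale (alpha j) H0).
  have -> : \sum_j fps_const (c j) * fps_scale (alpha j) H0 =
      \sum_j fps_const (c j) * fps_scale (alpha j) H +
      \sum_j fps_const (- c j) * E 0 * fps_scale (alpha j) (H - H0).
    rewrite -big_split; apply: eq_bigr => j _ /=.
    have -> : fps_scale (alpha j) (H - H0) = fps_scale (alpha j) H - fps_scale (alpha j) H0.
      have := fps_scale_linear (alpha j) (-1) H0 H.
      by rewrite rmorphN1 !mulN1r addrC => ->; rewrite addrC.
    rewrite (pmono0 p_pr pcharF) rmorphN /=; ring.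
  apply: pseudo_polynomialD => //; apply: pseudo_polynomial_sum => j.
  apply: pseudo_polynomialZM; apply: (@pseudo_polynomial_scale_laurent _ e R).
  by rewrite mulrBr HR addrC addKr.
have [n [g [beta rel]]] := pseudo_polynomial_fin H0pp.
(* The substitution [x -> x^-1] turns [a(x) / (1 - x^d)] into [- x^d a(x^-1) / (1 - x^d)], whose
   numerator may have degree [d]. *)
pose b (s : bool) : {poly F} := if s then - \sum_(k < d) (a`_k)%:P * 'X^(d - k) else a.
pose Hs (s : bool) := if s then fps_scale (-1 : Zp) H0 else H0.
have sb s : (size (b s) <= d.+1)%N.
  case: s => /=; last exact: leqW.
  rewrite size_polyN; apply: size_poly_sum_leq => k _.
  apply: leq_trans (size_polyM_leqS (a := 0) (b := d - k) _ _) _.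
  - exact: size_polyC_leq1.
  - by rewrite size_polyXn.
  by rewrite add0n ltnS leq_subr.
have xE k : x ^+ k = E k%:R by rewrite (pmono_nat p_pr pcharF).
have Hsb s : (1 - x ^+ d) * Hs s = fps_eval x (b s).
  case: s => //=.
  have : fps_scale (-1 : Zp) ((1 - x ^+ d) * H0) = fps_scale (-1 : Zp) (fps_eval x a) by rewrite H0a.
  rewrite (fps_scale_mul pcharF) (fps_scale_eval pcharF).
  have -> : 1 - x ^+ d = fps_eval x (1 - 'X^d) by rewrite rmorphB rmorph1 /= (fps_evalXn x).
  rewrite (fps_scale_eval pcharF) !rmorphB !rmorph1 /= (fps_evalXn x) (fps_evalXn (E (-1))).
  rewrite (pmonoX pcharF) mulN1r => h.
  have xNd : x ^+ d * E (- d%:R) = 1.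
    by rewrite xE -(pmonoD pcharF) subrr (pmono0 p_pr pcharF).
  transitivity (- (x ^+ d * ((1 - E (- d%:R)) * fps_scale (-1 : Zp) H0))).
    transitivity (- ((x ^+ d - x ^+ d * E (- d%:R)) * fps_scale (-1 : Zp) H0)); last by ring.
    by rewrite xNd; ring.
  rewrite h rmorphN rmorph_sum /=; congr (- _).
  have -> : fps_eval (E (-1)) a = \sum_(k < d) fps_const a`_k * E (-1) ^+ k.
    rewrite fps_evalE (big_ord_widen _ (fun k => fps_const a`_k * E (-1) ^+ k) ad).
    rewrite big_mkcond; apply: eq_bigr => k _; case: ltnP => // ak.
    by rewrite nth_default// rmorph0 mul0r.
  rewrite mulr_sumr; apply: eq_bigr => k _.
  rewrite rmorphM /= fps_evalC (fps_evalXn x) mulrCA; congr (_ * _).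
  rewrite (pmonoX pcharF) mulN1r !xE -(pmonoD pcharF) natrB//.
  exact: ltnW.
have sHs s : fps_scale (-1 : Zp) (Hs s) = Hs (~~ s).
  by case: s => //=; rewrite (fps_scaleA pcharF) mulrNN mulr1 (fps_scale1 p_pr pcharF).
pose A s := projT1 (cid (fps_geom_ex (fps_of_poly (b s)) d0)).
have Ab s : (1 - fps_X ^+ d) * A s = fps_of_poly (b s) by rewrite /A; case: cid.
have A0 := relation_vanish d0 sb Hsb sHs c0 aD aB rel j0 Ab.
have az := periodic_poly_eq0 ad d0 (Ab false) (A0 false).
have H00 : H0 = 0.
  have : (1 - x ^+ d) * H0 = 0 by rewrite H0a az rmorph0.
  by case/fps_mul_eq0 => // /eqP; rewrite (negPf (x_subXn_neq0 F d0)).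
by exists e, R; rewrite HR H00 mulr0 add0r.
Qed.

End Core.

(** * The theorem *)

Section Interpolate.
Variables (p : nat) (p_pr : prime p) (F : finFieldType).
Hypothesis pcharF : p \in [pchar F].
Local Notation x := (1 + fps_X : fps F).
Variable phi : nat -> fps F.
Hypothesis phi_eq : forall N l, eqT (p ^ N) (phi (l + p ^ N)%N) (phi l).

Let L (P : {poly F}) := \sum_(i < size P) fps_const P`_i * phi i.

Let LE n (P : {poly F}) : (size P <= n)%N -> L P = \sum_(i < n) fps_const P`_i * phi i.
Proof.
move=> sP; rewrite /L (big_ord_widen _ (fun i => fps_const P`_i * phi i) sP).
rewrite big_mkcond; apply: eq_bigr => i _; case: ltnP => // Pi.
by rewrite nth_default// rmorph0 mul0r.
Qed.

Let LD c P Q : L (c%:P * P + Q) = fps_const c * L P + L Q.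
Proof.
pose n := maxn (size P) (size Q).
have sPQ : (size (c%:P * P + Q)%R <= n)%N.
  apply: leq_trans (size_polyD _ _) _; rewrite geq_max leq_maxr andbT mul_polyC.
  by apply: leq_trans (size_scale_leq _ _) _; apply: leq_maxl.
rewrite (LE sPQ) (LE (leq_maxl _ _ : size P <= n)%N) (LE (leq_maxr _ _ : size Q <= n)%N).
rewrite mulr_sumr -big_split; apply: eq_bigr => i _ /=.
by rewrite coefD coefCM rmorphD rmorphM /=; ring.
Qed.

Let LXn q P : L ('X^q * P) = \sum_(i < size P) fps_const P`_i * phi (q + i)%N.
Proof.
have s : (size ('X^q * P)%R <= q + size P)%N.
  by apply: leq_trans (size_polyMleq _ _) _; rewrite size_polyXn.
rewrite (LE s) big_split_ord /= big1 ?add0r => [|i _]; last first.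
  by rewrite coefXnM ltn_ord rmorph0 mul0r.
by apply: eq_bigr => i _; rewrite coefXnM ltnNge leq_addr /= addKn.
Qed.

(** In characteristic [p], [(X - 1)^(p ^ N) = X^(p ^ N) - 1]; so [P - P'] has the form
    [X^(p ^ N) * W - W], and [phi_eq] says that [L] nearly kills it. *)
Let L_eqT N P P' : eqT (p ^ N) (fps_eval x P) (fps_eval x P') -> eqT (p ^ N) (L P) (L P').
Proof.
move=> PP'.
have [W WE] : exists W, P - P' = 'X^(p ^ N) * W - W.
  pose V := (P - P') \Po ('X + 1).
  have V0 i : (i < p ^ N)%N -> V`_i = 0.
    move=> iN; rewrite -[V`_i]/(fps_of_poly V i) -fps_eval1XE rmorphB.
    by rewrite fps_coefD fps_coefN PP'// subrr.
  pose V' : {poly F} := \poly_(i < size V) V`_(i + p ^ N).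
  have VE : V = 'X^(p ^ N) * V'.
    apply/polyP=> i; rewrite coefXnM; case: ltnP => [/V0//|Ni].
    rewrite coef_poly subnK//; case: ltnP => // sV; apply: nth_default.
    exact: leq_trans sV (leq_subr _ _).
  exists (V' \Po ('X - 1)).
  have -> : P - P' = V \Po ('X - 1).
    by rewrite /V poly_shiftK.
  rewrite VE rmorphM rmorphXn /= comp_polyX.
  suff -> : ('X - 1) ^+ (p ^ N) = 'X^(p ^ N) - 1 :> {poly F} by ring.
  have pP : p \in [pchar {poly F}] by rewrite pchar_poly.
  have pN : [pchar {poly F}].-nat (p ^ N)%N.
    by rewrite pnatX (eq_pnat _ (pcharf_eq pP)) pnat_id.
  by rewrite exprDn_pchar// exprNn_pchar// expr1n.
have -> : P = 1%:P * (P - P') + P' by rewrite mul1r subrK.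
rewrite LD WE -[X in eqT _ _ X]add0r; apply: eqTD => //.
have -> : 'X^(p ^ N) * W - W = (- 1)%:P * W + 'X^(p ^ N) * W.
  by rewrite rmorphN1 mulN1r addrC.
rewrite LD LXn rmorph1 rmorphN1 mulN1r mul1r /L -sumrN -big_split /=.
move=> k kN; rewrite fps_coef_sum fps_coef0; apply: big1 => i _.
by rewrite fps_coefD fps_coefN !fps_coefC addnC (phi_eq _ kN) addNr.
Qed.

Let T N (f : fps F) : {poly F} := (\poly_(i < p ^ N) f i) \Po ('X - 1).

Let T_eqT N f : eqT (p ^ N) f (fps_eval x (T N f)).
Proof. by rewrite /T -fps_of_polyE1X; apply: eqT_trunc. Qed.

(** Since [phi] is continuous in the exponent, its linear extension [L] to polynomials in [x] is
    continuous and passes to the limit. *)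
Lemma fps_operator_ex : exists A : fps F -> fps F,
  [/\ fps_linear A, fps_continuous A & forall l : nat, A (x ^+ l) = phi l].
Proof.
(* As [n < p ^ n], the truncation of [f] at order [p ^ n] settles the coefficient of index [n]. *)
pose A f : fps F := FPS (fun n => L (T n f) n).
have LT N N' f : (N <= N')%N -> eqT (p ^ N) (L (T N f)) (L (T N' f)).
  move=> NN'; apply: L_eqT; apply: eqT_trans (eqT_sym (@T_eqT N f)) _.
  by apply: eqTW (@T_eqT N' f); rewrite leq_pexp2l// prime_gt0.
have AT N f : eqT (p ^ N) (A f) (L (T N f)).
  move=> n nN; rewrite -[A f n]/(L (T n f) n).
  have [Nn|/ltnW nN'] := leqP N n; first by rewrite (LT N n).
  by rewrite (LT n N f nN')// ltn_expl// prime_gt1.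
exists A; split.
- move=> c f g; apply: (eqT_pexp p_pr) => N; apply: eqT_trans (AT N _) _.
  apply/eqT_sym; apply: eqT_trans (eqTD (eqTM (@eqT_refl _ (p ^ N) (fps_const c)) (AT N f)) (AT N g)) _.
  rewrite -LD; apply: L_eqT; rewrite rmorphD rmorphM /= fps_evalC.
  apply: eqT_trans _ (@T_eqT N _).
  by apply: eqTD; [apply: eqTM => //|]; apply/eqT_sym/T_eqT.
- move=> M; exists (p ^ M)%N => f g fg; apply: (@eqTW _ _ (p ^ M) _ _ (leq_pexp p_pr M)).
  apply: eqT_trans (AT M f) _; apply: eqT_sym; apply: eqT_trans (AT M g) _.
  apply: L_eqT; apply: eqT_trans (eqT_sym (@T_eqT M g)) _.
  by apply: eqT_trans (eqT_sym fg) _; apply: T_eqT.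
move=> l; apply: (eqT_pexp p_pr) => N; apply: eqT_trans (AT N _) _.
have -> : phi l = L ('X^l).
  rewrite -[X in L X]mulr1 LXn size_poly1 big_ord1 coef1 rmorph1 mul1r addn0.
  by [].
by apply: L_eqT; rewrite (fps_evalXn x); apply/eqT_sym/T_eqT.
Qed.

End Interpolate.

Section Rational.
Variables (p : nat) (p_pr : prime p) (F : finFieldType).
Hypothesis pcharF : p \in [pchar F].
Local Notation x := (1 + fps_X : fps F).
Local Notation E := (fps_1Xpow F (p_pr := p_pr)).

Lemma is_poly_eval (h : fps F) : is_poly h <-> exists R, h = fps_eval x R.
Proof.
split=> [[P ->]|[R ->]]; first by exists (P \Po ('X - 1)); rewrite fps_of_polyE1X.
by exists (R \Po ('X + 1)); rewrite fps_eval1XE.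
Qed.

Lemma is_rational_linear (c : F) (f g : fps F) :
  is_rational f -> is_rational g -> is_rational (f + fps_const c * g).
Proof.
move=> [P [Q [Q0 Qf]]] [P' [Q' [Q'0 Qg]]].
exists (Q' * P + c%:P * Q * P'), (Q * Q'); split; first exact: mulf_neq0.
rewrite rmorphD !rmorphM /= -Qf -Qg fps_of_polyC; ring.
Qed.

(** Numerator and denominator are reversed with respect to the same length [n], so that both acquire
    the factor [x ^+ n]. *)
Lemma is_rational_scaleN1 (f : fps F) :
  is_rational f -> is_rational (fps_scale (-1 : padic_int p_pr) f).
Proof.
move=> [P [Q [Q0 Qf]]].
pose P1 := P \Po ('X - 1); pose Q1 := Q \Po ('X - 1).
have Q1f : fps_eval x Q1 * f = fps_eval x P1 by rewrite -!fps_of_polyE1X.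
have Q10 : Q1 != 0.
  by apply: contra_neq Q0 => Q10; rewrite -[Q]poly_unshiftK -/Q1 Q10 comp_poly0.
pose n := maxn (size P1) (size Q1).
pose rv (R : {poly F}) : {poly F} := \sum_(i < n) (R`_i)%:P * 'X^(n - i).
have rvE (R : {poly F}) : (size R <= n)%N -> fps_eval x (rv R) = x ^+ n * fps_eval (E (-1)) R.
  move=> Rn; rewrite rmorph_sum.
  have -> : fps_eval (E (-1)) R = \sum_(k < n) fps_const R`_k * E (-1) ^+ k.
    rewrite fps_evalE (big_ord_widen _ (fun k => fps_const R`_k * E (-1) ^+ k) Rn).
    rewrite big_mkcond; apply: eq_bigr => k _; case: ltnP => // ak.
    by rewrite nth_default// rmorph0 mul0r.
  rewrite mulr_sumr; apply: eq_bigr => k _.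
  rewrite rmorphM /= fps_evalC (fps_evalXn x) mulrCA; congr (_ * _).
  rewrite (pmonoX pcharF) mulN1r -!(pmono_nat p_pr pcharF) -(pmonoD pcharF) natrB//.
  exact: ltnW.
have PN : fps_eval x (rv Q1) * fps_scale (-1 : padic_int p_pr) f = fps_eval x (rv P1).
  rewrite !rvE ?leq_maxl ?leq_maxr// -(fps_scale_eval pcharF) -mulrA.
  by rewrite -(fps_scale_mul pcharF) Q1f (fps_scale_eval pcharF).
exists (rv P1 \Po ('X + 1)), (rv Q1 \Po ('X + 1)); split; last first.
  by rewrite -!fps_eval1XE.
have coef_rv k : (k < n)%N -> (rv Q1)`_(n - k) = Q1`_k.
  move=> kn; rewrite coef_sum (bigD1 (Ordinal kn))//= coefCM coefXn eqxx mulr1.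
  rewrite big1 ?addr0// => i ik; rewrite coefCM coefXn.
  suff -> : (n - k == n - i)%N = false by rewrite mulr0.
  apply/negP => /eqP nki; case/negP: ik; apply/eqP/val_inj => /=.
  by have := ltn_ord i; lia.
apply: contra_neq Q10 => rv0.
have {}rv0 : rv Q1 = 0.
  by rewrite -[rv Q1]poly_shiftK rv0 comp_poly0.
apply/polyP=> k; rewrite coef0; have [kn|nk] := ltnP k n.
  by rewrite -coef_rv// rv0 coef0.
by apply: nth_default; apply: leq_trans nk; apply: leq_maxr.
Qed.

(** Equal exponents are collected and zero coefficients dropped, as the final relation needs
    distinct [alpha_j] and nonzero [c_j]. *)
Lemma pseudo_polynomial_normal (f : fps F) : pseudo_polynomial p_pr f ->
  exists (n : nat) (g : 'I_n -> F) (a : 'I_n -> padic_int p_pr),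
  [/\ injective a, forall i, g i != 0 & f = \sum_i fps_const (g i) * E (a i)].
Proof.
case=> s ->.
pose g a := \sum_(ca <- s | ca.2 == a) ca.1.
pose t := [seq a <- undup [seq ca.2 | ca <- s] | g a != 0].
exists (size t), (fun i => g (tnth (in_tuple t) i)), (tnth (in_tuple t)); split.
- by apply/tuple_uniqP; rewrite /= filter_uniq// undup_uniq.
- move=> i; have := mem_tnth i (in_tuple t).
  by rewrite /= mem_filter => /andP[].
rewrite -(big_tnth _ _ t predT (fun a => fps_const (g a) * E a)).
rewrite big_filter [RHS]big_mkcond.
transitivity (\sum_(a <- undup [seq ca.2 | ca <- s]) \sum_(ca <- s | ca.2 == a) fps_const ca.1 * E ca.2).
  rewrite (exchange_big_dep predT)//=; rewrite big_seq [RHS]big_seq.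
  apply: eq_bigr => ca cas; rewrite (big_rem ca.2) /= ?mem_undup ?map_f// eqxx.
  rewrite big_seq_cond big_pred0 ?addr0// => a.
  rewrite mem_rem_uniq ?undup_uniq// inE eq_sym.
  by case: eqP => //=; rewrite andbF.
apply: eq_bigr => a _.
have -> : \sum_(ca <- s | ca.2 == a) fps_const ca.1 * E ca.2 = fps_const (g a) * E a.
  by rewrite rmorph_sum mulr_suml; apply: eq_bigr => ca /eqP->.
by case: eqVneq => // ->; rewrite rmorph0 mul0r.
Qed.

End Rational.

(** * The equivalence, from the values of both operators on the series x^a *)

Section Main.
Variables (p : nat) (p_pr : prime p) (p_odd : odd p) (F : finFieldType).
Hypothesis pcharF : p \in [pchar F].
Variables (kappa : padic_int p_pr).
Hypothesis kappa_gen : topological_generator_1pZp kappa.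
Variable delta : nat.
Local Notation Zp := (padic_int p_pr).
Local Notation E := (fps_1Xpow F (p_pr := p_pr)).
Local Notation x := (1 + fps_X : fps F).
Variables (Phi Ub : fps F -> fps F).
Hypothesis Phi_lin : fps_linear Phi.
Hypothesis Phi_cts : fps_continuous Phi.
Hypothesis Phi_p : forall c : Zp, c 1%N = 0%N -> Phi (E c) = 0.
Hypothesis Phi_unit : forall (j : nat) l, ~~ (p %| j)%N ->
  Phi (E (zteich p_pr j * zpow kappa l)) = fps_const (j%:R ^+ delta) * E l.
Hypothesis Ub_lin : fps_linear Ub.
Hypothesis Ub_cts : fps_continuous Ub.
Hypothesis Ub_pmono : forall c : Zp, Ub (E c) = if c 1%N == 0%N then 0 else E c.

Let xE n : x ^+ n = E n%:R := esym (pmono_nat p_pr pcharF n).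
Local Notation N1 := (-1 : Zp).

Let scl (a : Zp) : fps_linear (fps_scale a : fps F -> fps F).
Proof. exact: fps_scale_linear. Qed.
Let scc (a : Zp) : fps_continuous (fps_scale a : fps F -> fps F).
Proof. exact: fps_scale_continuous. Qed.

Lemma res1_ndvd (c : Zp) : c 1%N != 0%N -> ~~ (p %| c 1%N)%N.
Proof.
move=> c1; rewrite gtnNdvd// ?lt0n//.
by have := zres_lt c 1; rewrite expn1.
Qed.

Lemma res1_opp (c : Zp) : ((- c) 1%N == 0%N) = (c 1%N == 0%N).
Proof.
have h (a : Zp) : a 1%N = 0%N -> (- a) 1%N = 0%N.
  move=> a1; have := zres_eqN (etrans a1 (esym (zres0 p_pr 1))).
  by rewrite oppr0 zres0.
by apply/eqP/eqP => /h; rewrite ?opprK.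
Qed.

Lemma natr_neq0 i : (0 < i < p)%N -> i%:R != 0 :> F.
Proof. by move=> /andP[i0 ip]; rewrite -(dvdn_pcharf pcharF) gtnNdvd. Qed.

Lemma Phi_Ub f : Phi (Ub f) = Phi f.
Proof.
move: f; apply: fps_linear_ext => //; first exact: fps_linear_comp.
  exact: fps_continuous_comp.
move=> a; rewrite xE Ub_pmono; case: eqP => // a1.
by rewrite (fps_linear0 Phi_lin) Phi_p.
Qed.

(** With [omega] the Teichmueller representative, [- omega(j) = omega(p - j)], and
    [(p - j)^delta = (-1)^delta j^delta] in [F]. *)
Lemma Phi_scaleN1 f : Phi (fps_scale N1 f) = fps_const ((-1) ^+ delta) * Phi f.
Proof.
move: f; apply: fps_linear_ext.
- exact: (fps_linear_comp Phi_lin (scl _)).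
- exact: (fps_continuous_comp Phi_cts (scc _)).
- exact: (fps_linear_comp (fps_linear_mul _) Phi_lin).
- exact: (fps_continuous_comp (fps_continuous_mul _) Phi_cts).
move=> a; rewrite (fps_scale_xn pcharF) mulN1r xE.
have [a1|a1] := eqVneq ((a%:R : Zp) 1%N) 0%N.
  by rewrite !Phi_p ?mulr0//; apply/eqP; rewrite res1_opp a1.
have [l lE] := zunit_decomp kappa_gen a1; set j := (_ : Zp) 1%N in lE a1.
have jp : (j < p)%N by have := zres_lt (a%:R : Zp) 1; rewrite expn1.
have nj : ~~ (p %| j)%N by rewrite gtnNdvd// lt0n.
have npj : ~~ (p %| p - j)%N by rewrite gtnNdvd//; move: a1 jp; rewrite -lt0n; lia.
have nlE : - (a%:R) = zteich p_pr (p - j) * zpow kappa l :> Zp.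
  by rewrite {1}lE -mulNr (zteichN p_pr p_odd (ltnW jp)).
rewrite nlE (Phi_unit l npj) [in RHS]lE (Phi_unit l nj) mulrA.
rewrite -[fps_const _ * fps_const _]rmorphM -exprMn.
by rewrite natrB ?(ltnW jp)// (pcharf0 pcharF) sub0r mulN1r.
Qed.

Lemma Ub_scaleN1 f : Ub (fps_scale N1 f) = fps_scale N1 (Ub f).
Proof.
move: f; apply: fps_linear_ext.
- exact: (fps_linear_comp Ub_lin (scl _)).
- exact: (fps_continuous_comp Ub_cts (scc _)).
- exact: (fps_linear_comp (scl _) Ub_lin).
- exact: (fps_continuous_comp (scc _) Ub_cts).
move=> a; rewrite xE !Ub_pmono (fps_scale_pmono pcharF) mulN1r Ub_pmono res1_opp.
by case: ifP => _; [rewrite (fps_linear0 (scl _))|rewrite (fps_scale_pmono pcharF) mulN1r].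
Qed.

Lemma pseudo_polynomial_Phi (f : fps F) e (R : {poly F}) :
  x ^+ e * f = fps_eval x R -> pseudo_polynomial p_pr (Phi f).
Proof.
move=> fR; have -> : f = \sum_(i < size R) fps_const R`_i * E (i%:R - e%:R).
  have -> : f = E (- e%:R) * fps_eval x R.
    by rewrite -fR xE mulrA -(pmonoD pcharF) addNr (pmono0 p_pr pcharF) mul1r.
  rewrite fps_evalE mulr_sumr; apply: eq_bigr => i _.
  by rewrite xE mulrCA -(pmonoD pcharF) addrC.
rewrite (fps_linear_sum Phi_lin); apply: pseudo_polynomial_sum => i.
rewrite (fps_linearZ Phi_lin); set c := (_ - _).
have [c1|c1] := eqVneq (c 1%N) 0%N.
  by rewrite Phi_p// mulr0; exists [::]; rewrite big_nil.
have [l ->] := zunit_decomp kappa_gen c1.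
rewrite Phi_unit ?res1_ndvd// mulrA -rmorphM.
exact: pseudo_polynomial_mono.
Qed.

(** Twice the component of [Ub f] on which [x -> x^-1] acts by [(-1) ^+ delta]; it is even in the
    usual sense when [delta] is even. *)
Definition even_part (f : fps F) := Ub f + (-1) ^+ delta * Ub (fps_scale N1 f).

Lemma even_partE f :
  even_part f = Ub f + fps_const ((-1) ^+ delta) * fps_scale N1 (Ub f).
Proof. by rewrite /even_part Ub_scaleN1 rmorphXn rmorphN1. Qed.

Lemma pseudo_rational_of_laurent (f : fps F) e (R : {poly F}) :
  x ^+ e * even_part f = fps_eval x R -> pseudo_rational p_pr (Phi f).
Proof.
move=> /pseudo_polynomial_Phi; rewrite even_partE -Ub_scaleN1.
rewrite (fps_linearD Phi_lin) (fps_linearZ Phi_lin) !Phi_Ub Phi_scaleN1 mulrA -rmorphM /=.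
rewrite -exprMn mulrNN mulr1 expr1n rmorph1 mul1r => Ppp.
have two0 : 2%:R != 0 :> F.
  by apply: natr_neq0; rewrite /= odd_prime_gt2.
exists (fps_const 2%:R^-1 * E 0 * (Phi f + Phi f)), 1; split.
- exact: pseudo_polynomialZM.
- exact: pseudo_polynomial1.
- exact: oner_neq0.
have -> : Phi f + Phi f = fps_const 2%:R * Phi f.
  by rewrite (natrD _ 1 1) rmorphD rmorph1 mulrDl mul1r.
rewrite mul1r (pmono0 p_pr pcharF) mulr1 mulrA -rmorphM /=.
by rewrite mulVf// rmorph1 mul1r.
Qed.

(** The index [i.+1] runs over the nonzero residues modulo [p], and the factor [(i.+1)^-delta] is
    there to undo the [delta]-th power in [Phi_unit]. *)
Let phi (l : nat) : fps F :=
  \sum_(i < p.-1) fps_const ((i.+1)%:R ^- delta) * E (zteich p_pr i.+1 * kappa ^+ l).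

Let phiE (a : Zp) : fps F :=
  \sum_(i < p.-1) fps_const ((i.+1)%:R ^- delta) * E (zteich p_pr i.+1 * zpow kappa a).

Let phi_phiE l : phi l = phiE l%:R.
Proof. by apply: eq_bigr => i _; rewrite zpow_nat. Qed.

Let phiE_eq (a b : Zp) N : a N = b N -> eqT (p ^ N) (phiE a) (phiE b).
Proof.
move=> ab; apply: eqT_sum => i _; apply: eqTM => //; apply: (pmono_eq pcharF).
by apply: zres_eqM => //; apply: zres_eqW (leqnSn N) _; apply: (zpow_eq kappa_gen).
Qed.

(* On the powers [(1 + T) ^ l] the operator [Psi] inverts [Phi] up to symmetrization over
   the roots of unity of [Z_p]. *)
Lemma Psi_ex : exists Psi : fps F -> fps F,
  [/\ fps_linear Psi,
      forall a : Zp, Psi (E a) = \sum_(i < p.-1)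
        fps_const ((i.+1)%:R ^- delta) * E (zteich p_pr i.+1 * zpow kappa a),
      forall (a : Zp) f, Psi (E a * f) = fps_scale (zpow kappa a) (Psi f) &
      forall f, Psi (Phi f) = \sum_(i < p.-1)
        fps_const ((i.+1)%:R ^- delta) * fps_scale (zteich p_pr i.+1) (Ub f)].
Proof.
have [|Psi [lin cts PsiE]] := fps_operator_ex p_pr pcharF (phi := phi).
  move=> N l; rewrite !phi_phiE; apply: phiE_eq.
  by rewrite !zres_nat modnDr.
have PsiEa (a : Zp) : Psi (E a) = phiE a.
  apply: eqT_eq => R; have [N0 hN] := cts R; pose N := maxn N0 R.
  apply: eqT_trans (hN (E a) (x ^+ (a N)) _) _.
    apply: eqTW (pmono_eqT pcharF a (N := N)).
    by apply: leq_trans (leq_maxl N0 R) (leq_pexp p_pr _).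
  rewrite PsiE phi_phiE; apply: (@eqTW _ _ (p ^ N)).
    by apply: leq_trans (leq_maxr N0 R) (leq_pexp p_pr _).
  by apply: phiE_eq; rewrite zres_lift.
exists Psi; split=> //.
  move=> a f; move: f; apply: fps_linear_ext.
  - exact: (fps_linear_comp lin (fps_linear_mul _)).
  - exact: (fps_continuous_comp cts (fps_continuous_mul _)).
  - exact: (fps_linear_comp (scl _) lin).
  - exact: (fps_continuous_comp (scc _) cts).
  move=> l; rewrite xE -(pmonoD pcharF) !PsiEa (fps_linear_sum (scl _)).
  apply: eq_bigr => i _; rewrite (fps_linearZ (scl _)) (fps_scale_pmono pcharF).
  by rewrite (zpowD kappa_gen); congr (_ * E _); ring.
apply: fps_linear_ext.
- exact: (fps_linear_comp lin Phi_lin).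
- exact: (fps_continuous_comp cts Phi_cts).
- apply: fps_linear_bigsum => i.
  exact: (fps_linear_comp (fps_linear_mul _) (fps_linear_comp (scl _) Ub_lin)).
- apply: fps_continuous_bigsum => i.
  exact: (fps_continuous_comp (fps_continuous_mul _) (fps_continuous_comp (scc _) Ub_cts)).
move=> a; rewrite xE Ub_pmono.
have [a1|a1] := eqVneq ((a%:R : Zp) 1%N) 0%N.
  rewrite Phi_p// (fps_linear0 lin) big1// => i _.
  by rewrite (fps_linear0 (scl _)) mulr0.
have [l lE] := zunit_decomp kappa_gen a1; set j := (_ : Zp) 1%N in lE a1.
have jp : (j < p)%N by have := zres_lt (a%:R : Zp) 1; rewrite expn1.
have nj : ~~ (p %| j)%N by rewrite gtnNdvd// lt0n.
rewrite lE Phi_unit// (fps_linearZ lin) PsiEa /phiE mulr_sumr.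
pose G (i : nat) := fps_const (j%:R ^+ delta) *
  (fps_const (i%:R ^- delta) * E (zteich p_pr i * zpow kappa l)).
have ltm i : ((i * j) %% p < p)%N by rewrite ltn_mod prime_gt0.
(* Multiplication by [j] permutes the nonzero residues modulo [p]; replacing [i] by [i * j] absorbs
   the factor [j^delta] coming from [Phi]. *)
pose h (i : 'I_p) := Ordinal (ltm i).
have h_inj : injective h.
  move=> i i' /(congr1 val) /= /eqP hii; apply: val_inj => /=.
  wlog ii : i i' hii / (i' <= i)%N => [hw|].
    have [/hw|/ltnW/hw] := leqP i' i; first exact.
    by rewrite eq_sym => /(_ hii).
  move: hii; rewrite eqn_mod_dvd ?leq_mul2r ?ii ?orbT// -mulnBl Gauss_dvdl ?prime_coprime//.
  case: (posnP (i - i')) => [|ii0 /(dvdn_leq ii0)].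
    by move/eqP; rewrite subn_eq0 => ii' _; apply/eqP; rewrite eqn_leq ii'.
  by have := ltn_ord i; lia.
have shift (K : nat -> fps F) : \sum_(i < p.-1) K i.+1 = \sum_(i < p | i != 0%N :> nat) K i.
  rewrite -(big_mkord predT (fun i => K i.+1)) -(big_mkord (fun i => i != 0%N)).
  rewrite [RHS]big_ltn_cond ?prime_gt0//= -[in RHS](prednK (prime_gt0 p_pr)) big_add1 /=.
  by apply: eq_big_nat.
rewrite [LHS](shift G) (reindex_inj h_inj) /=.
rewrite (shift (fun i => fps_const (i%:R ^- delta) *
  fps_scale (zteich p_pr i) (E (zteich p_pr j * zpow kappa l)))).
apply: eq_big => [i|i i0].
  rewrite -/(dvdn _ _) Euclid_dvdM// (negPf nj) orbF.
  by rewrite /dvdn modn_small.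
rewrite /G (fps_scale_pmono pcharF) mulrA -rmorphM /= (natr_modp pcharF).
rewrite (@zteich_eqmod _ p_pr ((i * j) %% p) (i * j)) ?modn_mod// zteichM -mulrA.
congr (fps_const _ * _).
rewrite natrM exprMn invfM mulrCA divff ?mulr1// expf_neq0//.
by apply: natr_neq0; rewrite jp lt0n a1.
Qed.

(** Each root of unity is to be paired with its opposite. Only half of them remain as multipliers,
    so that no two exponents of the final relation are opposite. *)
Lemma zteich_sum_half (K : nat -> fps F) :
  \sum_(i < p.-1) K i.+1 = \sum_(i < p./2) (K i.+1 + K (p - i.+1)%N).
Proof.
have pE : p.-1 = (p./2 + p./2)%N by have := odd_double_half p; rewrite p_odd; lia.
rewrite big_split /= -(big_mkord predT (fun i => K i.+1)) pE.
rewrite (@big_cat_nat _ _ _ p./2) ?leq_addr//= !big_mkord; congr (_ + _).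
rewrite -{1}(add0n p./2) big_addn addnK big_nat_rev big_mkord /=.
apply: eq_bigr => i _; congr (K _); have := ltn_ord i; lia.
Qed.

(** The terms of [omega(i)] and of [omega(p - i) = - omega(i)] differ by [x -> x^-1] and the sign
    [(-1)^delta]. *)
Lemma fps_scale_even_part (a : Zp) i f : (i <= p)%N ->
  fps_scale a (fps_const (i%:R ^- delta) * fps_scale (zteich p_pr i) (Ub f) +
    fps_const ((p - i)%:R ^- delta) * fps_scale (zteich p_pr (p - i)) (Ub f)) =
  fps_const (i%:R ^- delta) * fps_scale (a * zteich p_pr i) (even_part f).
Proof.
move=> ip; set t := zteich p_pr i.
rewrite (zteichN p_pr p_odd ip) -/t even_partE.
have -> : (p - i)%:R ^- delta = i%:R ^- delta * (-1) ^+ delta :> F.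
  have sgV : ((-1) ^+ delta)^-1 = (-1) ^+ delta :> F by rewrite -exprVn invrN1.
  by rewrite natrB// (pcharf0 pcharF) sub0r [(- i%:R) ^+ delta]exprNn invfM mulrC sgV.
rewrite (fps_linearD (scl a)) !(fps_linearZ (scl a)).
rewrite (fps_scaleA pcharF a t) (fps_scaleA pcharF a (- t)).
rewrite (fps_linearD (scl (a * t))) (fps_linearZ (scl (a * t))).
rewrite (fps_scaleA pcharF (a * t) N1) mulrN mulrN1 mulrDr mulrA.
by rewrite -[in RHS]rmorphM.
Qed.

Lemma laurent_of_pseudo_rational (f : fps F) : is_rational (Ub f) ->
  pseudo_rational p_pr (Phi f) -> exists e R, x ^+ e * even_part f = fps_eval x R.
Proof.
move=> Urat [P [Q [Ppp Qpp Q0 QP]]].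
have [n [g [a [a_inj g0 QE]]]] := pseudo_polynomial_normal Qpp.
have [Psi [lin PsiE PsiM PsiPhi]] := Psi_ex.
have p0 := prime_gt0 p_pr; have p1 := prime_gt1 p_pr.
have pE : p = (p./2 + p./2).+1 by have := odd_double_half p; rewrite p_odd; lia.
pose J : finType := ('I_n * 'I_p./2)%type.
(* Here [a] lists the exponents of [Q]. The residue of [alpha k] modulo [p] lies between 1 and
   [p./2], so the sum of two of them is never 0 modulo [p]. *)
pose alpha (k : J) : Zp := zpow kappa (a k.1) * zteich p_pr (k.2).+1.
pose c (k : J) : F := g k.1 * ((k.2).+1)%:R ^- delta.
have ip (i : 'I_p./2) : (i.+1 < p)%N by have := ltn_ord i; lia.
have j0 : J.
  have n0 : (0 < n)%N.
    rewrite lt0n; apply: contra_neq Q0 => n0; rewrite QE.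
    by apply: big1 => i _; have := ltn_ord i; rewrite {2}n0.
  have h0 : (0 < p./2)%N by have := odd_prime_gt2 p_odd p_pr; lia.
  exact: (Ordinal n0, Ordinal h0).
have alpha1 k : alpha k 1%N = (k.2).+1.
  rewrite /alpha mulrC; transitivity ((zteich p_pr (k.2).+1 * 1) 1%N).
    apply: zres_eqM => //; rewrite zpow_res1// (zres_nat p_pr 1) expn1.
    by rewrite modn_small.
  by rewrite mulr1 zteich_res1 modn_small.
apply: (@scale_combination_laurent _ p_pr _ pcharF J j0 alpha c).
- rewrite even_partE; apply: is_rational_linear => //.
  exact: is_rational_scaleN1.
- move=> k; rewrite mulf_neq0// invr_eq0 expf_neq0//; apply: natr_neq0.
  by rewrite ip.
- move=> k k'; apply/eqP => akk'.
  have : (alpha k + alpha k') 1%N = (0 : Zp) 1%N by rewrite akk'.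
  rewrite zresD !alpha1 zres0 expn1 modn_small//.
  by have := ltn_ord k.2; have := ltn_ord k'.2; lia.
- move=> k k' kk'; rewrite subr_eq0; apply: contra_neq kk' => akk'.
  have k2 : k.2 = k'.2.
    have : alpha k 1%N = alpha k' 1%N by rewrite akk'.
    by rewrite !alpha1 => -[] /val_inj.
  have t0 : zteich p_pr (k'.2).+1 != 0.
    apply/eqP => t0; have : zteich p_pr (k'.2).+1 1%N = (0 : Zp) 1%N by rewrite t0.
    by rewrite zteich_res1 zres0 modn_small.
  move: akk'; rewrite /alpha k2 => /(mulIf t0) akk'.
  have k1 : k.1 = k'.1.
    apply: a_inj; apply/padic_intP=> m; apply: (zpow_inj kappa_gen).
    by rewrite akk'.
  by case: k k' k1 k2 {akk' t0} => [? ?] [? ?] /= -> ->.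
have := congr1 Psi QP; rewrite QE mulr_suml (fps_linear_sum lin).
have -> : \sum_(i < n) Psi (fps_const (g i) * E (a i) * Phi f) =
    \sum_k fps_const (c k) * fps_scale (alpha k) (even_part f).
  rewrite -(pair_bigA _ (fun i k => fps_const (c (i, k)) * fps_scale (alpha (i, k)) (even_part f))) /=.
  apply: eq_bigr => i _; rewrite -mulrA (fps_linearZ lin) PsiM PsiPhi.
  rewrite (zteich_sum_half (fun k => fps_const (k%:R ^- delta) * fps_scale (zteich p_pr k) (Ub f))).
  rewrite (fps_linear_sum (scl (zpow kappa (a i)))) mulr_sumr; apply: eq_bigr => k _.
  by rewrite fps_scale_even_part ?(ltnW (ip k))// mulrA -rmorphM.
move=> ->; case: Ppp => s ->; rewrite (fps_linear_sum lin).
apply: pseudo_polynomial_sum => ca; rewrite (fps_linearZ lin) PsiE mulr_sumr.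
apply: pseudo_polynomial_sum => i; rewrite mulrA -rmorphM.
exact: pseudo_polynomial_mono.
Qed.

End Main.

Theorem theorem3p7
  (p : nat) (p_pr : prime p) (p_odd : odd p)
  (* K / Q_p finite, with its normalized valuation v *)
  (K : fieldExtType (padic p_pr)) (v : valuation K)
  (v_ext : extends (fun x => x%:A) (padic_val p_pr) v)
  (* uniformizer and residue field F = O_K / pi O_K *)
  (pi : valring v) (pi_unif : v (\val pi) = 1)
  (F : finFieldType) (red : {rmorphism valring v -> F})
  (red_surj : forall c, exists x, red x = c)
  (red_ker : forall x, red x = 0 <-> exists y, x = pi * y)
  (* an extension of K containing mu_p *)
  (L : fieldExtType K) (w : valuation L)
  (w_ext : extends (fun x => x%:A) v w)
  (z : L) (z_prim : p.-primitive_root z)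
  (kappa : padic_int p_pr) (kappa_gen : topological_generator_1pZp kappa)
  (delta : 'Z_p.-1)
  (U : fps (valring v) -> fps (valring v))
  (U_def : forall G, is_U w z G (U G))
  (Gamma : fps (valring v) -> fps (valring v))
  (Gamma_def : forall G, is_leopoldt kappa delta G (Gamma G))
  (f : fps F) (f_rat : is_rational f) :
  pseudo_rational p_pr (fps_overline red Gamma f) <->
  exists n : nat,
    is_poly ((1 + fps_X) ^+ n *
      (fps_overline red U f +
       (-1) ^+ delta *
         fps_overline red U (fps_comp f (fps_inv1X - 1)))).
Proof.
have pcharF := residue_pchar v_ext pi_unif red_ker.
have Phi_unit := Gammabar_pmono_unit p_odd v_ext pi_unif red_surj red_ker kappa_gen Gamma_def.
have Phi_p := Gammabar_pmono_p p_odd v_ext pi_unif red_surj red_ker kappa_gen Gamma_def.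
have Phi_lin := Gammabar_linear p_odd v_ext pi_unif red_surj red_ker kappa_gen Gamma_def.
have Phi_cts := Gammabar_continuous p_odd v_ext pi_unif red_surj red_ker kappa_gen Gamma_def.
have Ub_lin := Ubar_linear red_surj red_ker U_def.
have Ub_cts := Ubar_continuous z_prim red_surj red_ker pcharF U_def.
have Ub_pmono := Ubar_pmono z_prim red_surj red_ker pcharF U_def.
have Ub_rat := is_rational_Ubar z_prim red_surj red_ker pcharF U_def f_rat.
(* [fps_inv1X] is the series [x^-1], so the composition in the statement becomes
   [fps_scale (-1)]. *)
rewrite -(pmonoN1 p_pr pcharF); split.
  move=> /(laurent_of_pseudo_rational p_odd pcharF kappa_gen Phi_lin Phi_cts Phi_p Phi_unit
             Ub_lin Ub_cts Ub_pmono Ub_rat) [e [R eR]].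
  by exists e; apply/is_poly_eval; exists R.
move=> [n /is_poly_eval[R nR]].
exact: (pseudo_rational_of_laurent p_odd pcharF kappa_gen Phi_lin Phi_cts Phi_p Phi_unit
  Ub_lin Ub_cts Ub_pmono nR).
Qed.
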